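(* For any $\epsilon>0$, there is a probability kernel $g$ on a binary alphabet $A$ and a shift-invariant probability measure $\mu$ on $A^{\mathbb{Z}}$ compatible with $g$ such that $\sum_{j=1}^\infty\mathrm{Osc}_j(g)\in(1,1+\epsilon]$ and $\mu$ does not satisfy a Gaussian concentration bound (GCB). Moreover, $g$ can be chosen to satisfy $\lim_{j\to\infty}\mathrm{Var}_j(g)=0$ and $\inf_{a\in A,\,x\in\mathcal{X}^-}g(a|x)>0$.
   Context: $A$ is the alphabet with the discrete topology; $A^{\mathbb{Z}}$ has the product topology and the $\sigma$-algebra generated by cylinders; the shift is $(T\omega)_i=\omega_{i+1}$. For integers $i\le j$, $\omega_i^j=(\omega_i,\dots,\omega_j)$ (the empty string if $i>j$). $\mathcal{X}^-=A^{\{\dots,-2,-1\}}$. A probability kernel is a function $g:A\times\mathcal{X}^-\to[0,1]$ with $\sum_{s\in A}g(s|x)=1$ for all $x\in\mathcal{X}^-$; for a left-infinite sequence ending at another index $n-1$, $g(\cdot|\cdot)$ denotes the same function after re-indexing. A probability measure $\mu$ on $A^{\mathbb{Z}}$ is compatible with $g$ if for all $n\in\mathbb{Z}$, $a\in A$, and $\mu$-a.e. past $x=(\dots,x_{n-2},x_{n-1})$, the conditional probability under $\mu$ that the $n$-th coordinate equals $a$ given the $\sigma$-algebra generated by coordinates up to $n-1$ is $g(a|x)$. For $j\ge1$, $\mathrm{Osc}_j(g)=\sup\{\frac12\sum_{a\in A}|g(a|z)-g(a|z')|: z,z'\in\mathcal{X}^-,\ z_k=z'_k\ \forall k\ne -j\}$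 and $\mathrm{Var}_j(g)=\sup\{\frac12\sum_{a\in A}|g(a|z)-g(a|z')|: z,z'\in\mathcal{X}^-,\ z_k=z'_k\ \forall k\ge -j\}$. For $f:A^{n+1}\to\mathbb{R}$ and $0\le j\le n$, $\delta_j(f)=\sup\{|f(\omega_0^{j-1}a\,\omega_{j+1}^n)-f(\omega_0^{j-1}b\,\omega_{j+1}^n)|: a,b\in A,\ \omega\in A^{n+1}\}$. $\mathcal{L}=\bigcup_{n\ge0}\{f:A^{n+1}\to\mathbb{R}: \delta_j(f)<\infty,\ j=0,\dots,n\}$; such $f$ is viewed as a function of coordinates $0,\dots,n$, and $\|\underline{\delta}(f)\|_2^2=\sum_{j=0}^n\delta_j(f)^2$. A probability measure $\mu$ satisfies a Gaussian concentration bound (GCB) if there is a constant $C>0$ such that for all $f\in\mathcal{L}$, $\mathbb{E}_\mu[e^{f-\mathbb{E}_\mu[f]}]\le e^{C\|\underline{\delta}(f)\|_2^2}$ ($C$ independent of $f$ and $n$). *)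

(* Defs.v *)
From HB Require Import structures.
From mathcomp Require Import all_boot all_order all_algebra.
From mathcomp Require Import all_classical all_reals all_analysis.

Set Implicit Arguments.
Unset Strict Implicit.
Unset Printing Implicit Defensive.

Import Order.TTheory GRing.Theory Num.Theory.
Import numFieldNormedType.Exports.

Local Open Scope classical_set_scope.
Local Open Scope ring_scope.

(* A past x : nat -> A encodes (..., x_{-2}, x_{-1}): x k is the coordinate of
   index -(k + 1). *)
Definition past (A : Type) := nat -> A.

(* (..., w_{n-2}, w_{n-1}), re-indexed by the negative integers. *)
Definition past_before (A : Type) (n : int) (w : int -> A) : past A :=
  fun k => w (n - k.+1%:Z).

Definition shift (A : Type) (w : int -> A) : int -> A := fun i => w (i + 1).

Definition cylinders (A : Type) : set (set (int -> A)) :=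
  [set B | exists i j (eta : int -> A), i <= j /\
     B = [set w | forall k, i <= k <= j -> w k = eta k]].

(* A^Z with the sigma-algebra generated by the cylinders. *)
Definition biseq (A : pointedType) : measurableType _ :=
  g_sigma_algebraType (@cylinders A).

(* Generators of the sigma-algebra of the coordinates up to n - 1 (every subset
   of the discrete alphabet is measurable). *)
Definition coord_events_before (A : Type) (n : int) : set (set (int -> A)) :=
  [set B | exists (i : int) (S : set A), i < n /\ B = [set w | S (w i)]].

Section Kernels.
Context (R : realType) (A : finType).
Implicit Types (g : A -> past A -> R) (j : nat).

Definition is_kernel g :=
  (forall a x, 0 <= g a x <= 1) /\ (forall x, \sum_(a : A) g a x = 1).

Definition tv g (z z' : past A) : R :=
  2^-1 * \sum_(a : A) `|g a z - g a z'|.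

(* The coordinates of z and z' agree except possibly at the index -j. *)
Definition agree_off j (z z' : past A) := forall k : nat, k.+1 != j -> z k = z' k.

(* The coordinates of z and z' agree at the indices -j, ..., -1. *)
Definition agree_upto j (z z' : past A) := forall k : nat, (k.+1 <= j)%N -> z k = z' k.

Definition Osc g j : \bar R :=
  ereal_sup [set e | exists z z', agree_off j z z' /\ e = (tv g z z')%:E].

Definition Var g j : \bar R :=
  ereal_sup [set e | exists z z', agree_upto j z z' /\ e = (tv g z z')%:E].

End Kernels.

(* h is a version of the conditional probability mu(E | <<s G>>). *)
Definition is_cond_prob d (T : measurableType d) (R : realType)
    (mu : probability T R) (G : set (set T)) (E : set T) (h : T -> R) :=
  [/\ measurable_fun (setT : set (g_sigma_algebraType G)) h,
      mu.-integrable setT (EFin \o h) &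
      forall B : set T, <<s G >> B ->
        (\int[mu]_(w in B) (h w)%:E = mu (E `&` B))%E].

Section Measures.
Context (R : realType) (A : pointedType).
Implicit Type mu : probability (biseq A) R.

Definition shift_invariant mu :=
  forall B : set (biseq A), measurable B -> mu (@shift A @^-1` B) = mu B.

Definition compatible mu (g : A -> past A -> R) :=
  forall (n : int) (a : A), exists h : biseq A -> R,
    is_cond_prob mu (@coord_events_before A n) [set w | w n = a] h /\
    {ae mu, forall w : biseq A, h w = g a (past_before n w)}.

End Measures.

Section GCB.
Context (R : realType) (A : Type) (n : nat).
Implicit Type f : ('I_n.+1 -> A) -> R.

Definition subst_at (w : 'I_n.+1 -> A) (j : 'I_n.+1) (a : A) : 'I_n.+1 -> A :=
  fun k => if k == j then a else w k.

Definition delta f (j : 'I_n.+1) : \bar R :=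
  ereal_sup [set e | exists a b w,
    e = `|f (subst_at w j a) - f (subst_at w j b)|%:E].

Definition local_fun f := forall j, (delta f j < +oo)%E.

Definition delta_sqnorm f : R := \sum_(j < n.+1) (fine (delta f j)) ^+ 2.

(* f as a function of the coordinates 0, ..., n. *)
Definition on_coords f (w : int -> A) : R := f (fun k : 'I_n.+1 => w k%:Z).

End GCB.

Definition GCB (R : realType) (A : pointedType) (mu : probability (biseq A) R) :=
  exists2 C : R, 0 < C &
    forall (n : nat) (f : ('I_n.+1 -> A) -> R), local_fun f ->
      let F : biseq A -> R := on_coords f in
      ('E_mu[fun w => expR (F w - fine 'E_mu[F])]
         <= (expR (C * delta_sqnorm f))%:E)%E.

(* Main.v *)
(* With spins +1 and -1, a kernel is given by the conditional mean b of the next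
   spin.  Let chi be the response of the stationary mean spin to a constant
   external field.  Start from an increasing odd b of finite memory whose total
   oscillation slightly exceeds 1 and whose response is large.  Adding to b the
   average of the last N spins, with slope 1 / (2 chi) and saturated at a small
   level h, costs only 1 / (2 chi) in total oscillation, yet multiplies chi by
   at least 3/2 when h is small and then N is large.  Iterating, the oscillations
   added form a geometric series of sum at most 3 / (2 chi), and with h chosen
   small enough at each stage the kernels converge uniformly.  A Poisson equation
   for the mean spin shows that the variance of the sum of n spins is at least of
   order chi^2 n for some n, a bound that survives small uniform perturbations of
   the kernel.  A generalized limit of the stationary laws is therefore
   shift-invariant, compatible with the limit kernel, and has variances which are
   not O(n), whereas a Gaussian concentration bound forces O(n). *)
Require Import Defs.
From HB Require Import structures.
From mathcomp Require Import all_boot all_order all_algebra.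
From mathcomp Require Import all_classical all_reals all_analysis.
From mathcomp Require Import ring lra zify.

Import Order.TTheory GRing.Theory Num.Theory.
Import numFieldNormedType.Exports.

Local Open Scope classical_set_scope.
Local Open Scope ring_scope.

Set Implicit Arguments.
Unset Strict Implicit.
Unset Printing Implicit Defensive.

(** * Local functions of the past *)

(** With slope [(2 * chi)^-1] the cumulative response [A] of the new kernel obeys, up to errors,
    [A = chi + A / 2], whose solution is [2 * chi]; asking only for the factor 3/2 leaves room for
    the errors. Saturation is harmless because a feedback of size at most [h] moves the mean spin by
    about [h * chi], half of the level [2 * chi * h] at which clipping starts: clipping is
    exponentially rare in [N]. The remaining obstacle is the delay of the feedback, up to [N] steps,
    while the argument works with sums of responses over a finite horizon [T]; a pigeonhole argument
    finds a [T] at which [A] hardly grows during one delay. Up to the limit all kernels have finite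
    memory, so a stationary mean is the constant in a Poisson equation on a finite-dimensional
    space, and no invariant measure is required. A measure on sequences is built only once, from the
    limit functional. The total oscillation stays strictly above 1 in the limit because every
    feedback is increasing and so cannot cancel the oscillations of the starting kernel. *)

Lemma inj_linear_surj (F : fieldType) (V : vectType F) (f : V -> V) :
  linear f -> (forall v, f v = 0 -> v = 0) -> forall w, exists v, f v = w.
Proof.
move=> flin finj w.
pose fl : {linear V -> V} := HB.pack f (GRing.isLinear.Build F V V *:%R f flin).
have ker0 : lker (linfun fl) == 0%VS.
  apply/lker0P => x y; rewrite !lfunE /= => fxy.
  apply/eqP; rewrite -subr_eq0; apply/eqP/finj.
  by rewrite -[f]/(fl : V -> V) linearB /= fxy subrr.
exists ((linfun fl)^-1%VF w).
by rewrite -[RHS](lker0_lfunVK ker0) lfunE.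
Qed.

Definition scons (c : bool) (s : past bool) : past bool :=
  fun k => if k is k'.+1 then s k' else c.

Definition upd (s : past bool) (j : nat) (c : bool) : past bool :=
  fun k => if k == j then c else s k.

Lemma scons_upd c s j c' : scons c (upd s j c') = upd (scons c s) j.+1 c'.
Proof. by apply/funext => -[|k]. Qed.

Lemma upd_scons0 c s c' : upd (scons c s) 0 c' = scons c' s.
Proof. by apply/funext => -[|k]. Qed.

Lemma upd_eta (s : past bool) j : upd s j (s j) = s.
Proof. by apply/funext => k; rewrite /upd; case: eqP => [->|]. Qed.

Section LocalFunctions.
Context {R : realType}.
Local Notation obs := (past bool -> R).
Implicit Types (f g b : obs) (s : past bool).

Definition dep n f :=
  forall s s', (forall k, (k < n)%N -> s k = s' k) -> f s = f s'.

Definition loc f := exists n, dep n f.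

Definition spin (j : nat) : obs := fun s => if s j then 1 else -1.

Definition avg f : obs := fun s => (f (scons true s) + f (scons false s)) / 2.

Definition diff f : obs := fun s => (f (scons true s) - f (scons false s)) / 2.

(* [b s] is the conditional mean of the next spin, so that the probability of
   [true] after the past [s] is [(1 + b s) / 2]. *)
Definition tr b f : obs := avg f + b * diff f.

Definition incr f := forall s j, f (upd s j false) <= f (upd s j true).

Definition flip s : past bool := fun k => ~~ s k.

Definition odd_obs f := forall s, f (flip s) = - f s.

Lemma dep_le m n f : (m <= n)%N -> dep m f -> dep n f.
Proof. by move=> mn df s s' ss'; apply: df => k km; exact/ss'/(leq_trans km). Qed.

Lemma dep_common f g : loc f -> loc g -> exists n, dep n f /\ dep n g.
Proof.
move=> [n df] [m dg]; exists (maxn n m).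
by split; [apply: dep_le df; exact: leq_maxl|apply: dep_le dg; exact: leq_maxr].
Qed.

Lemma loc_map2 (h : R -> R -> R) f g :
  loc f -> loc g -> loc (fun s => h (f s) (g s)).
Proof.
by move=> lf lg; have [n [df dg]] := dep_common lf lg; exists n => s s' ss';
  rewrite (df s s')// (dg s s').
Qed.

Lemma loc_map (h : R -> R) f : loc f -> loc (fun s => h (f s)).
Proof. by move=> [n df]; exists n => s s' ss'; rewrite (df s s'). Qed.

Lemma loc_cst (c : R) : loc (cst c).
Proof. by exists 0%N. Qed.

Lemma loc0 : loc 0.
Proof. by exists 0%N. Qed.

Lemma loc1 : loc 1.
Proof. by exists 0%N. Qed.

Lemma locD f g : loc f -> loc g -> loc (f + g).
Proof. exact: (@loc_map2 +%R). Qed.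

Lemma locN f : loc f -> loc (- f).
Proof. exact: (@loc_map -%R). Qed.

Lemma locB f g : loc f -> loc g -> loc (f - g).
Proof. by move=> lf lg; apply: locD => //; exact: locN. Qed.

Lemma locM f g : loc f -> loc g -> loc (f * g).
Proof. exact: (@loc_map2 *%R). Qed.

Lemma locZ (c : R) f : loc f -> loc (c *: f).
Proof. exact: (@loc_map ( *%R c)). Qed.

Lemma loc_sum n (F : nat -> obs) :
  (forall i, loc (F i)) -> loc (\sum_(i < n) F i).
Proof.
move=> lF; elim: n => [|n IH]; first by rewrite big_ord0; exact: loc0.
by rewrite big_ord_recr; exact: locD.
Qed.

Lemma loc_spin j : loc (spin j).
Proof. by exists j.+1 => s s' ss'; rewrite /spin ss'. Qed.

Lemma dep_avg n f : dep n f -> dep n (avg f).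
Proof.
move=> df s s' ss'; rewrite /avg; congr (_ / _); congr (_ + _);
  by apply: df => -[|k] //= kn; apply: ss'; exact: ltnW.
Qed.

Lemma dep_diff n f : dep n f -> dep n (diff f).
Proof.
move=> df s s' ss'; rewrite /diff; congr (_ / _); congr (_ - _);
  by apply: df => -[|k] //= kn; apply: ss'; exact: ltnW.
Qed.

Lemma dep_tr n b f : dep n b -> dep n f -> dep n (tr b f).
Proof.
move=> db df s s' ss'; rewrite /tr !fctE /=.
by rewrite (db s s')// (dep_avg df ss') (dep_diff df ss').
Qed.

Lemma loc_avg f : loc f -> loc (avg f).
Proof. by case=> n df; exists n; exact: dep_avg. Qed.

Lemma loc_diff f : loc f -> loc (diff f).
Proof. by case=> n df; exists n; exact: dep_diff. Qed.

Lemma loc_tr b f : loc b -> loc f -> loc (tr b f).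
Proof.
by move=> lb lf; apply: locD; [exact: loc_avg|apply: locM => //; exact: loc_diff].
Qed.

Lemma loc_iter_tr b f n : loc b -> loc f -> loc (iter n (tr b) f).
Proof. by move=> lb lf; elim: n => //= n IH; exact: loc_tr. Qed.

Lemma loc_behead f : loc f -> loc (fun s => f (fun k => s k.+1)).
Proof. by case=> n df; exists n.+1 => s s' ss'; apply: df => k kn; exact: ss'. Qed.

Lemma loc_bounded f : loc f -> exists2 B : R, 0 <= B & forall s, `|f s| <= B.
Proof.
move=> [n df]; pose ext (w : n.-tuple bool) : past bool := nth false w.
exists (\sum_(w : n.-tuple bool) `|f (ext w)|); first exact: sumr_ge0.
move=> s; have -> : f s = f (ext [tuple of mkseq s n]).
  by apply: df => k kn; rewrite /ext /= nth_mkseq.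
by rewrite (bigD1 [tuple of mkseq s n])//= lerDl; exact: sumr_ge0.
Qed.

Lemma avgD f g : avg (f + g) = avg f + avg g.
Proof. by apply/funext => s; rewrite /avg !fctE; field. Qed.

Lemma diffD f g : diff (f + g) = diff f + diff g.
Proof. by apply/funext => s; rewrite /diff !fctE; field. Qed.

Lemma avgZ (c : R) f : avg (c *: f) = c *: avg f.
Proof. by apply/funext => s; rewrite /avg !fctE /GRing.scale /=; field. Qed.

Lemma diffZ (c : R) f : diff (c *: f) = c *: diff f.
Proof. by apply/funext => s; rewrite /diff !fctE /GRing.scale /=; field. Qed.

Lemma diff_spinS j : diff (spin j.+1) = 0.
Proof. by apply/funext => s; rewrite /diff /spin /= subrr mul0r. Qed.

Lemma trD b f g : tr b (f + g) = tr b f + tr b g.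
Proof. by rewrite /tr avgD diffD; ring. Qed.

Lemma trZ b (c : R) f : tr b (c *: f) = c *: tr b f.
Proof.
by apply/funext => s; rewrite /tr avgZ diffZ !fctE /GRing.scale /=; ring.
Qed.

Lemma trN b f : tr b (- f) = - tr b f.
Proof. by rewrite -scaleN1r trZ scaleN1r. Qed.

Lemma trB b f g : tr b (f - g) = tr b f - tr b g.
Proof. by rewrite trD trN. Qed.

Lemma tr_cst b (c : R) : tr b (cst c) = cst c.
Proof. by apply/funext => s; rewrite /tr /avg /diff !fctE /=; field. Qed.

Lemma iter_trD b n f g : iter n (tr b) (f + g) = iter n (tr b) f + iter n (tr b) g.
Proof. by elim: n => //= n ->; rewrite trD. Qed.

Lemma iter_trZ b n (c : R) f : iter n (tr b) (c *: f) = c *: iter n (tr b) f.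
Proof. by elim: n => //= n ->; rewrite trZ. Qed.

Lemma iter_trN b n f : iter n (tr b) (- f) = - iter n (tr b) f.
Proof. by rewrite -scaleN1r iter_trZ scaleN1r. Qed.

Lemma iter_trB b n f g : iter n (tr b) (f - g) = iter n (tr b) f - iter n (tr b) g.
Proof. by rewrite iter_trD iter_trN. Qed.

Lemma iter_tr_cst b n (c : R) : iter n (tr b) (cst c) = cst c.
Proof. by elim: n => //= n ->; rewrite tr_cst. Qed.

Lemma tr_addk b d f : tr (b + d) f = tr b f + d * diff f.
Proof. by rewrite /tr; ring. Qed.

Lemma avg_behead f : avg (fun s => f (fun k => s k.+1)) = f.
Proof. by apply/funext => s; rewrite /avg /=; field. Qed.

Lemma diff_behead f : diff (fun s => f (fun k => s k.+1)) = 0.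
Proof. by apply/funext => s; rewrite /diff subrr mul0r. Qed.

Lemma tr_behead b f : tr b (fun s => f (fun k => s k.+1)) = f.
Proof. by rewrite /tr avg_behead diff_behead mulr0 addr0. Qed.

Lemma tr_spinS b j : tr b (spin j.+1) = spin j.
Proof. exact: (tr_behead b (spin j)). Qed.

Lemma tr_spin0 b : tr b (spin 0) = b.
Proof. by apply/funext => s; rewrite /tr /avg /diff /spin !fctE /=; field. Qed.

Lemma trE b f s : tr b f s =
  (1 + b s) / 2 * f (scons true s) + (1 - b s) / 2 * f (scons false s).
Proof. by rewrite /tr /avg /diff !fctE /=; field. Qed.

(** A factor that ignores the newest spin is already known before the step, hence comes out of the
    conditional expectation. *)
Lemma tr_mulbehead b f g :
  tr b ((fun s => g (fun k => s k.+1)) * f) = g * tr b f.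
Proof. by apply/funext => s; rewrite /tr /avg /diff !fctE /=; field. Qed.

Lemma incr_scons f s : incr f -> f (scons false s) <= f (scons true s).
Proof. by move=> /(_ (scons true s) 0%N); rewrite !upd_scons0. Qed.

Section Monotone.
Context (b : obs) (b_le1 : forall s, `|b s| <= 1).

Lemma tr_le f g s : (forall s, f s <= g s) -> tr b f s <= tr b g s.
Proof.
move=> fg; have := b_le1 s; rewrite ler_norml => /andP[h1 h2].
rewrite !trE; apply: lerD; apply: ler_wpM2l => //; lra.
Qed.

Lemma iter_tr_le n f g : (forall s, f s <= g s) ->
  forall s, iter n (tr b) f s <= iter n (tr b) g s.
Proof. by elim: n => //= n IH fg s; apply: tr_le; exact: IH. Qed.

Lemma iter_tr_norm n f s :
  `|iter n (tr b) f s| <= iter n (tr b) (fun s => `|f s|) s.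
Proof.
rewrite ler_norml -[- iter _ _ _ s]/((- iter n (tr b) (fun s => `|f s|)) s) -iter_trN.
apply/andP; split; apply: iter_tr_le => {}s; last exact: ler_norm.
by rewrite !fctE lerNl; rewrite -normrN; exact: ler_norm.
Qed.

Lemma iter_tr_bound n f (B : R) : (forall s, `|f s| <= B) ->
  forall s, `|iter n (tr b) f s| <= B.
Proof.
move=> fB s; rewrite ler_norml; apply/andP; split.
  rewrite -[- B]/(cst (- B) s) -(iter_tr_cst b n).
  by apply: iter_tr_le => s'; have := fB s'; rewrite ler_norml => /andP[].
rewrite -[B]/(cst B s) -(iter_tr_cst b n).
by apply: iter_tr_le => s'; have := fB s'; rewrite ler_norml => /andP[].
Qed.

(** Attractiveness: raising a spin of the past raises both possible later values of [f] and shifts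
    probability towards the larger one. *)
Lemma tr_incr f : incr b -> incr f -> incr (tr b f).
Proof.
move=> bi fi s j; rewrite !trE !scons_upd.
have h1 := fi (scons true s) j.+1; have h2 := fi (scons false s) j.+1.
have h3 := bi s j.
have h4 : f (upd (scons false s) j.+1 false) <= f (upd (scons true s) j.+1 false).
  by rewrite -!scons_upd; exact: incr_scons.
move: (b_le1 (upd s j false)) (b_le1 (upd s j true)); rewrite !ler_norml.
move=> /andP[? ?] /andP[? ?].
nra.
Qed.

Lemma iter_tr_incr n f : incr b -> incr f -> incr (iter n (tr b) f).
Proof. by move=> bi fi; elim: n => //= n; exact: tr_incr. Qed.

End Monotone.

Lemma diff_incr f s : incr f -> 0 <= diff f s.
Proof.
move=> fi; by rewrite /diff divr_ge0// subr_ge0; exact: incr_scons.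
Qed.

Lemma incr_spin j : incr (spin j).
Proof. by move=> s k; rewrite /spin /upd; case: eqP => // _; lra. Qed.

Lemma incrD f g : incr f -> incr g -> incr (f + g).
Proof. by move=> fi gi s j; rewrite !fctE lerD. Qed.

Lemma incrZ (c : R) f : 0 <= c -> incr f -> incr (c *: f).
Proof. by move=> c0 fi s j; rewrite !fctE; exact: ler_wpM2l. Qed.

Lemma iter_tr_flip b n f : odd_obs b ->
  iter n (tr b) (fun s => f (flip s)) = fun s => iter n (tr b) f (flip s).
Proof.
move=> bo; have sf c s : flip (scons c s) = scons (~~ c) (flip s).
  by apply/funext => -[|k].
elim: n => //= n ->; apply/funext => s.
by rewrite !trE !sf /= bo; ring.
Qed.

End LocalFunctions.

#[local] Hint Resolve loc0 loc1 loc_cst locD locN locB locM locZ loc_sum loc_spin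
  loc_diff loc_tr loc_iter_tr : core.

(** * Stationary means and the Poisson equation *)

Section Ergodic.
Context {R : realType} (b : past bool -> R) (k : R) (k_gt0 : 0 < k)
  (b_loc : loc b) (b_le : forall s, `|b s| <= 1 - 2 * k).
Local Notation obs := (past bool -> R).
Implicit Types (f g U : obs) (s : past bool).

Definition osc_le f (r : R) := forall s s', f s - f s' <= r.

Let b_le1 s : `|b s| <= 1.
Proof. by have k0 := k_gt0; apply: (le_trans (b_le s)); lra. Qed.

Let b_bounds s : -1 + 2 * k <= b s <= 1 - 2 * k.
Proof. by have := b_le s; rewrite ler_norml => /andP[? ?]; apply/andP; split; lra. Qed.

Let k_le1 : k <= 1.
Proof. by have /andP[? ?] := b_bounds (fun=> false); lra. Qed.

(** Two copies can be coupled so that both next spins are [true] with probability at least [k]. *)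
Lemma tr_coupling f r : osc_le f r -> forall s s',
  tr b f s - tr b f s' <=
  (1 - k) * r + k * (f (scons true s) - f (scons true s')).
Proof.
move=> fr s s'; have k0 := k_gt0; rewrite !trE.
have /andP[? ?] := b_bounds s; have /andP[? ?] := b_bounds s'.
have := fr (scons true s) (scons true s').
have := fr (scons true s) (scons false s').
have := fr (scons false s) (scons true s').
have := fr (scons false s) (scons false s').
move: (f (scons true s)) (f (scons false s)) (f (scons true s'))
  (f (scons false s')) => f1 f2 g1 g2 h22 h21 h12 h11.
by case: (lerP g1 g2) => ?; nra.
Qed.

Lemma osc_le_tr f r : osc_le f r -> osc_le (tr b f) r.
Proof.
move=> fr s s'; apply: (le_trans (tr_coupling fr s s')).
have k0 := k_gt0; have := fr (scons true s) (scons true s'); nra.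
Qed.

Lemma osc_le_iter n f r : osc_le f r -> osc_le (iter n (tr b) f) r.
Proof. by elim: n => //= n IH fr; apply: osc_le_tr; exact: IH. Qed.

(** With weight [k ^+ n] the coupling draws [true] in both copies [n] times in a row, after which
    the two pasts share their last [n] spins. *)
Lemma iter_coupling n f r : osc_le f r -> forall s s',
  iter n (tr b) f s - iter n (tr b) f s' <=
  (1 - k ^+ n) * r +
  k ^+ n * (f (iter n (scons true) s) - f (iter n (scons true) s')).
Proof.
move=> fr; elim: n => [|n IH] s s'; first by rewrite expr0 /=; lra.
rewrite !iterS; apply: (le_trans (tr_coupling (osc_le_iter n fr) s s')).
have := IH (scons true s) (scons true s'); rewrite -!iterSr !iterS exprS.
move=> h; have := ler_wpM2l (ltW k_gt0) h.
lra.
Qed.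

Lemma osc_le_contract n f r : dep n f -> osc_le f r ->
  osc_le (iter n (tr b) f) ((1 - k ^+ n) * r).
Proof.
move=> df fr s s'; apply: (le_trans (iter_coupling n fr s s')).
suff -> : f (iter n (scons true) s) = f (iter n (scons true) s').
  by rewrite subrr mulr0 addr0.
apply: df => j; elim: n j => [//|n IH] [|j] //=.
by rewrite ltnS => /IH.
Qed.

Lemma osc_le_to0 f (e : R) : loc f -> 0 < e ->
  exists T, osc_le (iter T (tr b) f) e.
Proof.
move=> lf e0; have [n [df db]] := dep_common lf b_loc.
have [B B0 fB] := loc_bounded lf.
pose q := 1 - k ^+ n.
have q0 : 0 <= q by rewrite subr_ge0 exprn_ile1// ltW.
have q1 : q < 1 by rewrite ltrBlDr ltrDl exprn_gt0.
have fosc : osc_le f (2 * B).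
  by move=> s s'; have := fB s; have := fB s'; rewrite !ler_norml => /andP[? ?] /andP[? ?]; lra.
have it m : dep n (iter m (tr b) f) by elim: m => //= m; exact: dep_tr.
have main m : osc_le (iter (m * n) (tr b) f) (q ^+ m * (2 * B)).
  elim: m => [|m IH]; first by rewrite expr0 mul1r.
  by rewrite mulSn iterD exprS -mulrA; apply: osc_le_contract.
have : (fun m => q ^+ m * (2 * B)) @ \oo --> (0 * (2 * B) : R).
  apply: cvgMl; apply: cvg_expr; by rewrite ger0_norm.
rewrite mul0r => /cvgrPdist_lt /(_ e e0) [m _ /(_ m (leqnn m))].
rewrite /= sub0r normrN => hm; exists (m * n)%N => s s'.
by apply: (le_trans (main m s s')); apply: ltW; apply: le_lt_trans hm; exact: ler_norm.
Qed.

Lemma osc_le_sub_tr f r s : osc_le f r -> `|f s - tr b f s| <= r.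
Proof.
move=> fr; have k0 := k_gt0; rewrite trE ler_norml.
have /andP[? ?] := b_bounds s.
have h1 := fr s (scons true s); have h2 := fr s (scons false s).
have h3 := fr (scons true s) s; have h4 := fr (scons false s) s.
by apply/andP; split; nra.
Qed.

(** Iterating [tr b] leaves [c] unchanged while the oscillation of [U] tends to 0, so [c = 0]; then
    [U] is fixed by all iterates and has no oscillation. *)
Lemma harmonic_cst U c : loc U -> U - tr b U = cst c ->
  c = 0 /\ forall s s', U s = U s'.
Proof.
move=> lU Uc.
have c0 : c = 0.
  apply/eqP; rewrite -normr_eq0 eq_le normr_ge0 andbT.
  apply/ler_addgt0Pl => e e0; rewrite addr0.
  have [T Te] := osc_le_to0 lU e0.
  have := osc_le_sub_tr (fun=> false) Te.
  have -> : tr b (iter T (tr b) U) = iter T (tr b) (tr b U) by rewrite -iterS -iterSr.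
  rewrite -[_ - _]/((iter T (tr b) U - iter T (tr b) (tr b U)) (fun=> false)).
  by rewrite -iter_trB Uc iter_tr_cst.
split=> // s s'; subst c.
have trU : tr b U = U by apply/esym/eqP; rewrite -subr_eq0 Uc.
have itU T : iter T (tr b) U = U by elim: T => //= T ->.
have le0 s1 s2 : U s1 - U s2 <= 0.
  apply/ler_addgt0Pl => e e0; rewrite addr0.
  by have [T] := osc_le_to0 lU e0; rewrite itU; apply.
by apply/eqP; rewrite eq_le; apply/andP; split; rewrite -subr_le0.
Qed.

(** Functions of the last [n] spins form a finite-dimensional space stable under [tr b], where
    injectivity, given by [harmonic_cst], implies surjectivity. *)
Lemma poisson f : loc f -> exists U c, loc U /\ f = cst c + U - tr b U.
Proof.
move=> lf; have [n [df db]] := dep_common lf b_loc.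
pose ext (p : {ffun n.-tuple bool -> R^o}) : obs := fun s => p [tuple of mkseq s n].
pose res f : {ffun n.-tuple bool -> R^o} := [ffun w => f (nth false (tval w))].
have dext p : dep n (ext p).
  move=> s s' ss'; rewrite /ext; congr (p _); apply: val_inj => /=.
  by apply/eq_in_map => i; rewrite mem_iota add0n => /andP[_ /ss'].
have extK p : res (ext p) = p.
  apply/ffunP => w; rewrite ffunE /ext; congr (p _); apply: val_inj => /=.
  by rewrite -[in RHS](mkseq_nth false w) size_tuple.
have resK h : dep n h -> ext (res h) = h.
  move=> dh; apply/funext => s; rewrite /ext ffunE; apply: dh => j jn.
  by rewrite /= nth_mkseq.
pose s0 : past bool := fun=> false.
(* Adding the value at [s0] makes [1 - tr b] injective, since it detects the constants, and supplies
   the constant [c] of the conclusion. *)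
pose T p := res (ext p - tr b (ext p) + cst (ext p s0)).
have dT p : dep n (ext p - tr b (ext p) + cst (ext p s0)).
  move=> s s' ss'; rewrite !fctE (dext p s s')//.
  by rewrite (dep_tr db (dext p) ss').
have extD c p q : ext (c *: p + q) = c *: ext p + ext q.
  by apply/funext => s; rewrite /ext ffunE /= ffunE.
have linT : linear T.
  move=> c p q; apply/ffunP => w; rewrite /T extD trD trZ /res !ffunE /= !fctE /GRing.scale /=.
  ring.
have injT p : T p = 0 -> p = 0.
  move=> Tg0.
  have h0 : ext p - tr b (ext p) + cst (ext p s0) = 0.
    by rewrite -(resK _ (dT p)) -/(T p) Tg0; apply/funext => s; rewrite /ext ffunE.
  have lg : loc (ext p) by exists n.
  have [] := @harmonic_cst (ext p) (- ext p s0) lg.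
    by apply/eqP; rewrite -subr_eq0; apply/eqP; rewrite -[RHS]h0;
      apply/funext => s; rewrite !fctE opprK.
  move=> /eqP; rewrite oppr_eq0 => /eqP g0 gc.
  rewrite -(extK p); apply/ffunP => w; rewrite !ffunE.
  by rewrite (gc _ s0) g0.
have [p Tp] := inj_linear_surj linT injT (res f).
exists (ext p), (ext p s0); split; first by exists n.
rewrite -(resK _ df) -Tp /T resK//; ring.
Qed.

(** The stationary mean of [f], obtained without an invariant measure. For local [f] the constant
    exists by [poisson] and is unique by [pi_unique]; the default 0 concerns other functions. *)
Definition pi f : R := xget 0 [set c | exists U, loc U /\ f = cst c + U - tr b U].

Lemma pi_poisson f : loc f -> exists U, loc U /\ f = cst (pi f) + U - tr b U.
Proof.
move=> lf; have [U [c [lU fE]]] := poisson lf; rewrite /pi.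
by case: xgetP => [c' -> //|/(_ c)]; case; exists U.
Qed.

Lemma pi_unique f U c : loc U -> f = cst c + U - tr b U -> pi f = c.
Proof.
move=> lU fE.
have lf : loc f by rewrite fE; auto.
have [V [lV]] := pi_poisson lf; rewrite [in LHS]fE => h.
have [] := @harmonic_cst (U - V) (pi f - c) (locB lU lV).
  rewrite trB; apply/funext => s; have := congr1 (fun f => f s) h.
  by rewrite !fctE => h'; lra.
by move=> /eqP; rewrite subr_eq0 => /eqP.
Qed.

Lemma pi_cst c : pi (cst c) = c.
Proof. by apply: (@pi_unique _ 0) => //; rewrite addr0 -[X in tr b X]/(cst 0) tr_cst subr0. Qed.

Lemma piD f g : loc f -> loc g -> pi (f + g) = pi f + pi g.
Proof.
move=> /pi_poisson[U [lU fE]] /pi_poisson[V [lV gE]].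
apply: (pi_unique (locD lU lV)); rewrite [in LHS]fE [in LHS]gE trD.
by apply/funext => s; rewrite !fctE; ring.
Qed.

Lemma piZ c f : loc f -> pi (c *: f) = c * pi f.
Proof.
move=> /pi_poisson[U [lU fE]].
apply: (pi_unique (locZ c lU)); rewrite [in LHS]fE trZ.
by apply/funext => s; rewrite !fctE /GRing.scale /=; ring.
Qed.

Lemma piN f : loc f -> pi (- f) = - pi f.
Proof. by move=> lf; rewrite -scaleN1r piZ// mulN1r. Qed.

Lemma piB f g : loc f -> loc g -> pi (f - g) = pi f - pi g.
Proof. by move=> lf lg; rewrite piD ?piN//; exact: locN. Qed.

Lemma pi_tr f : loc f -> pi (tr b f) = pi f.
Proof.
move=> /pi_poisson[U [lU fE]].
apply: (pi_unique (loc_tr b_loc lU)); rewrite [in LHS]fE trB trD tr_cst.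
by [].
Qed.

Lemma pi_iter n f : loc f -> pi (iter n (tr b) f) = pi f.
Proof. by move=> lf; elim: n => //= n IH; rewrite pi_tr//; exact: loc_iter_tr. Qed.

(** The nonnegative function [iter T (tr b) f] tends to [pi f]: the difference is
    [iter T (tr b) (U - tr b U)], controlled by the vanishing oscillation of [iter T (tr b) U]. *)
Lemma pi_ge0 f : loc f -> (forall s, 0 <= f s) -> 0 <= pi f.
Proof.
move=> lf f0; have [U [lU fE]] := pi_poisson lf.
rewrite -oppr_le0; apply/ler_addgt0Pl => e e0; rewrite addr0.
have [T Te] := osc_le_to0 lU e0.
have := osc_le_sub_tr (fun=> false) Te.
have -> : tr b (iter T (tr b) U) = iter T (tr b) (tr b U) by rewrite -iterS -iterSr.
rewrite -[_ - _]/((iter T (tr b) U - iter T (tr b) (tr b U)) (fun=> false)).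
have -> : iter T (tr b) U - iter T (tr b) (tr b U) = iter T (tr b) f - cst (pi f).
  by rewrite {1}fE iter_trB iter_trD iter_tr_cst; ring.
have : 0 <= iter T (tr b) f (fun=> false).
  have := @iter_tr_le _ b b_le1 T (cst 0) f f0 (fun=> false).
  by rewrite iter_tr_cst.
by rewrite !fctE ler_norml => ? /andP[? ?]; lra.
Qed.

Lemma pi_le f g : loc f -> loc g -> (forall s, f s <= g s) -> pi f <= pi g.
Proof.
by move=> lf lg fg; rewrite -subr_ge0 -piB// pi_ge0// => [|s]; [exact: locB|rewrite subr_ge0].
Qed.

Lemma pi_norm_le f (B : R) : loc f -> (forall s, `|f s| <= B) -> `|pi f| <= B.
Proof.
move=> lf fB; rewrite ler_norml -{1}(pi_cst (- B)) -{2}(pi_cst B).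
by apply/andP; split; apply: pi_le => // s; have := fB s; rewrite ler_norml => /andP[].
Qed.

Lemma pi_behead f : loc f -> pi (fun s => f (fun j => s j.+1)) = pi f.
Proof. by move=> lf; rewrite -pi_tr ?tr_behead//; exact: loc_behead. Qed.

(** [U - iter T (tr b) U] is the sum of the increasing functions [iter t (tr b) (f - cst c)] for
    [t < T], and the subtracted term becomes constant as [T] grows. *)
Lemma poisson_incr f U c : loc U -> incr b -> incr f ->
  f = cst c + U - tr b U -> incr U.
Proof.
move=> lU bi fi fE.
have inc T : incr (U - iter T (tr b) U).
  elim: T => [|T IH]; first by rewrite /= subrr => s j.
  have -> : U - iter T.+1 (tr b) U =
      (U - iter T (tr b) U) + iter T (tr b) (f - cst c).
    have -> : f - cst c = U - tr b U by rewrite fE; ring.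
    by rewrite iter_trB -iterSr; ring.
  apply: incrD => //; apply: iter_tr_incr => //.
  by move=> s j; rewrite !fctE lerD2r.
move=> s j; rewrite -subr_le0; apply/ler_addgt0Pl => e e0; rewrite addr0.
have [T Te] := osc_le_to0 lU e0.
have := inc T s j; have := Te (upd s j false) (upd s j true).
by rewrite !fctE; lra.
Qed.

(** Flipping all spins turns a solution for [f] into a solution for [- f] with the same constant. *)
Lemma pi_odd f : loc f -> odd_obs b -> odd_obs f -> pi f = 0.
Proof.
move=> lf bo fo; have [U [lU fE]] := pi_poisson lf.
have lU' : loc (fun s => U (flip s)).
  by case: lU => n dU; exists n => s s' ss'; apply: dU => j jn; rewrite /flip ss'.
suff : pi (- f) = pi f by rewrite piN//; lra.
apply: (pi_unique lU'); apply/funext => s.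
rewrite -[tr b _]/(iter 1 (tr b) _) iter_tr_flip// !fctE -fo.
by rewrite {1}fE !fctE.
Qed.

End Ergodic.

(** * Oscillations and saturated feedback *)

Section Lipschitz.
Context {R : realType}.
Local Notation obs := (past bool -> R).
Implicit Types (f g : obs) (s : past bool).

(** The factor 2 makes [c j] a bound on half the effect of a flip, which for a kernel with
    conditional mean [f] is the total variation entering [Osc j.+1]. *)
Definition lips (C : R) f := exists c : nat -> R,
  [/\ forall j, 0 <= c j,
      forall J, \sum_(j < J) c j <= C &
      forall s j, `|f (upd s j true) - f (upd s j false)| <= 2 * c j].

Lemma lips_le C C' f : C <= C' -> lips C f -> lips C' f.
Proof.
move=> CC' [c [c0 cC fc]]; exists c; split=> // J; exact: le_trans (cC J) CC'.
Qed.

Lemma lipsD C C' f g : lips C f -> lips C' g -> lips (C + C') (f + g).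
Proof.
move=> [c [c0 cC fc]] [d [d0 dC gd]]; exists (fun j => c j + d j); split.
- by move=> j; exact: addr_ge0.
- by move=> J; rewrite big_split; exact: lerD.
- move=> s j; rewrite !fctE opprD addrACA mulrDr.
  by apply: (le_trans (ler_normD _ _)); exact: lerD.
Qed.

Lemma lipsZ C (a : R) f : lips C f -> lips (`|a| * C) (a *: f).
Proof.
move=> [c [c0 cC fc]]; exists (fun j => `|a| * c j); split.
- by move=> j; exact: mulr_ge0.
- by move=> J; rewrite -mulr_sumr; exact: ler_wpM2l.
- move=> s j; rewrite !fctE -scalerBr normrM mulrCA.
  exact: ler_wpM2l.
Qed.

Lemma lipsN C f : lips C f -> lips C (- f).
Proof.
by move=> /(lipsZ (-1)); rewrite normrN1 mul1r scaleN1r.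
Qed.

Lemma lipsB C C' f g : lips C f -> lips C' g -> lips (C + C') (f - g).
Proof. by move=> lf /lipsN; exact: lipsD. Qed.

Lemma lipsM A B C C' f g : (forall s, `|f s| <= A) -> (forall s, `|g s| <= B) ->
  lips C f -> lips C' g -> lips (B * C + A * C') (f * g).
Proof.
move=> fA gB [c [c0 cC fc]] [d [d0 dC gd]].
have A0 : 0 <= A by exact: le_trans (fA (fun=> false)).
have B0 : 0 <= B by exact: le_trans (gB (fun=> false)).
exists (fun j => B * c j + A * d j); split.
- by move=> j; rewrite addr_ge0// mulr_ge0.
- by move=> J; rewrite big_split -!mulr_sumr lerD// ler_wpM2l.
- move=> s j; rewrite !fctE.
  set f1 := f (upd s j true); set f0 := f (upd s j false).
  set g1 := g (upd s j true); set g0 := g (upd s j false).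
  have -> : f1 * g1 - f0 * g0 = g1 * (f1 - f0) + f0 * (g1 - g0) by ring.
  apply: (le_trans (ler_normD _ _)); rewrite !normrM mulrDr !(mulrCA 2).
  have h1 : `|g1| * `|f1 - f0| <= B * (2 * c j).
    by apply: ler_pM => //; [exact: gB|exact: fc].
  have h2 : `|f0| * `|g1 - g0| <= A * (2 * d j).
    by apply: ler_pM => //; [exact: fA|exact: gd].
  exact: lerD.
Qed.

Lemma dep_upd n f s j c : dep n f -> (n <= j)%N -> f (upd s j c) = f s.
Proof.
move=> df nj; apply: df => i ni; rewrite /upd.
by case: eqP => // ij; rewrite ij ltnNge nj in ni.
Qed.

Lemma sum_ord_lt (J m : nat) (B : R) : 0 <= B ->
  \sum_(j < J) (if (j < m)%N then B else 0) <= m%:R * B.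
Proof.
move=> B0; rewrite -(big_mkord xpredT (fun j => if (j < m)%N then B else 0)).
rewrite -big_mkcond /=.
have [Jm|mJ] := leqP J m.
  rewrite big_nat_cond (eq_bigl (fun i => (0 <= i < J)%N)); last first.
    move=> i /=; case: (ltnP i J) => //= iJ; exact: leq_trans iJ Jm.
  by rewrite -big_nat big_const_nat iter_addr addr0 subn0 -[B *+ J]mulr_natl ler_wpM2r// ler_nat.
have -> : \sum_(0 <= j < J | (j < m)%N) B = \sum_(0 <= j < m) B.
  by rewrite (big_nat_widen 0 m J xpredT)// ltnW.
by rewrite big_const_nat iter_addr addr0 subn0 mulr_natl.
Qed.

Lemma lips_dep n (B : R) f : dep n f -> (forall s, `|f s| <= B) -> lips (n%:R * B) f.
Proof.
move=> df fB; have B0 : 0 <= B by exact: le_trans (fB (fun=> false)).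
exists (fun j => if (j < n)%N then B else 0); split.
- by move=> j; case: ifP.
- by move=> J; exact: sum_ord_lt.
- move=> s j; case: ltnP => jn; last by rewrite !(dep_upd _ _ df)// subrr normr0 mulr0.
  by apply: (le_trans (ler_normB _ _)); rewrite mulrDl mul1r lerD.
Qed.

Lemma lips_spin i : lips 1 (spin i).
Proof.
exists (fun j => if j == i then 1 else 0); split.
- by move=> j; case: ifP.
- move=> J; have [iJ|Ji] := ltnP i J.
    rewrite (bigD1 (Ordinal iJ))//= eqxx big1 ?addr0// => j ji.
    by rewrite -(inj_eq val_inj) /= in ji; rewrite (negPf ji).
  by rewrite big1// => j _; rewrite ltn_eqF// (leq_trans (ltn_ord j)).
- move=> s j; rewrite /spin /upd eq_sym; case: eqP => _.
    by rewrite mulr1 opprK ger0_norm.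
  by rewrite subrr normr0 mulr0.
Qed.

Lemma spin_le1 j s : `|spin j s| <= 1 :> R.
Proof. by rewrite /spin; case: ifP; rewrite ?normrN1 ?normr1. Qed.

Definition wmean (N : nat) : obs := N%:R^-1 *: \sum_(j < N) spin j.

Definition clip (h x : R) : R := Num.max (- h) (Num.min h x).

Definition feedback (N : nat) (l h : R) : obs := fun s => clip h (l * wmean N s).

Lemma clip_norm h x : 0 <= h -> `|clip h x| <= h.
Proof.
move=> h0; rewrite /clip ler_norml le_max lexx /= ge_max ge_min lexx /= andbT; lra.
Qed.

Lemma clip_le h x y : x <= y -> clip h x <= clip h y.
Proof.
move=> xy; rewrite /clip; case: (leP (- h) (Num.min h x)); case: (leP (- h) (Num.min h y));
  case: (leP h x); case: (leP h y); lra.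
Qed.

Lemma clipN h x : 0 <= h -> clip h (- x) = - clip h x.
Proof.
move=> h0; rewrite /clip; 
case: (leP (- h) (Num.min h x)); case: (leP (- h) (Num.min h (- x)));
  case: (leP h x); case: (leP h (- x)); lra.
Qed.

Lemma clip_sub h x y : 0 <= h -> x <= y -> clip h y - clip h x <= y - x.
Proof.
move=> h0 xy; rewrite /clip.
case: (leP (- h) (Num.min h x)); case: (leP (- h) (Num.min h y));
  case: (leP h x); case: (leP h y); lra.
Qed.

Lemma clip_id h x : `|x| <= h -> clip h x = x.
Proof.
rewrite ler_norml => /andP[? ?]; rewrite /clip.
case: (leP (- h) (Num.min h x)); case: (leP h x); lra.
Qed.

End Lipschitz.

(** * Responses of the stationary mean *)

Section Feedback.
Context {R : realType}.
Local Notation obs := (past bool -> R).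
Implicit Types (f g : obs) (s : past bool).

Lemma wmeanE N s : wmean N s = N%:R^-1 * \sum_(j < N) spin j s :> R.
Proof. by rewrite /wmean fct_sumE. Qed.

Lemma loc_wmean N : loc (wmean N : obs).
Proof. by apply: locZ; apply: loc_sum. Qed.

Lemma loc_feedback N (l h : R) : loc (feedback N l h).
Proof. exact: (loc_map (fun x => clip h (l * x)) (loc_wmean N)). Qed.

Lemma wmean_le1 N s : `|wmean N s| <= 1 :> R.
Proof.
rewrite wmeanE normrM; case: N => [|N]; first by rewrite big_ord0 normr0 mulr0.
rewrite normfV normr_nat mulrC ler_pdivrMr ?ltr0n// mul1r.
apply: (le_trans (ler_norm_sum _ _ _)).
apply: (@le_trans _ _ (\sum_(j < N.+1) (1 : R))).
  by apply: ler_sum => j _; exact: spin_le1.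
by rewrite sumr_const card_ord.
Qed.

Lemma spin_upd i s j c :
  spin i (upd s j c) = if i == j then (if c then 1 else -1) else spin i s :> R.
Proof. by rewrite /spin /upd; case: eqP. Qed.

Lemma wmean_upd N s j : wmean N (upd s j true) - wmean N (upd s j false) =
  if (j < N)%N then 2 / N%:R else 0 :> R.
Proof.
rewrite !wmeanE -mulrBr -sumrB.
have [jN|Nj] := ltnP j N.
  rewrite (bigD1 (Ordinal jN))//= !spin_upd eqxx big1; first by rewrite addr0; ring.
  move=> i ij; rewrite -(inj_eq val_inj) /= in ij.
  by rewrite !spin_upd (negPf ij) subrr.
rewrite big1 ?mulr0// => i _; have iE : (i == j :> nat) = false.
  by rewrite ltn_eqF// (leq_trans (ltn_ord i)).
by rewrite !spin_upd iE subrr.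
Qed.

Lemma wmean_incr N : incr (wmean N : obs).
Proof.
by move=> s j; rewrite -subr_ge0 wmean_upd; case: ifP.
Qed.

Lemma odd_spin j : odd_obs (spin j : obs).
Proof. by move=> s; rewrite /spin /flip; case: (s j); rewrite ?opprK. Qed.

Lemma odd_wmean N : odd_obs (wmean N : obs).
Proof.
move=> s; rewrite !wmeanE -mulrN -sumrN; congr (_ * _).
by apply: eq_bigr => i _; exact: odd_spin.
Qed.

Section Params.
Context (N : nat) (l h : R) (l_ge0 : 0 <= l) (h_ge0 : 0 <= h).

Lemma feedback_norm s : `|feedback N l h s| <= h.
Proof. exact: clip_norm. Qed.

Lemma feedback_incr : incr (feedback N l h).
Proof. by move=> s j; apply: clip_le; rewrite ler_wpM2l// wmean_incr. Qed.

Lemma odd_feedback : odd_obs (feedback N l h).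
Proof. by move=> s; rewrite /feedback odd_wmean mulrN clipN. Qed.

Lemma feedback_upd s j :
  feedback N l h (upd s j true) - feedback N l h (upd s j false) <=
  2 * (if (j < N)%N then l / N%:R else 0).
Proof.
apply: (le_trans (clip_sub h_ge0 _)); first by rewrite ler_wpM2l// wmean_incr.
rewrite -mulrBr wmean_upd; case: ifP => _; last by rewrite !mulr0.
by rewrite le_eqVlt; apply/orP; left; apply/eqP; ring.
Qed.

Lemma lips_feedback : lips l (feedback N l h).
Proof.
exists (fun j => if (j < N)%N then l / N%:R else 0); split.
- by move=> j; case: ifP => // _; rewrite divr_ge0.
- move=> J; apply: (le_trans (sum_ord_lt J N _)); first by rewrite divr_ge0.
  case: N => [|n]; first by rewrite mul0r.
  by rewrite mulrC divfK ?pnatr_eq0.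
- by move=> s j; rewrite ger0_norm ?feedback_upd// subr_ge0 feedback_incr.
Qed.

End Params.
End Feedback.

Section Response.
Context {R : realType} (b : past bool -> R) (k : R) (k_gt0 : 0 < k)
  (b_loc : loc b) (b_le : forall s, `|b s| <= 1 - 2 * k) (b_incr : incr b).
Local Notation obs := (past bool -> R).
Implicit Types (f g U : obs) (s : past bool).

Let b_le1 s : `|b s| <= 1.
Proof. by have k0 := k_gt0; apply: (le_trans (b_le s)); lra. Qed.

#[local] Hint Resolve b_loc : core.

(* Half of the mean effect on [f], [n] steps later, of flipping a spin of the
   stationary process. *)
Definition resp n f : R := pi b (diff (iter n (tr b) f)).

Definition cresp T f : R := \sum_(n < T) resp n f.

Lemma respD n f g : loc f -> loc g -> resp n (f + g) = resp n f + resp n g.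
Proof. by move=> lf lg; rewrite /resp iter_trD diffD (piD k_gt0)//; auto. Qed.

Lemma respZ n c f : loc f -> resp n (c *: f) = c * resp n f.
Proof. by move=> lf; rewrite /resp iter_trZ diffZ (piZ k_gt0)//; auto. Qed.

Lemma respN n f : loc f -> resp n (- f) = - resp n f.
Proof. by move=> lf; rewrite -scaleN1r respZ// mulN1r. Qed.

Lemma crespD T f g : loc f -> loc g -> cresp T (f + g) = cresp T f + cresp T g.
Proof.
by move=> lf lg; rewrite -big_split; apply: eq_bigr => n _; rewrite respD.
Qed.

Lemma crespZ T c f : loc f -> cresp T (c *: f) = c * cresp T f.
Proof. by move=> lf; rewrite mulr_sumr; apply: eq_bigr => n _; rewrite respZ. Qed.

Lemma crespN T f : loc f -> cresp T (- f) = - cresp T f.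
Proof. by move=> lf; rewrite -scaleN1r crespZ// mulN1r. Qed.

Lemma crespB T f g : loc f -> loc g -> cresp T (f - g) = cresp T f - cresp T g.
Proof. by move=> lf lg; rewrite crespD ?crespN//; exact: locN. Qed.

Lemma cresp_sum T n (G : nat -> obs) : (forall i, loc (G i)) ->
  cresp T (\sum_(i < n) G i) = \sum_(i < n) cresp T (G i).
Proof.
move=> lG; elim: n => [|n IH].
  by rewrite !big_ord0 -[0 in LHS](scale0r (spin 0 : obs)) crespZ// mul0r.
by rewrite !big_ord_recr /= crespD ?IH//; apply: loc_sum.
Qed.

Lemma resp_tr n f : resp n (tr b f) = resp n.+1 f.
Proof. by rewrite /resp iterSr. Qed.

Lemma cresp_tr T f : cresp T (tr b f) = cresp T.+1 f - resp 0 f.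
Proof.
rewrite /cresp big_ord_recl /= [resp _ _ + _]addrC addrK.
by apply: eq_bigr => n _; rewrite resp_tr.
Qed.

Lemma cresp_sub_tr T f : loc f -> cresp T (f - tr b f) = resp 0 f - resp T f.
Proof.
move=> lf; rewrite crespB//; last exact: loc_tr.
rewrite cresp_tr /cresp big_ord_recr /=; ring.
Qed.

Lemma resp_ge0 n f : loc f -> incr f -> 0 <= resp n f.
Proof.
move=> lf fi; apply: (pi_ge0 k_gt0) => //; first by auto.
by move=> s; apply: diff_incr; exact: iter_tr_incr.
Qed.

Lemma cresp_ge0 T f : loc f -> incr f -> 0 <= cresp T f.
Proof. by move=> lf fi; apply: sumr_ge0 => n _; exact: resp_ge0. Qed.

Lemma diff_bound f (B : R) s : (forall s, `|f s| <= B) -> `|diff f s| <= B.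
Proof.
move=> fB; rewrite /diff normrM [`|2^-1|]ger0_norm// ler_pdivrMr// mulrDr mulr1.
by apply: (le_trans (ler_normB _ _)); apply: lerD.
Qed.

Lemma resp_bound n f (B : R) : loc f -> (forall s, `|f s| <= B) -> `|resp n f| <= B.
Proof.
move=> lf fB; apply: (pi_norm_le k_gt0) => //; first by auto.
by move=> s; apply: diff_bound; exact: iter_tr_bound.
Qed.

(** Each value of the next spin has probability at least [k], so a difference over that spin is
    dominated by a conditional expectation. Functions that are small only on average, such as the
    excess over the saturation level, thus have small responses. *)
Lemma resp_le_norm n f : loc f ->
  `|resp n f| <= (2 * k)^-1 * pi b (fun s => `|f s|).
Proof.
move=> lf; pose af : obs := fun s => `|f s|.
have laf : loc af by exact: (loc_map Num.norm).
have h s : `|diff (iter n (tr b) f) s| <= ((2 * k)^-1 *: iter n.+1 (tr b) af) s.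
  have k0 := k_gt0.
  rewrite !fctE /= trE /diff /GRing.scale /=.
  rewrite normrM [`|2^-1|]ger0_norm//.
  apply: (@le_trans _ _ ((iter n (tr b) af (scons true s) + iter n (tr b) af (scons false s)) / 2)).
    rewrite ler_pM2r//; apply: (le_trans (ler_normB _ _)).
    by apply: lerD; exact: iter_tr_norm.
  have p s' : 0 <= iter n (tr b) af s'.
    by apply: (le_trans (normr_ge0 _)); exact: iter_tr_norm.
  have := p (scons true s); have := p (scons false s).
  have := b_le s; rewrite ler_norml => /andP[b1 b2].
  move: (iter n _ _ (scons true s)) (iter n _ _ (scons false s)) => x y x0 y0.
  rewrite [leRHS]mulrC ler_pdivlMr; last by lra.
  nra.
rewrite -{1}[pi b af](pi_iter k_gt0 b_loc b_le n.+1 laf).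
rewrite -(piZ k_gt0)//; last by auto.
rewrite ler_norml -(piN k_gt0)//; last by auto.
apply/andP; split; apply: (pi_le k_gt0) => //; auto.
- by move=> s; have := h s; rewrite ler_norml => /andP[].
- by move=> s; have := h s; rewrite ler_norml => /andP[].
Qed.

Lemma cresp_mono T T' f : loc f -> incr f -> (T <= T')%N -> cresp T f <= cresp T' f.
Proof.
move=> lf fi TT'; rewrite /cresp -!(big_mkord xpredT (fun n => resp n f)).
rewrite (big_cat_nat _ TT')//= lerDl; apply: sumr_ge0 => n _; exact: resp_ge0.
Qed.

(** After [n] steps the spin of age [j] precedes the flipped one if [n < j], and otherwise is the
    newest spin of step [n - j]. *)
Lemma resp_spin n j : resp n (spin j) = if (n < j)%N then 0 else resp (n - j) (spin 0).
Proof.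
elim: j n => [|j IH] n; first by rewrite subn0.
case: n => [|n]; first by rewrite /resp /= diff_spinS -[0]/(cst 0) (pi_cst k_gt0).
by rewrite -resp_tr tr_spinS IH ltnS subSS.
Qed.

Lemma cresp_spin T j : cresp T (spin j) = cresp (T - j) (spin 0).
Proof.
elim: T => [|T IH]; first by rewrite sub0n /cresp !big_ord0.
rewrite /cresp big_ord_recr /= -/(cresp T _) IH resp_spin.
have [Tj|jT] := ltnP T j.
  by rewrite addr0; congr cresp; lia.
by rewrite subSn// /cresp big_ord_recr.
Qed.

(* If [c] bounds the oscillations of [f], then both [\sum_j c_j spin_j + f] and
   [\sum_j c_j spin_j - f] are increasing, hence have nonnegative responses. *)
Lemma resp_lips n m f (c : nat -> R) : dep m f -> (forall j, 0 <= c j) ->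
  (forall s j, `|f (upd s j true) - f (upd s j false)| <= 2 * c j) ->
  `|resp n f| <= \sum_(j < m) c j * resp n (spin j).
Proof.
move=> df c0 fc; have lf : loc f by exists m.
pose g : obs := \sum_(j < m) c j *: spin j.
have lg : loc g by apply: (@loc_sum _ m (fun j => c j *: spin j)); auto.
have gupd s j : (j < m)%N -> g (upd s j true) - g (upd s j false) = 2 * c j.
  move=> jm; rewrite /g fct_sumE -sumrB (bigD1 (Ordinal jm))//= big1 ?addr0.
    rewrite !fctE /GRing.scale /= !spin_upd eqxx; ring.
  move=> i ij; rewrite -(inj_eq val_inj) /= in ij.
  by rewrite !fctE !spin_upd (negPf ij) subrr.
have gupd0 s j : (m <= j)%N -> g (upd s j true) - g (upd s j false) = 0.
  move=> mj; rewrite /g fct_sumE -sumrB big1// => i _.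
  by rewrite !fctE !spin_upd ltn_eqF ?subrr// (leq_trans (ltn_ord i)).
have gi1 : incr (g + f).
  move=> s j; rewrite -subr_ge0 !fctE.
  have [jm|mj] := ltnP j m; last first.
    have := gupd0 s j mj; rewrite !(dep_upd _ _ df)//; lra.
  by have := gupd s j jm; have := fc s j; rewrite ler_norml => /andP[]; lra.
have gi2 : incr (g - f).
  move=> s j; rewrite -subr_ge0 !fctE.
  have [jm|mj] := ltnP j m; last first.
    have := gupd0 s j mj; rewrite !(dep_upd _ _ df)//; lra.
  by have := gupd s j jm; have := fc s j; rewrite ler_norml => /andP[]; lra.
have lgf : loc (g + f) by auto.
have lgf' : loc (g - f) by auto.
have := resp_ge0 n lgf gi1; have := resp_ge0 n lgf' gi2.
rewrite respD ?respN ?respD//; last exact: locN.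
have -> : \sum_(j < m) c j * resp n (spin j) = resp n g.
  rewrite /g; elim: (m) => [|p IH].
    by rewrite !big_ord0 -[0 in RHS](scale0r (spin 0 : obs)) respZ// mul0r.
  have lp : loc (\sum_(j < p) c j *: spin j : obs).
    by apply: (@loc_sum _ p (fun j => c j *: spin j)); auto.
  have lp' : loc (c p *: spin p : obs) by auto.
  by rewrite !big_ord_recr /= respD// IH respZ.
by rewrite ler_norml; lra.
Qed.

(** Summation of [resp_lips] over time: an older spin responds like the newest one with a delay, so
    its cumulative response is no larger. *)
Lemma cresp_lips C T f : loc f -> lips C f -> `|cresp T f| <= C * cresp T (spin 0).
Proof.
move=> [m df] [c [c0 cC fc]].
apply: (@le_trans _ _ (\sum_(n < T) \sum_(j < m) c j * resp n (spin j))).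
  apply: (le_trans (ler_norm_sum _ _ _)); apply: ler_sum => n _.
  exact: resp_lips.
rewrite exchange_big /=.
apply: (@le_trans _ _ (\sum_(j < m) c j * cresp T (spin 0))).
  apply: ler_sum => j _; rewrite -mulr_sumr ler_wpM2l// -/(cresp T _).
  by rewrite cresp_spin; apply: cresp_mono; [auto|exact: incr_spin|exact: leq_subr].
rewrite -mulr_suml ler_wpM2r//.
by apply: cresp_ge0; [auto|exact: incr_spin].
Qed.

(** The sum telescopes to [resp 0 u - resp T u], and the subtracted term is nonnegative because [u]
    is increasing. *)
Lemma cresp_spin_le u T : loc u -> spin 0 = u - tr b u -> incr u ->
  cresp T (spin 0) <= pi b (diff u).
Proof.
move=> lu uE ui; rewrite uE cresp_sub_tr// -[pi b _]/(resp 0 u) gerBl.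
exact: resp_ge0.
Qed.

End Response.

#[local] Hint Resolve loc_wmean loc_feedback : core.

(** * Exponential moments of the spin sum *)

(** Comes from [expR x <= (1 - x)^-1], the inverse of the tangent inequality at [- x]. *)
Lemma expR_le_quad (R : realType) (x : R) : `|x| <= 2^-1 ->
  expR x <= 1 + x + 2 * x ^+ 2.
Proof.
rewrite ler_norml => /andP[x1 x2].
rewrite -[x in expR x]opprK expRN -[leRHS]invrK lef_pV2 ?posrE ?expR_gt0//; last first.
  by rewrite invr_gt0; nra.
apply: (@le_trans _ _ (1 - x)); last exact: expR_ge1Dx.
rewrite invf_ple ?posrE; [|nra|lra].
rewrite -[leLHS]mul1r ler_pdivrMr; [nra|lra].
Qed.

(** One step of an exponential supermartingale: the exponent grows by the drift [m] and a
    second-order term. *)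
Lemma expR_two_point (R : realType) (p q x y m c : R) :
  0 <= p -> 0 <= q -> p + q = 1 -> p * x + q * y <= m ->
  `|x| <= c -> `|y| <= c -> c <= 2^-1 ->
  p * expR x + q * expR y <= expR (m + 2 * c ^+ 2).
Proof.
move=> p0 q0 pq xym xc yc c2.
have ex : expR x <= 1 + x + 2 * c ^+ 2.
  apply: (le_trans (expR_le_quad (le_trans xc c2))); rewrite lerD2l ler_pM2l//.
  by rewrite -real_normK ?num_real// lerXn2r ?nnegrE// (le_trans _ xc).
have ey : expR y <= 1 + y + 2 * c ^+ 2.
  apply: (le_trans (expR_le_quad (le_trans yc c2))); rewrite lerD2l ler_pM2l//.
  by rewrite -real_normK ?num_real// lerXn2r ?nnegrE// (le_trans _ yc).
apply: (le_trans _ (expR_ge1Dx _)).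
have := ler_wpM2l p0 ex; have := ler_wpM2l q0 ey.
move: (expR x) (expR y) (c ^+ 2) => X Y C; have -> : q = 1 - p by lra.
move: xym; have -> : q = 1 - p by lra.
nra.
Qed.

Section Concentration.
Context {R : realType} (b u v F : past bool -> R) (k chi B h : R).
Context (k_gt0 : 0 < k) (b_loc : loc b) (u_loc : loc u) (v_loc : loc v)
  (F_loc : loc F) (bF_le : forall s, `|(b + F) s| <= 1 - 2 * k).
Context (uE : spin 0 = u - tr b u) (vE : diff u = cst chi + v - tr b v)
  (du_ge0 : forall s, 0 <= diff u s) (u_le : forall s, `|u s| <= B)
  (v_le : forall s, `|v s| <= B) (F_le : forall s, `|F s| <= h)
  (h_ge0 : 0 <= h) (h_le1 : h <= 1).
Local Notation obs := (past bool -> R).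
Local Notation b' := (b + F).

Let b'_le1 s : `|b' s| <= 1.
Proof. by have k0 := k_gt0; apply: (le_trans (bF_le s)); lra. Qed.

Let b'_loc : loc b'.
Proof. exact: locD. Qed.

#[local] Hint Resolve b_loc u_loc v_loc F_loc b'_loc : core.

(** The feedback makes [u] drift by at most [h * diff u], which depends on the past; the summand
    [h *: v] replaces [diff u] by its mean [chi]. The sign [sg] serves the two tails. *)
Let w (sg : R) : obs := sg *: u + h *: v.
Let phi (sg : R) : obs := w sg - sg *: spin 0.

(* [u] and [v] are correctors: they turn the sum of the spins into a
   martingale plus a drift of at most [h * chi] per step. *)
Lemma tr_corrector (sg : R) s : `|sg| <= 1 ->
  tr b' (w sg) s <= phi sg s + (h * chi + h ^+ 2 * B).
Proof.
move=> sg1; rewrite /phi /w trD !trZ !tr_addk.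
have uE' : tr b u = u - spin 0 by rewrite uE; ring.
have vE' : tr b v = cst chi + v - diff u by rewrite vE; ring.
rewrite uE' vE' !fctE /GRing.scale /=.
have h1 : sg * (F s * diff u s) <= h * diff u s.
  rewrite mulrA ler_wpM2r//; apply: (le_trans (ler_norm _)).
  by rewrite normrM -[h]mul1r ler_pM.
have h2 : h * (F s * diff v s) <= h ^+ 2 * B.
  rewrite expr2 -mulrA ler_wpM2l//; apply: (le_trans (ler_norm _)).
  by rewrite normrM ler_pM//; exact: diff_bound.
lra.
Qed.

Let w_le (sg : R) s : `|sg| <= 1 -> `|w sg s| <= 2 * B.
Proof.
move=> sg1; rewrite /w !fctE /GRing.scale /=.
apply: (le_trans (ler_normD _ _)); rewrite !normrM mulrDl mul1r.
rewrite (ger0_norm h_ge0).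
by apply: lerD; rewrite -[B]mul1r ler_pM.
Qed.

Let phi_le (sg : R) s : `|sg| <= 1 -> `|phi sg s| <= 2 * B + 1.
Proof.
move=> sg1; rewrite /phi !fctE.
apply: (le_trans (ler_normB _ _)); apply: lerD; first exact: w_le.
by rewrite normrM -[1]mulr1 ler_pM// spin_le1.
Qed.

Let E (lam sg : R) N : obs :=
  fun s => expR (lam * (sg * \sum_(j < N) spin j s + phi sg s)).

Let loc_S N : loc (fun s => \sum_(j < N) spin j s : R).
Proof. by rewrite -(fct_sumE _ xpredT); apply: loc_sum. Qed.

Let E_loc lam sg N : loc (E lam sg N).
Proof.
apply: (loc_map2 (fun x y => expR (lam * (sg * x + y)))) => //.
by rewrite /phi /w; auto.
Qed.

#[local] Hint Resolve E_loc : core.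

Let kap (lam : R) := lam * (h * chi + h ^+ 2 * B) + 2 * (lam * (4 * B + 1)) ^+ 2.

Let tr_E lam sg N s : 0 <= lam -> lam * (4 * B + 1) <= 2^-1 -> `|sg| <= 1 ->
  tr b' (E lam sg N.+1) s <= expR (kap lam) * E lam sg N s.
Proof.
move=> lam0 lam1 sg1.
(* The appended spin enters the sum and is subtracted again in [phi], so only [w] sees it. *)
have Ec c : E lam sg N.+1 (scons c s) =
    E lam sg N s * expR (lam * (w sg (scons c s) - phi sg s)).
  rewrite /E -expRD; congr expR; rewrite big_ord_recl /=.
  rewrite {1}/phi !fctE /GRing.scale /=.
  have -> : \sum_(i < N) spin (bump 0 i) (scons c s) = \sum_(i < N) spin i s :> R.
    by apply: eq_bigr => i _.
  ring.
rewrite trE !Ec.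
have E0 : 0 < E lam sg N s by exact: expR_gt0.
suff : (1 + b' s) / 2 * expR (lam * (w sg (scons true s) - phi sg s)) +
    (1 - b' s) / 2 * expR (lam * (w sg (scons false s) - phi sg s)) <= expR (kap lam).
  move=> /(ler_wpM2l (ltW E0)); rewrite [leRHS]mulrC; apply: le_trans.
  rewrite le_eqVlt; apply/orP; left; apply/eqP; ring.
have := b'_le1 s; rewrite ler_norml => /andP[b1 b2].
have dwp c : `|lam * (w sg (scons c s) - phi sg s)| <= lam * (4 * B + 1).
  rewrite normrM (ger0_norm lam0) ler_wpM2l//; apply: (le_trans (ler_normB _ _)).
  by have := w_le (scons c s) sg1; have := phi_le s sg1; lra.
apply: expR_two_point => //; [lra|lra|lra|].
have := ler_wpM2l lam0 (tr_corrector s sg1); rewrite trE; lra.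
Qed.

Let iter_E lam sg N s : 0 <= lam -> lam * (4 * B + 1) <= 2^-1 -> `|sg| <= 1 ->
  iter N (tr b') (E lam sg N) s <= expR (N%:R * kap lam + lam * (2 * B + 1)).
Proof.
move=> lam0 lam1 sg1.
have -> : expR (N%:R * kap lam + lam * (2 * B + 1)) =
    expR (kap lam) ^+ N * expR (lam * (2 * B + 1)).
  by rewrite expRD expRM_natl.
elim: N s => [|N IH] s.
  rewrite /E /= big_ord0 mulr0 add0r expr0 mul1r ler_expR ler_wpM2l//.
  by apply: (le_trans (ler_norm _)); exact: phi_le.
rewrite iterSr exprS -mulrA.
apply: (@le_trans _ _ (iter N (tr b') (expR (kap lam) *: E lam sg N) s)).
  by apply: iter_tr_le => // s'; exact: tr_E.
by rewrite iter_trZ !fctE /GRing.scale /= ler_wpM2l// expR_ge0.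
Qed.

(** To be used at the level [2 * chi * h] per spin: the drift is only about [h * chi], so by
    Markov's inequality the mean of [N] spins exceeds that level with exponentially small
    probability. *)
Lemma mgf_spin_sum (lam sg : R) N :
  0 <= lam -> lam * (4 * B + 1) <= 2^-1 -> `|sg| <= 1 ->
  pi b' (fun s => expR (lam * (sg * \sum_(j < N) spin j s))) <=
  expR (N%:R * (lam * (h * chi + h ^+ 2 * B) + 2 * (lam * (4 * B + 1)) ^+ 2) +
        lam * (4 * B + 2)).
Proof.
move=> lam0 lam1 sg1; rewrite -/(kap lam).
have lE : loc (fun s => expR (lam * (sg * \sum_(j < N) spin j s))).
  exact: (loc_map (fun x => expR (lam * (sg * x)))).
have h1 : pi b' (E lam sg N) <= expR (N%:R * kap lam + lam * (2 * B + 1)).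
  rewrite -(pi_iter k_gt0 b'_loc bF_le N)// -[leRHS](pi_cst k_gt0 b'_loc bF_le).
  by apply: (pi_le k_gt0) => // [|s]; [auto|exact: iter_E].
apply: (@le_trans _ _ (pi b' (expR (lam * (2 * B + 1)) *: E lam sg N))).
  apply: (pi_le k_gt0) => //; first by auto.
  move=> s; rewrite !fctE /GRing.scale /= /E -expRD ler_expR -mulrDr ler_wpM2l//.
  by have := phi_le s sg1; rewrite ler_norml => /andP[]; lra.
rewrite (piZ k_gt0)//.
have -> : N%:R * kap lam + lam * (4 * B + 2) =
    lam * (2 * B + 1) + (N%:R * kap lam + lam * (2 * B + 1)) by ring.
by rewrite expRD ler_wpM2l// expR_ge0.
Qed.

End Concentration.

(** * Distance between the feedback and its linear part *)

Section Saturation.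
Context {R : realType}.
Local Notation obs := (past bool -> R).

Definition excess (N : nat) (l h : R) : obs := l *: wmean N - feedback N l h.

Lemma loc_excess N l h : loc (excess N l h).
Proof. by rewrite /excess; auto. Qed.

(* The feedback is exactly linear unless the empirical mean exceeds [th]. *)
Lemma excess_le N (l h th lam : R) s : (0 < N)%N -> 0 <= l -> 0 <= h ->
  h = l * th -> 0 <= lam ->
  `|excess N l h s| <=
  l * (expR (lam * (1 * \sum_(j < N) spin j s)) * expR (- (lam * (N%:R * th))) +
       expR (lam * (-1 * \sum_(j < N) spin j s)) * expR (- (lam * (N%:R * th)))).
Proof.
move=> N0 l0 h0 hE lam0; rewrite /excess !fctE /GRing.scale /= /feedback.
have Nr : 0 < N%:R :> R by rewrite ltr0n.
have SE : \sum_(j < N) spin j s = N%:R * wmean N s :> R.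
  by rewrite wmeanE mulrA divff ?mul1r ?gt_eqF.
rewrite SE -!expRD; have := @wmean_le1 R N s; move: (wmean N s) => m m1.
have e1 := expR_ge0 (lam * (1 * (N%:R * m)) - lam * (N%:R * th)).
have e2 := expR_ge0 (lam * (-1 * (N%:R * m)) - lam * (N%:R * th)).
have [mth|] := leP `|m| th.
  rewrite clip_id ?subrr ?normr0; last by rewrite normrM ger0_norm// hE ler_wpM2l.
  by apply: mulr_ge0 => //; exact: addr_ge0.
move=> thm.
have le_l : `|l * m - clip h (l * m)| <= l.
  have /andP[m1' m2'] : -1 <= m <= 1 by rewrite -ler_norml.
  have l1 : l * m <= l * 1 by rewrite ler_wpM2l.
  have l2 : l * -1 <= l * m by rewrite ler_wpM2l.
  rewrite ler_norml /clip; move: (l * m) l1 l2 => x l1 l2; apply/andP.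
  by case: (leP (- h) (Num.min h x)); case: (leP h x); split; lra.
apply: (le_trans le_l); rewrite -[leLHS]mulr1 ler_wpM2l//.
move: thm; rewrite lter_normr => /orP[] thm.
  suff : 1 <= expR (lam * (1 * (N%:R * m)) - lam * (N%:R * th)) by lra.
  rewrite -[leLHS]expR0 ler_expR mul1r -mulrBr -mulrBr mulr_ge0// mulr_ge0 ?(ltW Nr)//; lra.
suff : 1 <= expR (lam * (-1 * (N%:R * m)) - lam * (N%:R * th)) by lra.
rewrite -[leLHS]expR0 ler_expR mulN1r -mulrN -mulrBr -mulrBr mulr_ge0// mulr_ge0 ?(ltW Nr)//; lra.
Qed.

End Saturation.

#[local] Hint Resolve loc_excess : core.

(** * The effect of a feedback on the response *)

(** The horizon may reach [(N + 1)^2] steps, over which the exponentially small saturation error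
    accumulates. The constant is [4 * 27], from [N.+1 <= 2 * N] and
    [(q * N / 3)^3 <= expR (q * N)]. *)
Lemma sqr_expRN_le (R : realType) (q : R) (N : nat) : 0 < q -> (0 < N)%N ->
  (N.+1%:R) ^+ 2 * expR (- (q * N%:R)) <= 108 / (q ^+ 3 * N%:R).
Proof.
move=> q0 N0; have Nr : 1 <= N%:R :> R by rewrite ler1n.
have qN : 0 < q * N%:R by rewrite mulr_gt0// (lt_le_trans _ Nr).
have h : (q * N%:R / 3) ^+ 3 <= expR (q * N%:R).
  rewrite [in leRHS](_ : q * N%:R = (q * N%:R / 3) *+ 3); last first.
    by rewrite -[RHS]mulr_natr divfK.
  rewrite -[X in expR X]mulr_natl expRM_natl lerXn2r ?nnegrE ?expR_ge0//;
    first by rewrite divr_ge0// ltW.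
  by apply: le_trans (expR_ge1Dx _); rewrite lerDr.
rewrite expRN ler_pdivrMr ?expR_gt0//.
apply: (@le_trans _ _ (108 / (q ^+ 3 * N%:R) * (q * N%:R / 3) ^+ 3)); last first.
  rewrite ler_wpM2l// divr_ge0// mulr_ge0// ?exprn_ge0// ltW//.
have -> : 108 / (q ^+ 3 * N%:R) * (q * N%:R / 3) ^+ 3 = 4 * N%:R ^+ 2 :> R.
  by field; rewrite !gt_eqF// (lt_le_trans _ Nr).
rewrite -[N.+1]addn1 natrD; nra.
Qed.

(** Pigeonhole: [N] consecutive increments add up to at most [B]. Applied to cumulative responses,
    it finds a time at which a delay of [L] steps is almost invisible. *)
Lemma slow_increment (R : realType) (A : nat -> R) (B : R) (N L : nat) : (0 < N)%N ->
  (forall T, 0 <= A T <= B) ->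
  exists2 j, (j < N)%N & A (j.+1 * L)%N - A (j * L)%N <= B / N%:R.
Proof.
move=> N0 AB; apply: contrapT => noj.
have grow j : (j < N)%N -> B / N%:R < A (j.+1 * L)%N - A (j * L)%N.
  by move=> jN; rewrite ltNge; apply/negP => h; apply: noj; exists j.
have lower j : (0 < j <= N)%N -> j%:R * (B / N%:R) < A (j * L)%N - A 0%N.
  elim: j => [//|[|j] IH] /andP[_ jN].
    by have := grow 0%N N0; rewrite mul0n mul1r mul1n.
  have := IH (ltnW jN); have := grow _ jN.
  by rewrite -[j.+2]addn1 natrD mulrDl mul1r addn1; lra.
have := lower N; rewrite N0 leqnn => /(_ isT).
rewrite mulrCA divff ?mulr1; last by rewrite pnatr_eq0 -lt0n.
have /andP[? ?] := AB 0%N; have /andP[? ?] := AB (N * L)%N; lra.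
Qed.

Definition behead_past (s : past bool) : past bool := fun k => s k.+1.

Section Step.
Context {R : realType} (b u v : past bool -> R) (k chi : R) (m N : nat) (h B g : R).
Context (k_gt0 : 0 < k) (b_loc : loc b) (b_incr : incr b)
  (u_dep : dep m u) (v_dep : dep m v)
  (uE : spin 0 = u - tr b u) (vE : diff u = cst chi + v - tr b v)
  (u_le : forall s, `|u s| <= B) (v_le : forall s, `|v s| <= B)
  (chi_gt0 : 0 < chi) (h_gt0 : 0 < h) (N_gt0 : (0 < N)%N) (mN : (m <= N)%N).
Local Notation obs := (past bool -> R).
Local Notation l := (2 * chi)^-1.
Local Notation F := (feedback N l h).
Local Notation b' := (b + F).
Local Notation A := (fun T => cresp b' T (spin 0)).
Context (b'_le : forall s, `|b' s| <= 1 - 2 * k).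
Context (g_le : pi b' (fun s => `|excess N l h s|) <= g).

Let u_loc : loc u. Proof. by exists m. Qed.
Let v_loc : loc v. Proof. by exists m. Qed.
Let l_gt0 : 0 < l. Proof. by rewrite invr_gt0 mulr_gt0. Qed.
Let l_ge0 : 0 <= l. Proof. exact: ltW. Qed.
Let h_ge0 : 0 <= h. Proof. exact: ltW. Qed.
Let b'_loc : loc b'. Proof. by auto. Qed.
Let b'_incr : incr b'.
Proof. by apply: incrD => //; apply: feedback_incr; exact: ltW. Qed.
Let B_ge0 : 0 <= B. Proof. exact: le_trans (u_le (fun=> false)). Qed.

#[local] Hint Resolve b_loc u_loc v_loc b'_loc : core.

Let F_le s : `|F s| <= h. Proof. by apply: feedback_norm; exact: ltW. Qed.
Let lips_F : lips l F. Proof. by apply: lips_feedback; exact: ltW. Qed.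
Let dv_le s : `|diff v s| <= B. Proof. exact: diff_bound. Qed.
Let lips_v : lips (m%:R * B) v. Proof. exact: lips_dep. Qed.
Let lips_dv : lips (m%:R * B) (diff v).
Proof. by apply: lips_dep => //; exact: dep_diff. Qed.

Let A_mono T T' : (T <= T')%N -> A T <= A T'.
Proof. by move=> TT'; apply: (cresp_mono k_gt0) => //; exact: incr_spin. Qed.

Let A_ge0 T : 0 <= A T.
Proof. by apply: (cresp_ge0 k_gt0) => //; exact: incr_spin. Qed.

Let Fm : obs := fun s => F (behead_past s).
Let G : obs := excess N l h.
Let Gm : obs := fun s => G (behead_past s).

Let Fm_loc : loc Fm. Proof. exact: loc_behead. Qed.
Let G_loc : loc G. Proof. exact: loc_excess. Qed.
Let Gm_loc : loc Gm. Proof. exact: loc_behead. Qed.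
#[local] Hint Resolve Fm_loc G_loc Gm_loc : core.

(** Both Poisson equations are rewritten for [b'], each at the cost of a term [F * diff], and
    coboundaries telescope in [cresp]. The summand [chi * cresp b' T F] is the feedback loop and
    [resp b' 0 u] is close to [chi]; the others will be small. *)
Lemma response_identity T :
  A T = resp b' 0 u - resp b' T u +
    (chi * cresp b' T F +
     ((resp b' 0 (F * v) - resp b' T (F * v)) +
      (cresp b' T.+1 ((F - Fm) * v) - resp b' 0 ((F - Fm) * v)) +
      cresp b' T (F * F * diff v))).
Proof.
have trF f : tr b f = tr b' f - F * diff f by rewrite tr_addk; ring.
have spinE : spin 0 = (u - tr b' u) + F * diff u by rewrite {1}uE trF; ring.
(* [Fm] ignores the newest spin, so [F * tr b' v] equals [tr b' (Fm * v)]. The coboundary of [v]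
   weighted by [F] is therefore a true coboundary plus a term in the slow variation [F - Fm]. *)
have FdE : F * diff u = chi *: F + ((F * v - tr b' (F * v)) +
    tr b' ((F - Fm) * v) + F * F * diff v).
  have tm : tr b' (Fm * v) = F * tr b' v by rewrite tr_mulbehead.
  have -> : tr b' ((F - Fm) * v) = tr b' (F * v) - F * tr b' v.
    by rewrite mulrBl trB tm.
  rewrite {1}vE trF; have -> : chi *: F = cst chi * F by [].
  by ring.
have lFF : loc (F - Fm) by auto.
have l1 : loc (u - tr b' u) by auto.
have l2 : loc (F * v - tr b' (F * v)) by auto.
have l3 : loc (tr b' ((F - Fm) * v)) by auto.
have l4 : loc (F * F * diff v) by auto.
have l5 : loc (chi *: F) by auto.
have l6 : loc (F * v - tr b' (F * v) + tr b' ((F - Fm) * v)) by exact: locD.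
rewrite spinE FdE (crespD k_gt0)//; last by apply: locD => //; exact: locD.
rewrite (cresp_sub_tr k_gt0)// (crespD k_gt0)//; last exact: locD.
rewrite (crespZ k_gt0)// (crespD k_gt0)// (crespD k_gt0)//.
by rewrite (cresp_sub_tr k_gt0) ?cresp_tr//; auto.
Qed.

(** Since [v] solves the Poisson equation of [diff u] for [b], the mean of [diff u] under [b']
    differs from [chi] only by the mean of [F * diff v]. *)
Let respF0 : chi - h * B <= resp b' 0 u.
Proof.
rewrite /resp /=; have -> : diff u = (cst chi + v - tr b' v) + F * diff v.
  by rewrite vE tr_addk; ring.
have lFd : loc (F * diff v) by auto.
rewrite (piD k_gt0)//; last by auto.
have -> : pi b' (cst chi + v - tr b' v) = chi by exact: (pi_unique k_gt0 b'_loc b'_le v_loc).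
rewrite lerD2l lerNl.
apply: (le_trans (ler_norm _)); rewrite normrN.
apply: (pi_norm_le k_gt0) => // s; rewrite normrM. exact: ler_pM.
Qed.

(** [u] involves only spins of age below [m <= N], whose responses at time [T] are all increments of
    [A] within the last delay window. *)
Let respT_le T : (N <= T)%N -> resp b' T u <= m%:R * B * (A T.+1 - A (T - N)%N).
Proof.
move=> NT; apply: (le_trans (ler_norm _)).
apply: (le_trans (resp_lips k_gt0 b'_loc b'_le b'_incr T u_dep (fun=> B_ge0) _)).
  by move=> s j; apply: (le_trans (ler_normB _ _)); rewrite mulrDl mul1r lerD.
apply: (@le_trans _ _ (\sum_(j < m) B * (A T.+1 - A (T - N)%N))); last first.
  by rewrite sumr_const card_ord -[leLHS]mulr_natl mulrA.
apply: ler_sum => j _; rewrite ler_wpM2l// (resp_spin k_gt0)//.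
have jT : (j <= T)%N by rewrite (leq_trans (ltnW (ltn_ord j)))// (leq_trans mN).
rewrite ltnNge jT /=.
have -> : resp b' (T - j) (spin 0) = A (T - j).+1 - A (T - j)%N.
  by rewrite /cresp big_ord_recr /=; ring.
apply: lerB; apply: A_mono; first by rewrite ltnS leq_subr.
by apply: leq_sub2l; exact: leq_trans (ltnW (ltn_ord j)) mN.
Qed.

Let resp_G n : `|resp b' n G| <= (2 * k)^-1 * g.
Proof.
apply: (le_trans (resp_le_norm k_gt0 b'_loc b'_le n G_loc)).
by rewrite ler_wpM2l// invr_ge0 mulr_ge0// ltW.
Qed.

(** The linear part averages [N] delayed copies of the newest spin, each with cumulative response at
    least [A (T - N)]; the excess is controlled in mean by [g]. *)
Let cresp_F T : l * A (T - N)%N - T%:R * ((2 * k)^-1 * g) <= cresp b' T F.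
Proof.
have FE : F = l *: wmean N - G by rewrite /G /excess; ring.
rewrite [X in _ <= cresp _ _ X]FE (crespB k_gt0)//; last by auto.
apply: lerB; last first.
  apply: (le_trans (ler_norm _)); apply: (le_trans (ler_norm_sum _ _ _)).
  apply: (@le_trans _ _ (\sum_(n < T) (2 * k)^-1 * g)).
    by apply: ler_sum => n _; exact: resp_G.
  by rewrite sumr_const card_ord -[leLHS]mulr_natl.
rewrite (crespZ k_gt0)//; apply: ler_wpM2l => //.
have -> : cresp b' T (wmean N) = N%:R^-1 * \sum_(j < N) cresp b' T (spin j).
  rewrite /wmean (crespZ k_gt0)//; last exact: loc_sum.
  by rewrite (cresp_sum k_gt0).
rewrite ler_pdivlMl ?ltr0n//.
apply: (@le_trans _ _ (\sum_(j < N) A (T - N)%N)).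
  by rewrite sumr_const card_ord -[leRHS]mulr_natl.
apply: ler_sum => j _; rewrite [leRHS](cresp_spin k_gt0)//; apply: A_mono.
by apply: leq_sub2l; exact: ltnW.
Qed.

Let F_sub_le s : `|(F - Fm) s| <= 2 * h.
Proof.
have -> : 2 * h = h + h by ring.
by rewrite !fctE; apply: (le_trans (ler_normB _ _)); apply: lerD; exact: F_le.
Qed.

Let resp_Fsub : resp b' 0 ((F - Fm) * v) <= 2 * h * B.
Proof.
apply: (le_trans (ler_norm _)); apply: (resp_bound k_gt0) => //; first by auto.
by move=> s; rewrite normrM ler_pM.
Qed.

Let resp_Fv n : `|resp b' n (F * v)| <= h * B.
Proof.
apply: (resp_bound k_gt0) => //; first by auto.
by move=> s; rewrite normrM ler_pM.
Qed.

(** Of order [h]: when one feedback factor varies, the other is still bounded by [h]. *)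
Let cresp_FFdv T : `|cresp b' T (F * F * diff v)| <=
  (B * (h * l + h * l) + h * h * (m%:R * B)) * A T.
Proof.
apply: (cresp_lips k_gt0) => //; first by auto.
apply: lipsM => //; last exact: lipsM.
by move=> s; rewrite normrM ler_pM.
Qed.

(** One step exchanges a single spin among the [N] that are averaged, which makes the feedback vary
    slowly when [N] is large. *)
Let F_sub : F - Fm = (l / N%:R) *: (spin 0 - spin N) - (G - Gm).
Proof.
have wE : wmean N - (fun s => wmean N (behead_past s)) = N%:R^-1 *: (spin 0 - spin N) :> obs.
  apply/funext => s; rewrite !fctE !wmeanE -mulrBr; congr (_ * _).
  have shiftE : spin 0 s + \sum_(j < N) spin j.+1 s = \sum_(j < N) spin j s + spin N s :> R.
    transitivity (\sum_(j < N.+1) spin j s : R); first by rewrite big_ord_recl.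
    by rewrite big_ord_recr.
  rewrite -[\sum_(j < N) spin j (behead_past s)]/(\sum_(j < N) spin j.+1 s).
  lra.
have -> : Fm = l *: (fun s => wmean N (behead_past s)) - Gm.
  by apply/funext => s; rewrite /Fm /Gm /G /excess !fctE; ring.
have -> : F = l *: wmean N - G by rewrite /G /excess; ring.
rewrite -scalerA -wE scalerBr; ring.
Qed.

Let cresp_Fsub T : `|cresp b' T ((F - Fm) * v)| <=
  l / N%:R * ((B * 2 + 2 * (m%:R * B)) * A T) +
  T%:R * ((2 * k)^-1 * (2 * B * g)).
Proof.
have -> : (F - Fm) * v = (l / N%:R) *: ((spin 0 - spin N) * v) - (G - Gm) * v.
  rewrite F_sub mulrBl; congr (_ - _).
  by apply/funext => s; rewrite !fctE /GRing.scale /=; ring.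
rewrite (crespB k_gt0)//; [|by auto..].
apply: (le_trans (ler_normB _ _)); apply: lerD.
  rewrite (crespZ k_gt0)//; last by auto.
  rewrite normrM ger0_norm; last by rewrite divr_ge0.
  apply: ler_wpM2l; first by rewrite divr_ge0.
  apply: (cresp_lips k_gt0) => //; first by auto.
  apply: lipsM => //.
    move=> s; apply: (le_trans (ler_normB _ _)).
    by apply: lerD; exact: spin_le1.
  by apply: lipsB; exact: lips_spin.
apply: (le_trans (ler_norm_sum _ _ _)).
apply: (@le_trans _ _ (\sum_(n < T) (2 * k)^-1 * (2 * B * g))); last first.
  by rewrite sumr_const card_ord -[leLHS]mulr_natl.
have lGG : loc ((G - Gm) * v) by auto.
apply: ler_sum => n _; apply: (le_trans (resp_le_norm k_gt0 b'_loc b'_le n lGG)).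
rewrite ler_wpM2l//; first by rewrite invr_ge0 mulr_ge0// ltW.
pose nG : obs := fun s => `|G s|.
pose nGm : obs := fun s => nG (behead_past s).
have lnG : loc nG by exact: (loc_map Num.norm).
have lnGm : loc nGm by exact: loc_behead.
apply: (@le_trans _ _ (pi b' (B *: (nG + nGm)))).
  apply: (pi_le k_gt0) => //; [exact: (loc_map Num.norm)|by auto|].
  move=> s; rewrite !fctE /GRing.scale /= normrM mulrC ler_pM//.
  exact: ler_normB.
rewrite (piZ k_gt0)//; last by auto.
rewrite (piD k_gt0)// (pi_behead k_gt0 b'_loc b'_le lnG).
have -> : 2 * B * g = B * (g + g) by ring.
by rewrite ler_wpM2l// lerD.
Qed.

(** The errors are grouped by what makes them small: [h], then [1 / N], then the mean excess [g]
    against the horizon. [A T / 2] is the gain of the loop, as [chi * l] is one half. *)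
Lemma step_inequality T (Bchi : R) : (N <= T)%N -> A T.+1 <= Bchi ->
  A T.+1 - A (T - N)%N <= Bchi / N%:R ->
  chi + A T / 2
    - h * (5 * B + (2 * l * B + h * (m%:R * B)) * Bchi)
    - (m%:R * B * Bchi + Bchi / 2 + l * (B * 2 + 2 * (m%:R * B)) * Bchi) / N%:R
    - T.+1%:R * ((chi + 2 * B) * ((2 * k)^-1 * g))
  <= A T.
Proof.
move=> NT AB incr_le.
have A0 : 0 <= A T.+1 := A_ge0 _.
have AT : A T <= A T.+1 by apply: A_mono.
have g0 : 0 <= g by apply: (le_trans _ g_le); apply: (pi_ge0 k_gt0) => //;
  exact: (loc_map Num.norm).
have c0 : 0 <= (2 * k)^-1 * g by rewrite mulr_ge0// invr_ge0 mulr_ge0// ltW.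
have NV : 0 < N%:R^-1 :> R by rewrite invr_gt0 ltr0n.
rewrite [leRHS]response_identity.
have h1 := respF0; have h2 := respT_le NT.
have h3 := ler_wpM2l (ltW chi_gt0) (cresp_F T).
have := resp_Fv 0; have := resp_Fv T; have := cresp_FFdv T; have := cresp_Fsub T.+1.
rewrite !ler_norml => /andP[h4 _] /andP[h5 _] /andP[_ h6] /andP[h7 _].
have h8 := resp_Fsub.
have chil : chi * l = 2^-1 by field; rewrite gt_eqF.
have h9 : chi * (l * A (T - N)%N) = A (T - N)%N / 2 by rewrite mulrA chil mulrC.
have h10 : m%:R * B * (A T.+1 - A (T - N)%N) <= m%:R * B * (Bchi / N%:R).
  by rewrite ler_wpM2l// mulr_ge0.
have h11 : l / N%:R * ((B * 2 + 2 * (m%:R * B)) * A T.+1) <=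
    l / N%:R * ((B * 2 + 2 * (m%:R * B)) * Bchi).
  by rewrite !ler_wpM2l// ?divr_ge0// addr_ge0// ?mulr_ge0// mulr_ge0.
have h12 : (B * (h * l + h * l) + h * h * (m%:R * B)) * A T <=
    (B * (h * l + h * l) + h * h * (m%:R * B)) * Bchi.
  rewrite ler_wpM2l// ?(le_trans AT)//.
  have h0 := ltW h_gt0; have l0 := ltW l_gt0.
  by rewrite addr_ge0// ?mulr_ge0// ?addr_ge0// ?mulr_ge0.
have h13 : T%:R * ((2 * k)^-1 * g) <= T.+1%:R * ((2 * k)^-1 * g).
  by rewrite ler_wpM2r// ler_nat.
have h14 := ler_wpM2l (ltW chi_gt0) h13.
rewrite mulrBr h9 in h3; cbv beta in *.
have e1 : A T / 2 <= A (T - N)%N / 2 + Bchi / 2 / N%:R by lra.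
have e2 : resp b' T u <= m%:R * B * (Bchi / N%:R) by lra.
have e3 : - (l / N%:R * ((B * 2 + 2 * (m%:R * B)) * Bchi)) -
    T.+1%:R * ((2 * k)^-1 * (2 * B * g)) <= cresp b' T.+1 ((F - Fm) * v) by lra.
have e4 : - ((B * (h * l + h * l) + h * h * (m%:R * B)) * Bchi) <=
    cresp b' T (F * F * diff v) by lra.
have e5 : A (T - N)%N / 2 - chi * (T.+1%:R * ((2 * k)^-1 * g)) <= chi * cresp b' T F by lra.
move: h1 h6 h7 h8 e1 e2 e3 e4 e5.
move: (cresp b' T (spin 0)) (cresp b' (T - N) (spin 0)) (resp b' 0 u)
  (resp b' T u) (cresp b' T F) (resp b' 0 (F * v)) (resp b' T (F * v))
  (cresp b' T.+1 ((F - Fm) * v)) (resp b' 0 ((F - Fm) * v))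
  (cresp b' T (F * F * diff v)) => x z a1 a2 a3 a4 a5 a6 a7 a8.
by move: l => L; lra.
Qed.

End Step.

(** * Amplification of the response by one feedback *)

Section ResponseStep.
Context {R : realType}.
Implicit Types (b u v : past bool -> R) (k chi : R).

(* [chi] is the derivative of the stationary mean spin with respect to a
   constant external field; [u] and [v] are the associated correctors. *)
Definition response b chi := exists u v,
  [/\ loc u, loc v, spin 0 = u - tr b u, diff u = cst chi + v - tr b v & incr u].

(** Odd symmetry makes the mean spin zero, so the Poisson equation for [spin 0] has no constant
    term. *)
Lemma exists_response b k : 0 < k -> loc b -> incr b -> odd_obs b ->
  (forall s, `|b s| <= 1 - 2 * k) ->
  exists chi, response b chi /\ forall T, cresp b T (spin 0) <= chi.
Proof.
move=> k0 lb bi bo bk.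
have [u [lu uE]] := pi_poisson k0 lb bk (loc_spin 0).
have [v [lv vE]] := pi_poisson k0 lb bk (loc_diff lu).
have ui : incr u by apply: (poisson_incr k0 lb bk lu bi (incr_spin 0) uE).
have uE' : spin 0 = u - tr b u.
  rewrite {1}uE (pi_odd k0 lb bk (loc_spin 0) bo (odd_spin 0)).
  by rewrite -[cst 0]/(0 : past bool -> R) add0r.
exists (pi b (diff u)); split; first by exists u, v.
by move=> T; exact: (cresp_spin_le k0).
Qed.

(* Feedback of slope [(2 * chi)^-1] has total oscillation of order [chi^-1] but
   multiplies the response by at least 3/2, however small its saturation [h]. *)
Lemma response_step b k chi (eta : R) : 0 < k -> loc b -> incr b ->
  0 < eta -> (forall s, `|b s| <= 1 - 2 * k - eta) ->
  0 < chi -> response b chi ->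
  exists N h, [/\ (0 < N)%N, 0 < h, h <= eta &
    forall chi', (forall T, cresp (b + feedback N (2 * chi)^-1 h) T (spin 0) <= chi') ->
      3 / 2 * chi <= chi'].
Proof.
move=> k0 lb bi eta0 bk chi0 [u [v [lu lv uE vE ui]]].
have [m [du dv]] := dep_common lu lv.
have [Bu Bu0 hBu] := loc_bounded lu; have [Bv Bv0 hBv] := loc_bounded lv.
pose B := Bu + Bv + 1.
have B1 : 1 <= B by rewrite lerDr addr_ge0.
have B0 : 0 < B by exact: lt_le_trans B1.
have u_le s : `|u s| <= B by apply: (le_trans (hBu s)); rewrite /B; lra.
have v_le s : `|v s| <= B by apply: (le_trans (hBv s)); rewrite /B; lra.
pose l := (2 * chi)^-1.
have l0 : 0 < l by rewrite invr_gt0 mulr_gt0.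
have lchi : l * (2 * chi) = 1 by rewrite mulVf// mulf_neq0// gt_eqF.
pose Bc := 3 / 2 * chi.
have Bc0 : 0 < Bc by rewrite mulr_gt0.
pose K1 := 5 * B + (2 * l * B + m%:R * B) * Bc.
have K10 : 0 < K1.
  by rewrite ltr_pwDl ?mulr_gt0// mulr_ge0 ?(ltW Bc0)//
    addr_ge0 ?mulr_ge0 ?(ltW l0) ?(ltW B0)// mulr_ge0// ltW.
(* Beyond the allowed room [eta] and the bound 1, the conditions on [h] serve in turn the
   second-order drift [h ^+ 2 * B], the errors of order [h] in [step_inequality], and the smallness
   of [lam * D]. *)
pose h := Num.min (Num.min eta 1) (Num.min (chi / (4 * B)) (Num.min (chi / (16 * K1)) chi^-1)).
have h0 : 0 < h.
  by rewrite !lt_min eta0 ltr01 !divr_gt0 ?mulr_gt0// invr_gt0.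
have h_eta : h <= eta by rewrite !ge_min lexx.
have h1 : h <= 1 by rewrite !ge_min lexx orbT.
have hB : h * B <= chi / 4.
  have : h <= chi / (4 * B) by rewrite !ge_min lexx !orbT.
  by rewrite ler_pdivlMr ?mulr_gt0//; lra.
have hK : h * K1 <= chi / 16.
  have : h <= chi / (16 * K1) by rewrite !ge_min lexx !orbT.
  by rewrite ler_pdivlMr ?mulr_gt0//; lra.
have hchi : h * chi <= 1.
  have : h <= chi^-1 by rewrite !ge_min lexx !orbT.
  by rewrite -[chi^-1]mul1r ler_pdivlMr.
clearbody h.
pose D := 4 * B + 1.
have D0 : 0 < D by rewrite /D; lra.
(* With this value the quadratic term [2 * (lam * D) ^+ 2] of the moment bound is a quarter of the
   linear term [lam * (h * chi)]. *)
pose lam := chi * h / (8 * D ^+ 2).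
have lam0 : 0 < lam by rewrite divr_gt0 ?mulr_gt0// exprn_gt0.
have lamD : lam * (8 * D ^+ 2) = chi * h.
  by rewrite divfK// mulf_neq0// ?expf_neq0// gt_eqF.
have lamD1 : lam * D <= 2^-1.
  have h2 : 8 * (lam * D) * D <= 1 by rewrite -mulrA -mulrA -expr2 mulrCA lamD mulrC.
  have h3 : 0 <= lam * D by rewrite mulr_ge0// ltW.
  have h4 : 5 <= D by rewrite /D; lra.
  nra.
clearbody lam.
(* Per spin, in units of [lam * (chi * h)], the moment contributes at most [1 + 1/4 + 1/4] and the
   level subtracts 2; one half remains as rate of decay. *)
pose q := lam * (chi * h) / 2.
have q0 : 0 < q by rewrite divr_gt0// mulr_gt0// mulr_gt0.
pose C := 2 * l * expR (lam * (4 * B + 2)).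
have C0 : 0 < C by rewrite mulr_gt0 ?mulr_gt0// expR_gt0.
pose K2 := m%:R * B * Bc + Bc / 2 + l * (B * 2 + 2 * (m%:R * B)) * Bc.
pose K3 := (chi + 2 * B) * (2 * k)^-1 * C * (108 / q ^+ 3).
have c1 : 0 <= (chi + 2 * B) * (2 * k)^-1 * C.
  have [Bn chin] : 0 <= B /\ 0 <= chi by split; exact: ltW.
  by rewrite !mulr_ge0 ?invr_ge0 ?addr_ge0 ?mulr_ge0 ?(ltW C0) ?(ltW k0).
have K30 : 0 <= K3.
  by rewrite mulr_ge0// divr_ge0// exprn_ge0// ltW.
have K20 : 0 <= K2.
  have [Bn Bcn ln] : [/\ 0 <= B, 0 <= Bc & 0 <= l] by split; exact: ltW.
  by rewrite /K2; do ![done | apply: addr_ge0 | apply: mulr_ge0 | apply: divr_ge0].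
(* [K2] collects the errors of order [1 / N], and [K3] the saturation error over a horizon of
   [(N + 1)^2] steps; both become at most [chi / 16]. *)
pose N := (m + (Num.bound (16 * K2 / chi)) + (Num.bound (16 * K3 / chi))).+1.
have mN : (m <= N)%N by rewrite /N -!addnA -addnS leq_addr.
have K2N : K2 / N%:R <= chi / 16.
  rewrite ler_pdivrMr ?ltr0n// mulrAC ler_pdivlMr// mulrC [_ * N%:R]mulrC -ler_pdivrMr//.
  apply: (le_trans (ltW (archi_boundP _))); first by apply: divr_ge0; [exact: mulr_ge0|exact: ltW].
  by rewrite ler_nat; exact: leqW (leq_trans (leq_addl m _) (leq_addr _ _)).
have K3N : K3 / N%:R <= chi / 16.
  rewrite ler_pdivrMr ?ltr0n// mulrAC ler_pdivlMr// mulrC [_ * N%:R]mulrC -ler_pdivrMr//.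
  apply: (le_trans (ltW (archi_boundP _))); first by apply: divr_ge0; [exact: mulr_ge0|exact: ltW].
  by rewrite ler_nat; exact: leqW (leq_addl _ _).
have N0 : (0 < N)%N by [].
clearbody N.
exists N, h; split=> // chi' chi'_le.
(* Arguing by contradiction provides the a priori bound [Bc] on all cumulative responses, on which
   both the pigeonhole argument and the error terms rely. *)
rewrite leNgt; apply/negP => chi'_lt.
pose F := feedback N l h.
have F_le s : `|F s| <= h by apply: feedback_norm; exact: ltW.
have lF : loc F by exact: loc_feedback.
have b'k s : `|(b + F) s| <= 1 - 2 * k.
  by rewrite !fctE; apply: (le_trans (ler_normD _ _)); have := bk s; have := F_le s; lra.
have b'i : incr (b + F) by apply: incrD => //; apply: feedback_incr; exact: ltW.
pose g := C * expR (- (q * N%:R)).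
have g_le : pi (b + F) (fun s => `|excess N l h s|) <= g.
  have hE : h = l * (2 * chi * h) by rewrite mulrA lchi mul1r.
  pose c0 := expR (- (lam * (N%:R * (2 * chi * h)))).
  have c00 : 0 <= c0 by exact: expR_ge0.
  have lS : loc (fun s => \sum_(j < N) spin j s : R).
    by rewrite -(fct_sumE _ xpredT); apply: loc_sum.
  pose E1 : past bool -> R := fun s => expR (lam * (1 * \sum_(j < N) spin j s)).
  pose E2 : past bool -> R := fun s => expR (lam * (-1 * \sum_(j < N) spin j s)).
  have lE1 : loc E1 by exact: (loc_map (fun x => expR (lam * (1 * x)))).
  have lE2 : loc E2 by exact: (loc_map (fun x => expR (lam * (-1 * x)))).
  have lbF : loc (b + F) by exact: locD.
  apply: (@le_trans _ _ (pi (b + F) ((l * c0) *: (E1 + E2)))).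
    apply: (pi_le k0) => //; [exact: (loc_map Num.norm (loc_excess _ _ _))|by auto|].
    move=> s; apply: (le_trans (excess_le s N0 (ltW l0) (ltW h0) hE (ltW lam0))).
    by rewrite !fctE /GRing.scale /= -/c0 -[E1 s]/(expR _) -[E2 s]/(expR _); lra.
  rewrite (piZ k0)//; last by auto.
  rewrite (piD k0)//.
  have du0 s : 0 <= diff u s by exact: diff_incr.
  have m1 := @mgf_spin_sum R b u v F k chi B h k0 lb lu lv lF b'k uE vE du0 u_le v_le F_le
    (ltW h0) h1 lam 1 N (ltW lam0) lamD1.
  have m2 := @mgf_spin_sum R b u v F k chi B h k0 lb lu lv lF b'k uE vE du0 u_le v_le F_le
    (ltW h0) h1 lam (-1) N (ltW lam0) lamD1.
  rewrite normr1 lexx in m1; rewrite normrN1 lexx in m2.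
  have {}m1 := m1 isT; have {}m2 := m2 isT.
  pose M := expR (N%:R * (lam * (h * chi + h ^+ 2 * B) + 2 * (lam * D) ^+ 2) +
        lam * (4 * B + 2)).
  have {}m1 : pi (b + F) E1 <= M := m1.
  have {}m2 : pi (b + F) E2 <= M := m2.
  apply: (@le_trans _ _ (l * c0 * (M + M))).
    by rewrite ler_wpM2l ?mulr_ge0 ?(ltW l0)// lerD.
  have -> : l * c0 * (M + M) = 2 * l * (c0 * M) by ring.
  rewrite /g /C -!mulrA !ler_pM2l// /c0 /M -!expRD ler_expR.
  have e1 : 2 * (lam * D) ^+ 2 = lam * (chi * h / 4).
    by rewrite -lamD exprMn; field.
  have e2 : h ^+ 2 * B <= h * (chi / 4).
    by rewrite expr2 -mulrA ler_wpM2l// ltW.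
  rewrite e1 /q.
  have Nr : 0 <= N%:R :> R by [].
  have e3 : N%:R * (lam * (h ^+ 2 * B)) <= N%:R * (lam * (h * (chi / 4))).
    by rewrite ler_wpM2l// ler_wpM2l// ltW.
  rewrite expr2 in e3 *; lra.
have A_le T : 0 <= cresp (b + F) T (spin 0) <= Bc.
  apply/andP; split; last by apply: (le_trans (chi'_le T)); exact: ltW.
  by apply: (cresp_ge0 k0) => //; [exact: locD|exact: incr_spin].
(* Windows of length [N.+1] run from [T - N] to [T.+1], as required by [step_inequality]. *)
have [j jN jinc] := slow_increment N.+1 N0 A_le.
pose T := (j.+1 * N.+1).-1.
have TE : (j.+1 * N.+1)%N = T.+1 by rewrite /T prednK.
have T'E : (j * N.+1)%N = (T - N)%N by rewrite /T mulSn addSn /= addKn.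
have NT : (N <= T)%N by rewrite /T mulSn addSn /= leq_addr.
have TN : (T.+1 <= N.+1 * N.+1)%N by rewrite -TE leq_mul2r ltnW ?orbT.
rewrite TE T'E in jinc.
have /andP[_ AT1] := A_le T.+1.
have := step_inequality k0 lb bi du dv uE vE u_le v_le chi0 h0 N0 mN b'k g_le NT AT1 jinc.
rewrite -/F -/l -/K2.
have lT : cresp (b + F) T (spin 0) < 3 / 2 * chi by apply: le_lt_trans (chi'_le T) chi'_lt.
have hK1 : h * (5 * B + (2 * l * B + h * (m%:R * B)) * Bc) <= chi / 16.
  apply: le_trans hK; rewrite ler_wpM2l ?(ltW h0)// /K1 lerD2l ler_wpM2r ?(ltW Bc0)//.
  by rewrite lerD2l -[leRHS]mul1r; apply: ler_wpM2r => //; apply: mulr_ge0 => //; exact: ltW.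
have hg : T.+1%:R * ((chi + 2 * B) * ((2 * k)^-1 * g)) <= chi / 16.
  apply: le_trans K3N.
  apply: (@le_trans _ _ ((chi + 2 * B) * (2 * k)^-1 * C *
      (N.+1%:R ^+ 2 * expR (- (q * N%:R))))).
    have -> : T.+1%:R * ((chi + 2 * B) * ((2 * k)^-1 * g)) =
      (chi + 2 * B) * (2 * k)^-1 * C * (T.+1%:R * expR (- (q * N%:R))) by rewrite /g; ring.
    rewrite ler_wpM2l// ler_wpM2r ?expR_ge0// -natrX ler_nat.
    by rewrite (leq_trans TN)// mulnn.
  have := ler_wpM2l c1 (sqr_expRN_le q0 N0).
  suff -> : K3 / N%:R = (chi + 2 * B) * (2 * k)^-1 * C * (108 / (q ^+ 3 * N%:R)) by [].
  by rewrite /K3 [(q ^+ 3 * _)^-1]invfM; ring.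
(* Three errors of at most [chi / 16] in [chi + x / 2 - errors <= x] force [x] to be at least
   [2 * chi - 3 / 8 * chi], above [3 / 2 * chi]. *)
move: (cresp (b + F) T (spin 0)) lT => x lT; move: hK1 hg K2N; rewrite -/l.
set e1 := h * _; set e2 := K2 / _; set e3 := _ * (_ * _); move=> *; lra.
Qed.

End ResponseStep.

(** * Lower bound on the variance *)

Section Variance.
Context {R : realType}.
Local Notation obs := (past bool -> R).
Implicit Types (b u v : obs) (k chi : R).

Definition spin_sum (n : nat) : obs := fun s => \sum_(j < n) spin j s.

Lemma loc_spin_sum n : loc (spin_sum n).
Proof. by rewrite /spin_sum -(fct_sumE _ xpredT); apply: loc_sum. Qed.

Lemma spin_sum_norm n s : `|spin_sum n s| <= n%:R.
Proof.
apply: (le_trans (ler_norm_sum _ _ _)).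
apply: (@le_trans _ _ (\sum_(j < n) (1 : R))).
  by apply: ler_sum => j _; exact: spin_le1.
by rewrite sumr_const card_ord.
Qed.

Lemma pi_sqr b k f : 0 < k -> loc b -> (forall s, `|b s| <= 1 - 2 * k) ->
  loc f -> pi b f ^+ 2 <= pi b (f * f).
Proof.
move=> k0 lb bk lf.
have lff : loc (f * f) by auto.
have : 0 <= pi b (f * f - (2 * pi b f) *: f + cst (pi b f ^+ 2)).
  apply: (pi_ge0 k0) => //; first by auto.
  move=> s; rewrite !fctE /GRing.scale /=; have := sqr_ge0 (f s - pi b f); lra.
rewrite (piD k0)//; last by auto.
rewrite (piB k0)//; last by auto.
rewrite (piZ k0)// (pi_cst k0)//; lra.
Qed.

(* The martingale [S_n + u] has increments of conditional variance
   [(1 - b^2) (diff u)^2], whose mean is at least of order [chi^2]. *)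
Lemma variance_lower_bound b k chi : 0 < k -> 0 < chi -> response b chi ->
  exists n eta, [/\ (0 < n)%N, 0 < eta &
    forall b', loc b' -> (forall s, `|b' s| <= 1 - 2 * k) ->
      (forall s, `|b' s - b s| <= eta) ->
      n%:R * (k * chi ^+ 2 / 16) <= pi b' (spin_sum n * spin_sum n)].
Proof.
move=> k0 chi0 [u [v [lu lv uE vE ui]]].
have [Bu Bu0 hBu] := loc_bounded lu; have [Bv Bv0 hBv] := loc_bounded lv.
pose B := Bu + Bv + 1.
have B1 : 1 <= B by rewrite lerDr addr_ge0.
have B0 : 0 < B by exact: lt_le_trans B1.
have u_le s : `|u s| <= B by apply: (le_trans (hBu s)); rewrite /B; lra.
have v_le s : `|v s| <= B by apply: (le_trans (hBv s)); rewrite /B; lra.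
clearbody B.
have kc0 : 0 < k * chi ^+ 2 by rewrite mulr_gt0// exprn_gt0.
(* Long enough for the boundary term [u - spin 0], at most [B + 1], to be absorbed by the
   variance. *)
pose n := (Num.bound (16 * (B + 1) ^+ 2 / (k * chi ^+ 2))).+1.
have nB : (B + 1) ^+ 2 <= n%:R * (k * chi ^+ 2 / 16).
  have : 16 * (B + 1) ^+ 2 / (k * chi ^+ 2) <= n%:R.
    apply: (le_trans (ltW (archi_boundP _))); last by rewrite ler_nat.
    by apply: divr_ge0; [apply: mulr_ge0 => //; exact: sqr_ge0|exact: ltW].
  by rewrite ler_pdivrMr//; lra.
have n0 : (0 < n)%N by [].
clearbody n.
(* [eta * Q] will bound the cross term produced in one step by the drift of the perturbed kernel. As
   [Q] grows with [n], the radius [eta] is chosen after [n]. *)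
have [Q QE] : exists Q, Q = 2 * (n%:R + B + 1) * B by exists (2 * (n%:R + B + 1) * B).
have Q0 : 0 < Q by rewrite QE !mulr_gt0// ltr_wpDl// addr_ge0// ltW.
pose eta := Num.min (chi / (2 * B)) (k * chi ^+ 2 / (4 * Q)).
have eta0 : 0 < eta by rewrite lt_min !divr_gt0// mulr_gt0.
have etaB : eta * B <= chi / 2.
  have : eta <= chi / (2 * B) by rewrite ge_min lexx.
  by rewrite ler_pdivlMr ?mulr_gt0//; lra.
have etaQ : eta * Q <= k * chi ^+ 2 / 4.
  have : eta <= k * chi ^+ 2 / (4 * Q) by rewrite ge_min lexx orbT.
  by rewrite ler_pdivlMr ?mulr_gt0//; lra.
clearbody eta.
exists n, eta; split=> // b' lb' b'k b'b.
pose d := diff u.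
have ld : loc d by exact: loc_diff.
have d_le s : `|d s| <= B by exact: diff_bound.
have k1 : 0 <= 1 - 2 * k := le_trans (normr_ge0 _) (b'k (fun=> false)).
pose Th j : obs := spin_sum j + (u - spin 0).
have lTh j : loc (Th j) by apply: locD; [exact: loc_spin_sum|auto].
have Th_le j s : (j <= n)%N -> `|Th j s| <= n%:R + B + 1.
  move=> jn; rewrite /Th !fctE -[leRHS]addrA; apply: (le_trans (ler_normD _ _)); apply: lerD.
    by apply: (le_trans (spin_sum_norm _ _)); rewrite ler_nat.
  by apply: (le_trans (ler_normB _ _)); apply: lerD => //; exact: spin_le1.
have trb f : tr b f = tr b' f - (b' - b) * diff f by rewrite /tr; ring.
have pid : chi / 2 <= pi b' d.
  pose psi : obs := (b' - b) * diff v.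
  have psiE : psi = diff u - (cst chi + v - tr b' v) by rewrite vE trb /psi; ring.
  have lpsi : loc psi by rewrite psiE; auto 8.
  have -> : d = (cst chi + v - tr b' v) + psi by rewrite psiE /d; ring.
  rewrite (piD k0)//; last by auto.
  have -> : pi b' (cst chi + v - tr b' v) = chi by exact: (pi_unique k0 lb' b'k lv).
  have : `|pi b' psi| <= eta * B.
    apply: (pi_norm_le k0) => // s; rewrite normrM.
    have h1 := b'b s; have h2 := diff_bound s v_le.
    by apply: ler_pM.
  by rewrite ler_norml => /andP[? _]; lra.
have Thc j c s : Th j.+1 (scons c s) = spin_sum j s + u (scons c s).
  rewrite /Th !fctE /spin_sum big_ord_recl.
  have -> : \sum_(i < j) spin (lift ord0 i) (scons c s) = \sum_(i < j) spin i s :> R.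
    by apply: eq_bigr => i _.
  by rewrite /= ; ring.
have step j s : (j < n)%N ->
    (Th j * Th j) s - eta * Q + 2 * k * (d s * d s) <= tr b' (Th j.+1 * Th j.+1) s.
  move=> jn; rewrite trE !fctE !Thc.
  have uE' : spin_sum j s + tr b' u s = Th j s + (b' s - b s) * d s.
    have -> : tr b' u = u - spin 0 + (b' - b) * d by rewrite uE trb /d; ring.
    by rewrite /Th !fctE; ring.
  have -> : (1 + b' s) / 2 *
      ((spin_sum j s + u (scons true s)) * (spin_sum j s + u (scons true s))) +
      (1 - b' s) / 2 * ((spin_sum j s + u (scons false s)) * (spin_sum j s + u (scons false s))) =
      (Th j s + (b' s - b s) * d s) ^+ 2 + (1 - b' s ^+ 2) * (d s * d s).
    by rewrite -uE' trE /d /diff; field.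
  have cross : `|Th j s * ((b' s - b s) * d s)| <= (n%:R + B + 1) * (eta * B).
    rewrite normrM [X in _ * X]normrM; have h0 := Th_le j s (ltnW jn).
    by apply: ler_pM => //; apply: ler_pM; rewrite ?b'b ?d_le.
  have b'2 : b' s ^+ 2 <= 1 - 2 * k.
    have := b'k s; rewrite ler_norml => /andP[? ?]; nra.
  have dd : 0 <= d s * d s by rewrite -expr2 sqr_ge0.
  have h1 := ler_wpM2r dd b'2.
  have h2 := sqr_ge0 ((b' s - b s) * d s).
  move: cross; rewrite ler_norml => /andP[h3 _].
  rewrite sqrrD QE; lra.
have Thn j : (j <= n)%N -> j%:R * (k * chi ^+ 2 / 4) <= pi b' (Th j * Th j).
  elim: j => [_|j IH jn].
    rewrite mul0r; apply: (pi_ge0 k0) => //; first by auto.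
    by move=> s; rewrite !fctE -expr2 sqr_ge0.
  have lTT i : loc (Th i * Th i) by auto.
  have ldd : loc (d * d) by auto.
  rewrite -(pi_tr k0 lb' b'k (lTT j.+1)).
  apply: (@le_trans _ _ (pi b' (Th j * Th j - cst (eta * Q) + (2 * k) *: (d * d)))).
    rewrite (piD k0)//; [|by auto..].
    rewrite (piB k0)// (pi_cst k0)// (piZ k0)//.
    have h1 := IH (ltnW jn).
    have h2 := pi_sqr k0 lb' b'k ld.
    have h3 : (chi / 2) ^+ 2 <= pi b' d ^+ 2.
      by rewrite lerXn2r ?nnegrE ?(le_trans _ pid) ?divr_ge0// ltW.
    have h4 := ler_wpM2l (ltW k0) (le_trans h3 h2).
    rewrite -[j.+1]addn1 natrD; lra.
  by apply: (pi_le k0) => //; [auto 8|exact: loc_tr|move=> s; exact: step].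
have lSS : loc (spin_sum n * spin_sum n) by apply: locM; exact: loc_spin_sum.
(* The boundary term is removed by [(x + y) ^+ 2 / 2 - y ^+ 2 <= x ^+ 2]. *)
have : pi b' (2^-1 *: (Th n * Th n) - cst ((B + 1) ^+ 2)) <= pi b' (spin_sum n * spin_sum n).
  apply: (pi_le k0) => //; first by auto.
  move=> s; rewrite /Th !fctE /GRing.scale /=.
  have : `|u s - spin 0 s| <= B + 1.
    by apply: (le_trans (ler_normB _ _)); apply: lerD => //; exact: spin_le1.
  rewrite ler_norml; move: (spin_sum n s) (u s - spin 0 s) => x y /andP[? ?].
  have yB : y ^+ 2 <= (B + 1) ^+ 2 by nra.
  have := sqr_ge0 (x - y); lra.
rewrite (piB k0)//; last by auto.
rewrite (piZ k0) ?(pi_cst k0)//; last by auto.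
have := Thn n (leqnn n); lra.
Qed.

End Variance.

#[local] Hint Resolve loc_spin_sum : core.

(** * The sequence of kernels *)

Section Base.
Context {R : realType} (del : R) (del_gt0 : 0 < del) (del_le : del <= 2^-1).
Local Notation obs := (past bool -> R).

(* A nearly critical linear kernel, pushed past total oscillation 1 by a small
   multiple of the majority of the last three spins. *)
Definition base_mean : obs :=
  (1 - del) *: spin 0 + feedback 3 (3 / 2 * del) (del / 2).

Let h_ge0 : 0 <= del / 2. Proof. by apply: divr_ge0 => //; exact: ltW. Qed.
Let l_ge0 : 0 <= 3 / 2 * del. Proof. by apply: mulr_ge0 => //; exact: ltW. Qed.
Let c_ge0 : 0 <= 1 - del.
Proof. by rewrite subr_ge0 (le_trans del_le)// invf_le1// ler1n. Qed.

Lemma base_loc : loc base_mean.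
Proof. by rewrite /base_mean; auto. Qed.

Lemma base_incr : incr base_mean.
Proof.
by apply: incrD; [apply: incrZ => //; exact: incr_spin|exact: feedback_incr].
Qed.

Lemma base_odd : odd_obs base_mean.
Proof.
move=> s; rewrite /base_mean !fctE /GRing.scale /= odd_spin odd_feedback//.
by rewrite mulrN opprD.
Qed.

Lemma base_norm s : `|base_mean s| <= 1 - del / 2.
Proof.
rewrite /base_mean !fctE /GRing.scale /=.
apply: (le_trans (ler_normD _ _)).
have h1 : `|(1 - del) * spin 0 s| <= (1 - del) * 1.
  by rewrite normrM ger0_norm// ler_wpM2l// spin_le1.
have h2 : `|feedback 3 (3 / 2 * del) (del / 2) s| <= del / 2 by exact: feedback_norm.
by apply: (le_trans (lerD h1 h2)); lra.
Qed.

Lemma base_lips : lips (1 + del / 2) base_mean.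
Proof.
have := lipsD (lipsZ (1 - del) (lips_spin (R := R) 0))
  (lips_feedback 3 l_ge0 h_ge0).
by apply: lips_le; rewrite ger0_norm//; lra.
Qed.

(** The linear kernel [(1 - del) *: spin 0] has corrector [spin 0 / del], hence response [1 / del].
    The increasing feedback can only help: up to a constant, [del *: u] is [spin 0 + w] with [w]
    increasing. *)
Lemma base_response chi : response base_mean chi -> 1 <= del * chi.
Proof.
move=> [u [v [lu lv uE vE ui]]].
have d0 := del_gt0.
pose k := del / 4.
have k0 : 0 < k by rewrite divr_gt0.
have bk s : `|base_mean s| <= 1 - 2 * k.
  by apply: (le_trans (base_norm s)); rewrite /k; lra.
have lb := base_loc.
pose e : obs := feedback 3 (3 / 2 * del) (del / 2).
have le_ : loc e by exact: loc_feedback.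
have [w [lw wE]] := pi_poisson k0 lb bk le_.
have e0 : pi base_mean e = 0.
  by apply: (pi_odd k0) => //; [exact: base_odd|exact: odd_feedback].
have wi : incr w.
  by apply: (poisson_incr k0 lb bk lw base_incr _ wE); exact: feedback_incr.
rewrite e0 in wE.
have lz : loc (del *: u - spin 0 - w) by auto.
have [_ zc] : (0 : R) = 0 /\ forall s s', (del *: u - spin 0 - w) s = (del *: u - spin 0 - w) s'.
  apply: (harmonic_cst k0 lb bk lz).
  rewrite !trB trZ tr_spin0.
  have -> : tr base_mean u = u - spin 0 by rewrite uE; ring.
  have -> : tr base_mean w = w - e by rewrite wE -[cst 0]/(0 : obs); ring.
  by apply/funext => s; rewrite /base_mean -/e !fctE /GRing.scale /=; ring.
have du s : 1 <= del * diff u s.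
  have := zc (scons true s) (scons false s).
  have := diff_incr s wi.
  by rewrite /diff !fctE /GRing.scale /spin /=; lra.
have -> : chi = pi base_mean (diff u) by rewrite (pi_unique k0 lb bk lv vE).
rewrite -(piZ k0)//; last by auto.
rewrite -[leLHS](pi_cst k0 lb bk).
by apply: (pi_le k0) => //; auto.
Qed.

Lemma base_gap j : (j < 3)%N -> exists s,
  base_mean (upd s j true) - base_mean (upd s j false) =
  2 * (if j == 0%N then 1 - del / 2 else del / 2).
Proof.
move=> j3; have d0 := del_gt0.
(* The other two of the last three spins disagree, so spin [j] decides the majority. *)
exists (fun i => i == (if j == 0%N then 1 else 0)%N).
have majE t : feedback 3 (3 / 2 * del) (del / 2) t =
    clip (del / 2) (del / 2 * (spin 0 t + spin 1 t + spin 2 t)).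
  rewrite /feedback; congr clip; rewrite wmeanE !big_ord_recl big_ord0 /=.
  by rewrite -[bump 0 0]/1%N -[bump 0 (bump 0 0)]/2%N; field.
have cp : clip (del / 2) (del / 2) = del / 2 by rewrite clip_id// ger0_norm.
have cn : clip (del / 2) (- (del / 2)) = - (del / 2) by rewrite clipN// cp.
rewrite /base_mean !fctE /GRing.scale /= !majE.
case: j j3 => [|[|[|//]]] _; rewrite /spin /upd /=.
- have -> : del / 2 * (1 + 1 + -1) = del / 2 by ring.
  have -> : del / 2 * (-1 + 1 + -1) = - (del / 2) by ring.
  by rewrite cp cn; field.
- have -> : del / 2 * (1 + 1 + -1) = del / 2 by ring.
  have -> : del / 2 * (1 + -1 + -1) = - (del / 2) by ring.
  by rewrite cp cn; field.
- have -> : del / 2 * (1 + -1 + 1) = del / 2 by ring.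
  have -> : del / 2 * (1 + -1 + -1) = - (del / 2) by ring.
  by rewrite cp cn; field.
Qed.

End Base.

(** * Iteration of the amplification step *)

Section Stages.
Context {R : realType}.
Local Notation obs := (past bool -> R).

Lemma exists_kernel_sequence (eps : R) : 0 < eps ->
  exists (del k : R) (bs : nat -> obs) (eta : nat -> R) (L : R),
  [/\ [/\ 0 < del, del <= 2^-1, 0 < k & L <= 1 + eps],
      forall n, [/\ loc (bs n), odd_obs (bs n), incr (bs n - base_mean del),
                    lips L (bs n) & forall s, `|bs n s| <= 1 - 2 * k],
      (forall n, 0 < eta n <= 2^-1 ^+ n),
      (forall n m s, `|bs (n + m)%N s - bs n s| <= eta n) &
      forall C : R, exists n J, (0 < n)%N /\ forall m,
        n%:R * C <= pi (bs (J + m)%N) (spin_sum n * spin_sum n)].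
Proof.
move=> eps0.
(* The starting kernel uses [1 + del / 2] of the oscillation, and since [1 <= del * chi] the later
   feedbacks need at most [3 / 2 * del] more. *)
pose del : R := Num.min (eps / 2) 2^-1.
have del0 : 0 < del by rewrite lt_min divr_gt0//= invr_gt0.
have del_le : del <= 2^-1 by rewrite ge_min lexx orbT.
have del_eps : 2 * del <= eps.
  have : del <= eps / 2 by rewrite ge_min lexx.
  by lra.
clearbody del.
pose k := del / 8.
have k0 : 0 < k by rewrite divr_gt0.
pose b0 := base_mean del.
(* The summand [3 / (2 * chi)] is the oscillation reserved for all later feedbacks. [eta] is both
   the room left below [1 - 2 * k] and the radius in which the variance bound holds. *)
pose stage (p : obs * R * R) := let: (b, chi, eta) := p in
  [/\ [/\ loc b, incr b, odd_obs b & incr (b - b0)],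
      (forall s, `|b s| <= 1 - 2 * k - eta), 0 < chi /\ response b chi,
      exists2 L, lips L b & L + 3 / (2 * chi) <= 1 + eps &
      0 < eta /\ exists2 n, (0 < n)%N & forall b', loc b' ->
        (forall s, `|b' s| <= 1 - 2 * k) -> (forall s, `|b' s - b s| <= eta) ->
        n%:R * (k * chi ^+ 2 / 16) <= pi b' (spin_sum n * spin_sum n)].
(* Each change spends [eta - eta'] of the radius, so all later kernels remain within [eta] of the
   present one. *)
pose next (p q : obs * R * R) := let: (b, chi, eta) := p in
  let: (b', chi', eta') := q in
  [/\ 3 / 2 * chi <= chi', eta' <= eta / 2 &
      forall s, `|b' s - b s| <= eta - eta'].
have d0 := del0.
have stage0 : exists chi eta, [/\ stage (b0, chi, eta), eta <= 1 & 1 <= chi].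
  have lb := base_loc del.
  have bk s : `|b0 s| <= 1 - 2 * k.
    by apply: (le_trans (base_norm del0 del_le s)); rewrite /k; lra.
  have bi := base_incr del0 del_le.
  have bo := base_odd del0.
  have [chi [chiR _]] := exists_response k0 lb bi bo bk.
  have chi1 := base_response del0 del_le chiR.
  have chi_gt0 : 0 < chi by rewrite -(pmulr_rgt0 _ del0) (lt_le_trans ltr01).
  have [n [eta [n0 eta0 H]]] := variance_lower_bound k0 chi_gt0 chiR.
  exists chi, (Num.min eta (del / 4)); split.
  - split.
    + by split => //; rewrite subrr => s j.
    + move=> s; apply: (le_trans (base_norm del0 del_le s)).
      have : Num.min eta (del / 4) <= del / 4 by rewrite ge_min lexx orbT.
      by rewrite /k; lra.
    + by [].
    + exists (1 + del / 2); first exact: base_lips.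
      have : 3 / (2 * chi) <= 3 / 2 * del.
        by rewrite ler_pdivrMr ?mulr_gt0//; lra.
      by lra.
    + split; first by rewrite lt_min eta0 divr_gt0.
      exists n => // b' lb' b'k b'b; apply: H => // s.
      by apply: (le_trans (b'b s)); rewrite ge_min lexx.
  - by rewrite ge_min; apply/orP; right; lra.
  - by have := ler_wpM2r (ltW chi_gt0) del_le; lra.
have step p : stage p -> exists q, stage q /\ next p q.
  move: p => [[b chi] eta] [[lb bi bo bb] bk [chi0 chiR] [L bL Lchi] [eta0 _]].
  have eta20 : 0 < eta / 2 by rewrite divr_gt0.
  have bk2 s : `|b s| <= 1 - 2 * k - eta / 2 by apply: (le_trans (bk s)); lra.
  have [N [h [N0 h0 heta H]]] := response_step k0 lb bi eta20 bk2 chi0 chiR.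
  pose l := (2 * chi)^-1.
  have l0 : 0 <= l by rewrite invr_ge0 mulr_ge0// ltW.
  pose F := feedback N l h; pose b' := b + F.
  have F_le s : `|F s| <= h by apply: feedback_norm; exact: ltW.
  have lF : loc F by exact: loc_feedback.
  have Fi : incr F by apply: feedback_incr => //; exact: ltW.
  have lb' : loc b' by exact: locD.
  have b'i : incr b' by exact: incrD.
  have b'o : odd_obs b'.
    by move=> s; rewrite /b' !fctE bo /F odd_feedback ?opprD//; exact: ltW.
  have b'k s : `|b' s| <= 1 - 2 * k - eta / 2.
    by rewrite /b' !fctE; apply: (le_trans (ler_normD _ _)); have := bk s; have := F_le s; lra.
  have b'k0 s : `|b' s| <= 1 - 2 * k by apply: (le_trans (b'k s)); lra.
  have [chi' [chi'R chi'_le]] := exists_response k0 lb' b'i b'o b'k0.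
  have chi'_ge := H chi' chi'_le.
  have chi'0 : 0 < chi' by apply: lt_le_trans chi'_ge; rewrite mulr_gt0.
  have [n [eta1 [n0 eta10 H1]]] := variance_lower_bound k0 chi'0 chi'R.
  pose eta' := Num.min eta1 (eta / 2).
  have eta'_le : eta' <= eta / 2 by rewrite ge_min lexx orbT.
  exists (b', chi', eta'); split.
    split.
    + split => //; have -> : b' - b0 = (b - b0) + F by rewrite /b'; ring.
      exact: incrD.
    + by move=> s; apply: (le_trans (b'k s)); lra.
    + by [].
    + exists (L + l); first by apply: lipsD => //; apply: lips_feedback => //; exact: ltW.
      have : 3 / (2 * chi') <= 2 * l.
        rewrite ler_pdivrMr ?mulr_gt0//.
        have : 2 * l * (3 / 2 * chi) <= 2 * l * chi' by rewrite ler_wpM2l// mulr_ge0.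
        have -> : 2 * l * (3 / 2 * chi) = 3 / 2 by rewrite /l; field; rewrite gt_eqF.
        lra.
      have : 3 / (2 * chi) = 3 * l by [].
      by lra.
    + split; first by rewrite lt_min eta10.
      exists n => // b'' lb'' b''k b''b; apply: H1 => // s.
      by apply: (le_trans (b''b s)); rewrite ge_min lexx.
  split => // s; rewrite /b' !fctE addrAC subrr add0r.
  by apply: (le_trans (F_le s)); lra.
have [chi0 [eta0 [st0 eta01 chi01]]] := stage0.
pose X := {p : obs * R * R | stage p}.
have stepX (x : X) : {y : X | next (sval x) (sval y)}.
  have [q [sq nq]] := cid (step (sval x) (svalP x)).
  by exists (exist _ q sq).
have [f [f0 fS]] := @dependent_choice X _ stepX (exist _ (b0, chi0, eta0) st0).
pose bs n := (sval (f n)).1.1; pose chi n := (sval (f n)).1.2.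
pose eta n := (sval (f n)).2.
have st n : stage (bs n, chi n, eta n).
  by rewrite /bs /chi /eta; case: (f n) => -[[? ?] ?] /=.
have nx n : next (bs n, chi n, eta n) (bs n.+1, chi n.+1, eta n.+1).
  by have := fS n; rewrite /bs /chi /eta; case: (sval (f n)) => -[? ?] ?;
    case: (sval _) => -[? ?] ?.
have etaP n : 0 < eta n by case: (st n) => _ _ _ _ [].
have chiP n : (3 / 2) ^+ n <= chi n.
  elim: n => [|n IH]; first by rewrite expr0 /chi f0.
  by rewrite exprS; case: (nx n) => h _ _; apply: le_trans h; rewrite ler_wpM2l.
have etaN n : eta n <= 2^-1 ^+ n.
  elim: n => [|n IH]; first by rewrite expr0 /eta f0.
  case: (nx n) => _ h _; apply: (le_trans h).
  by rewrite exprS mulrC ler_wpM2l// invr_ge0.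
have bsd n m s : `|bs (n + m)%N s - bs n s| <= eta n - eta (n + m)%N.
  elim: m => [|m IH]; first by rewrite addn0 !subrr normr0.
  rewrite addnS; case: (nx (n + m)%N) => _ _ /(_ s) h.
  have -> : bs (n + m).+1 s - bs n s =
    (bs (n + m).+1 s - bs (n + m)%N s) + (bs (n + m)%N s - bs n s) by ring.
  by apply: (le_trans (ler_normD _ _)); lra.
have bsk n s : `|bs n s| <= 1 - 2 * k.
  by case: (st n) => _ /(_ s) h _ _ _; apply: (le_trans h); have := etaP n; lra.
exists del, k, bs, eta, (1 + eps); split => //.
- move=> n; case: (st n) => -[lb bi bo bb] _ [chi_gt0 _] [L bL Lchi] _; split => //.
  apply: lips_le bL; apply: le_trans Lchi; rewrite lerDl; apply: divr_ge0 => //.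
  by apply: mulr_ge0 => //; exact: ltW.
- by move=> n; rewrite etaP etaN.
- by move=> n m s; apply: (le_trans (bsd n m s)); have := etaP (n + m)%N; lra.
- move=> C.
  have grow j : j%:R / 4 <= (3 / 2 : R) ^+ j.
    elim: j => [|j IH]; first by rewrite mul0r.
    have : 1 <= (3 / 2 : R) ^+ j by rewrite exprn_ege1//; lra.
    by rewrite exprS -[j.+1]addn1 natrD; lra.
  (* The factor 4 compensates the crude bound [J / 4 <= (3 / 2) ^+ J]. *)
  pose J := (4 * (Num.bound (16 * `|C| / k)).+1)%N.
  have hJ : C <= k * chi J ^+ 2 / 16.
    have c1 : (Num.bound (16 * `|C| / k)).+1%:R <= chi J.
      apply: le_trans (chiP J); apply: le_trans (grow J).
      rewrite le_eqVlt; apply/orP; left; apply/eqP.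
      by rewrite /J natrM; field.
    have c2 : 16 * `|C| / k <= chi J.
      apply: le_trans c1; apply: (le_trans (ltW (archi_boundP _))); last by rewrite ler_nat.
      by rewrite divr_ge0 ?mulr_ge0// ltW.
    have c3 : 1 <= chi J by apply: le_trans c1; rewrite ler1n.
    have c4 : 16 * `|C| <= chi J * k by rewrite -ler_pdivrMr.
    have c5 := ler_norm C.
    have c6 : chi J * k <= chi J * k * chi J.
      by rewrite -[leLHS]mulr1 ler_wpM2l// mulr_ge0// ?(ltW k0)// (le_trans ler01).
    by rewrite expr2; lra.
  case: (st J) => _ _ _ _ [_ [n n0 H]].
  exists n, J; split => // m.
  apply: (@le_trans _ _ (n%:R * (k * chi J ^+ 2 / 16))); first by rewrite ler_wpM2l.
  have [[lbJ _ _ _] _ _ _ _] := st (J + m)%N.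
  apply: H => //.
  by move=> s; apply: (le_trans (bsd J m s)); have := etaP (J + m)%N; lra.
Qed.

End Stages.

(** * Generalized limits *)

Section UltraLimit.
Context {R : realType}.

Definition bounded_seq (x : nat -> R) := exists B, forall n, `|x n| <= B.

(** Limits along an ultrafilter containing all tails of [nat]. They are applied to stationary means,
    which are bounded but not known to converge. *)
Lemma exists_generalized_limit : exists Lm : (nat -> R) -> R,
  [/\ forall x y, bounded_seq x -> bounded_seq y ->
        Lm (fun n => x n + y n) = Lm x + Lm y,
      forall c x, bounded_seq x -> Lm (fun n => c * x n) = c * Lm x,
      forall c, Lm (fun=> c) = c &
      forall x y N, bounded_seq x -> bounded_seq y ->
        (forall n, (N <= n)%N -> x n <= y n) -> Lm x <= Lm y].
Proof.
have [G [GU GN]] := ultraFilterLemma (@eventually_filter).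
have Gcvg x : bounded_seq x -> cvg (x n @[n --> G]).
  move=> [B xB].
  have FU : UltraFilter (x n @[n --> G]).
    split=> [|H HF sH]; rewrite ?eqEsubset; first exact: fmap_proper_filter.
    split => // A HA; have [//|GnA] := in_ultra_setVsetC (x @^-1` A) GU.
    have : H (A `&` ~` A) by apply: filterI => //; exact: sH.
    by rewrite setICr => /filter_not_empty.
  have := @segment_compact R (- B) B; rewrite compact_ultra => /(_ _ FU) [].
    rewrite /nbhs /=; apply: (@filterS _ G _ setT); last exact: filterT.
    by move=> n _ /=; rewrite in_itv /= -ler_norml.
  by move=> p [_ xp]; apply/cvg_ex; exists p.
exists (fun x => lim (x n @[n --> G])); split.
- by move=> x y /Gcvg cx /Gcvg cy; apply/cvg_lim => //; exact: cvgD.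
- by move=> c x /Gcvg cx; apply/cvg_lim => //; exact: cvgMr.
- by move=> c; apply/cvg_lim => //; exact: cvg_cst.
- move=> x y N /Gcvg cx /Gcvg cy xy; apply: ler_lim => //.
  by apply: GN; exists N.
Qed.

End UltraLimit.

(** * Nested partitions of the unit interval *)

Section PathMeasure.
Context {R : realType}.
Local Notation obs := (past bool -> R).

Definition cyl (k : nat) (x : past bool) : obs :=
  fun s => if [forall j : 'I_k, s j == x j] then 1 else 0.

Lemma cylP k (x s : past bool) :
  reflect (forall j, (j < k)%N -> s j = x j) [forall j : 'I_k, s j == x j].
Proof.
apply: (iffP forallP) => [h j jk|h j]; last by apply/eqP/h.
by have := h (Ordinal jk) => /eqP.
Qed.

Lemma loc_cyl k x : loc (cyl k x).
Proof.
exists k => s s' ss'; rewrite /cyl; congr (if _ then _ else _).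
by apply/cylP/cylP => h j jk; rewrite -?ss' ?h// ss' ?h.
Qed.

Lemma cylS k x : cyl k x = cyl k.+1 (upd x k false) + cyl k.+1 (upd x k true).
Proof.
apply/funext => s; rewrite fctE /cyl.
have [h|h] := cylP k x s; last first.
  have hc c : [forall j : 'I_k.+1, s j == upd x k c j] = false.
    apply/negP => /cylP h'; apply: h => j jk.
    by rewrite (h' j (ltnW jk)) /upd ltn_eqF.
  by rewrite !hc addr0.
have hc c : [forall j : 'I_k.+1, s j == upd x k c j] = (s k == c).
  apply/cylP/eqP => [h'|sk j]; first by rewrite h' // /upd eqxx.
  by rewrite ltnS leq_eqVlt /upd => /orP[/eqP->|jk]; rewrite ?eqxx// ltn_eqF ?h.
by rewrite !hc; case: (s k); rewrite /= ?addr0 ?add0r.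
Qed.

Context (F : obs -> R).
Context (F_add : forall f g, loc f -> loc g -> F (f + g) = F f + F g)
  (F_ge0 : forall f, loc f -> (forall s, 0 <= f s) -> 0 <= F f)
  (F_cst : F (cst 1) = 1).

Definition cell_len k x : R := F (cyl k x).

(** Left end of the cell of [x] at level [k], when each cell is cut with its [false] child on the
    left. *)
Fixpoint cell_left k x : R := if k is k'.+1 then
  cell_left k' x + (if x k' then cell_len k (upd x k' false) else 0) else 0.

Lemma cell_lenS k x :
  cell_len k x = cell_len k.+1 (upd x k false) + cell_len k.+1 (upd x k true).
Proof. by rewrite /cell_len cylS F_add//; exact: loc_cyl. Qed.

Lemma cell_len_ge0 k x : 0 <= cell_len k x.
Proof. by apply: F_ge0 => [|s]; [exact: loc_cyl|rewrite /cyl; case: ifP]. Qed.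

Lemma cell_len0 x : cell_len 0 x = 1.
Proof.
rewrite /cell_len -[RHS]F_cst; congr F; apply/funext => s; rewrite /cyl.
by case: cylP => // -[].
Qed.

Lemma cell_len_ext k x y : (forall j, (j < k)%N -> x j = y j) ->
  cell_len k x = cell_len k y.
Proof.
move=> xy; rewrite /cell_len; congr F; apply/funext => s; rewrite /cyl.
congr (if _ then _ else _).
by apply/cylP/cylP => h j jk; rewrite h// xy.
Qed.

Lemma cell_left_ext k x y : (forall j, (j < k)%N -> x j = y j) ->
  cell_left k x = cell_left k y.
Proof.
elim: k => [//|k IH] xy /=; rewrite (IH) => [|j jk]; last by rewrite xy// ltnW.
rewrite xy//; congr (_ + _); case: (y k) => //; apply: cell_len_ext => j jk.
by rewrite /upd; case: eqP => // /eqP jk'; rewrite xy// ltn_neqAle jk' -ltnS.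
Qed.

(* The [k]-th binary digit of [t] for the nested partitions of [0, 1[ whose
   [k]-th level cells have lengths [cell_len k]. *)
Fixpoint digits (t : R) k : past bool := if k is k'.+1 then
  upd (digits t k') k'
    (cell_left k' (digits t k') + cell_len k (upd (digits t k') k' false) <= t)
  else fun=> false.

Definition digit (t : R) : past bool := fun k => digits t k.+1 k.

Lemma digits_digit t k j : (j < k)%N -> digits t k j = digit t j.
Proof.
elim: k => [//|k IH]; rewrite ltnS leq_eqVlt => /orP[/eqP->//|jk].
by rewrite /= /upd ltn_eqF// IH.
Qed.

Lemma digitE t k : digit t k =
  (cell_left k (digit t) + cell_len k.+1 (upd (digit t) k false) <= t).
Proof.
rewrite {1}/digit /= /upd eqxx; congr (_ + _ <= _).
  by apply: cell_left_ext => j; exact: digits_digit.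
by apply: cell_len_ext => j; rewrite ltnS leq_eqVlt => /orP[/eqP->|jk];
  rewrite /upd ?eqxx// ltn_eqF ?digits_digit.
Qed.

Lemma digit_cell k x (t : R) : 0 <= t < 1 ->
  (forall j, (j < k)%N -> digit t j = x j) <->
  cell_left k x <= t < cell_left k x + cell_len k x.
Proof.
move=> t01; elim: k => [|k IH] /=; first by rewrite cell_len0 add0r.
have lenU : cell_len k.+1 x = cell_len k.+1 (upd x k (x k)) by rewrite upd_eta.
have lS := cell_lenS k x.
have l1 := cell_len_ge0 k.+1 (upd x k true).
have l2 := cell_len_ge0 k.+1 (upd x k false).
have key : (forall j, (j < k)%N -> digit t j = x j) ->
    digit t k = (cell_left k x + cell_len k.+1 (upd x k false) <= t).
  move=> h; rewrite digitE; congr (_ + _ <= _); first exact: cell_left_ext.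
  apply: cell_len_ext => j; rewrite ltnS leq_eqVlt => /orP[/eqP->|jk].
    by rewrite /upd eqxx.
  by rewrite /upd ltn_eqF// h.
split=> [h|].
  have h' j : (j < k)%N -> digit t j = x j by move=> jk; apply: h; exact: ltnW.
  have /andP[t1 t2] := IH.1 h'.
  have := key h'; rewrite (h k (ltnSn k)) lenU.
  case xk : (x k) => /esym.
    by move=> t3; apply/andP; split; lra.
  by move=> /negbT; rewrite -ltNge addr0 => t3; apply/andP; split; lra.
rewrite lenU; case xk : (x k) => /andP[t1 t2] j.
  have h' : forall j, (j < k)%N -> digit t j = x j by apply/IH/andP; split; lra.
  rewrite ltnS leq_eqVlt => /orP[/eqP->|/h'//].
  by rewrite key// xk.
have h' : forall j, (j < k)%N -> digit t j = x j by apply/IH/andP; split; lra.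
rewrite ltnS leq_eqVlt => /orP[/eqP->|/h'//].
by rewrite key// xk; apply/negbTE; rewrite -ltNge; lra.
Qed.

End PathMeasure.

(** * Probability measures from positive functionals *)

Section DigitLaw.
Context {R : realType}.
Local Notation obs := (past bool -> R).
Context (F : obs -> R).
Context (F_add : forall f g, loc f -> loc g -> F (f + g) = F f + F g)
  (F_scale : forall c f, loc f -> F (c *: f) = c * F f)
  (F_ge0 : forall f, loc f -> (forall s, 0 <= f s) -> 0 <= F f)
  (F_cst : F (cst 1) = 1).

Local Notation P := (@uniform_prob R 0 1 ltr01).
Local Notation digit := (digit F).

Lemma uniform01_itv (l d : R) : 0 <= l -> 0 <= d -> l + d <= 1 ->
  P `[l, l + d[%classic = d%:E.
Proof.
move=> l0 d0 ld.
rewrite /uniform_prob integral_uniform_pdf setIidl; last first.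
  move=> x /=; rewrite !in_itv /= => /andP[x1 x2]; apply/andP; split; lra.
rewrite (eq_integral (cst 1%:E)); last first.
  move=> x; rewrite inE /= in_itv /= => /andP[x1 x2].
  by rewrite /uniform_pdf subr0 invr1 ifT//; apply/andP; split; lra.
rewrite integral_cst//= mul1e lebesgue_measure_itv /= lte_fin.
have [d1|d1] := ltP l (l + d); first by rewrite -EFinB addrAC subrr add0r.
by congr EFin; lra.
Qed.

(** [digit_cell] describes the digits of points of [[0, 1[] only; the other points form a null
    set. *)
Lemma uniform01_restr (A : set R) : measurable A -> P A = P (A `&` `[0, 1[%classic).
Proof.
move=> mA; have mI : measurable (`[0, 1[%classic : set R) by exact: measurable_itv.
have PI : P `[0, 1[%classic = 1%:E.
  by have := @uniform01_itv 0 1; rewrite add0r => ->.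
have PC : P (A `&` ~` `[0, 1[%classic) = 0%E.
  apply/eqP; rewrite eq_le measure_ge0 andbT.
  apply: (@le_trans _ _ (P (~` `[0, 1[%classic))).
    by apply: le_measure; rewrite ?inE;
      [apply: measurableI => //; exact: measurableC|exact: measurableC|exact: subIsetr].
  by rewrite probability_setC// [X in (1 - X)%E]PI subee.
rewrite -[in LHS](setUIDK A `[0, 1[%classic) measureU//.
- by rewrite setDE [X in (_ + X)%E]PC adde0.
- exact: measurableI.
- exact: measurableD.
- by apply/seteqP; split => // x [[_ Ix] [_ nIx]]; exact: nIx.
Qed.

Definition agree (k : nat) (x : past bool) : set R :=
  [set t | forall j, (j < k)%N -> digit t j = x j].

Lemma agreeS k x : agree k.+1 x = agree k x `&` [set t | digit t k = x k].
Proof.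
apply/seteqP; split => t /=.
  by move=> h; split => [j jk|]; apply: h => //; exact: ltnW.
by move=> [h hk] j; rewrite ltnS leq_eqVlt => /orP[/eqP->//|/h].
Qed.

Lemma measurable_agree k x : measurable (agree k x).
Proof.
elim: k => [|k IH].
  by rewrite (_ : agree 0 x = setT)//; apply/seteqP; split.
rewrite agreeS.
pose c := cell_left F k x + cell_len F k.+1 (upd x k false).
have -> : agree k x `&` [set t | digit t k = x k] =
    agree k x `&` [set t | (c <= t) = x k].
  have dE t : agree k x t -> digit t k = (c <= t).
    move=> h; rewrite digitE /c; congr (_ + _ <= _); first exact: cell_left_ext.
    apply: cell_len_ext => j; rewrite ltnS leq_eqVlt => /orP[/eqP->|jk].
      by rewrite /upd eqxx.
    by rewrite /upd ltn_eqF// h.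
  by apply/seteqP; split => t /= [h]; [rewrite dE|rewrite -dE].
apply: measurableI => //; case: (x k).
  rewrite (_ : mkset _ = `[c, +oo[%classic); first exact: measurable_itv.
  by apply/seteqP; split => t /=; rewrite in_itv /= andbT.
rewrite (_ : mkset _ = `]-oo, c[%classic); first exact: measurable_itv.
apply/seteqP; split => t /=; rewrite in_itv /= ltNge; first by move=> ->.
by move/negbTE.
Qed.

Lemma cell_bounds k x :
  0 <= cell_left F k x /\ cell_left F k x + cell_len F k x <= 1.
Proof.
elim: k => [|k [IH1 IH2]] /=; first by rewrite cell_len0// add0r.
have lS := cell_lenS F_add k x.
have l1 := cell_len_ge0 F_ge0 k.+1 (upd x k true).
have l2 := cell_len_ge0 F_ge0 k.+1 (upd x k false).
have -> : cell_len F k.+1 x = cell_len F k.+1 (upd x k (x k)) by rewrite upd_eta.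
by case: (x k); split; lra.
Qed.

Lemma prob_agree k x : P (agree k x) = (F (cyl k x))%:E.
Proof.
have [h1 h2] := cell_bounds k x.
have l0 := cell_len_ge0 F_ge0 k x.
rewrite uniform01_restr; last exact: measurable_agree.
rewrite -[F _]/(cell_len F k x) -(uniform01_itv h1 l0 h2).
congr (P _); apply/seteqP; split => t /=; rewrite !in_itv /=.
  by move=> [h t01]; apply/(digit_cell F_add F_ge0 F_cst).
move=> h; have t01 : 0 <= t < 1 by move/andP: h => [? ?]; apply/andP; split; lra.
by split => //; apply/(digit_cell F_add F_ge0 F_cst).
Qed.

Lemma measurable_digit_event k (p : past bool -> Prop) :
  (forall s s', (forall j, (j < k)%N -> s j = s' j) -> p s -> p s') ->
  measurable [set t | p (digit t)].
Proof.
move=> pk; pose ext (w : k.-tuple bool) : past bool := nth false w.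
have -> : [set t | p (digit t)] =
    \bigcup_(w in [set w : k.-tuple bool | p (ext w)]) agree k (ext w).
  apply/seteqP; split => [t /= pt|t [w /= pw] h]; last first.
    by apply: pk pw => j jk; rewrite h.
  have extE j : (j < k)%N -> ext [tuple of mkseq (digit t) k] j = digit t j.
    by move=> jk; rewrite /ext /= nth_mkseq.
  exists [tuple of mkseq (digit t) k] => /=.
    by apply: pk pt => j jk; rewrite extE.
  by move=> j jk; rewrite extE.
apply: fin_bigcup_measurable; first exact: finite_finset.
by move=> w _; exact: measurable_agree.
Qed.

Lemma measurable_local_digit (f : obs) : loc f ->
  measurable_fun setT (fun t => f (digit t)).
Proof.
move=> [k fk] _ B mB; rewrite setTI.
apply: (@measurable_digit_event k (fun s => B (f s))) => s s' ss'.
by rewrite (fk _ _ ss').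
Qed.

(** Induction from fine to coarse cells: at level [k] the function is constant on each cell, and a
    coarser cell is the disjoint union of its two children. *)
Lemma integral_local_digit (f : obs) : loc f ->
  (\int[P]_t (f (digit t))%:E = (F f)%:E)%E.
Proof.
move=> lf; have [k fk] := lf.
have main d n x : (n + d)%N = k ->
    (\int[P]_(t in agree n x) (f (digit t))%:E = (F (f * cyl n x))%:E)%E.
  elim: d n x => [|d IH] n x nk.
    have nE : n = k by lia.
    rewrite (eq_integral (cst (f x)%:E)) => [|t]; last first.
      rewrite inE => h; congr EFin; apply: fk => j; rewrite -nE; exact: h.
    rewrite integral_cst//; last exact: measurable_agree.
    rewrite [X in (_ * X)%E](prob_agree n x) -EFinM; congr EFin.
    rewrite -F_scale; last exact: loc_cyl.
    congr F; apply/funext => s; rewrite !fctE /GRing.scale /= /cyl.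
    case: cylP => h; last by rewrite !mulr0.
    by congr (_ * _); apply: fk => j; rewrite -nE => jn; rewrite h.
  have -> : agree n x = agree n.+1 (upd x n false) `|` agree n.+1 (upd x n true).
    have ag c : agree n (upd x n c) = agree n x.
      by apply/seteqP; split => t /= h j jn; rewrite h// /upd ltn_eqF.
    rewrite !agreeS !ag -setIUr [X in _ `&` X](_ : _ = setT) ?setIT//.
    by apply/seteqP; split => t //= _; rewrite /upd eqxx; case: (digit t n); [right|left].
  rewrite integral_setU; [|exact: measurable_agree|exact: measurable_agree| |].
  - have nk' : (n.+1 + d)%N = k by lia.
    rewrite (IH _ _ nk') (IH _ _ nk') -EFinD -F_add.
    + by congr (F _)%:E; rewrite (cylS n x) mulrDr.
    + by apply: locM => //; exact: loc_cyl.
    + by apply: locM => //; exact: loc_cyl.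
  - by apply/measurable_realfun.measurable_EFinP; apply: measurable_funTS;
    exact: measurable_local_digit.
  - rewrite disj_set2E; apply/eqP/seteqP; split => t //= [h1 h2].
    by have := h1 n (ltnSn n); rewrite h2// /upd eqxx.
have := main k 0%N (fun=> false) (add0n k).
have -> : agree 0 (fun=> false) = setT by apply/seteqP; split.
have -> : cyl 0 (fun=> false) = 1 :> obs.
  by apply/funext => s; rewrite /cyl; case: (cylP 0 (fun=> false) s) => // -[].
by rewrite mulr1.
Qed.

End DigitLaw.

(** * Transfer to two-sided sequences *)

Section BiseqMeasure.
Context {R : realType}.
Implicit Types (w : int -> bool) (m : nat).

Definition bdep (T : Type) m (f : (int -> bool) -> T) :=
  forall w w', (forall i : int, (`|i| <= m)%N -> w i = w' i) -> f w = f w'.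

Definition bloc (T : Type) (f : (int -> bool) -> T) := exists m, bdep m f.

Lemma pickle_bound m : exists K, forall i : int, (`|i| <= m)%N -> (pickle i < K)%N.
Proof.
exists (\max_(a < m.+1) maxn (pickle (a : int)) (pickle (- (a : int)%R : int))).+1.
move=> i im; rewrite ltnS.
have := @leq_bigmax_cond _ xpredT
  (fun a : 'I_m.+1 => maxn (pickle (a : int)) (pickle (- (a : int)%R : int)))
  (Ordinal (im : (`|i| < m.+1)%N)) isT.
apply: leq_trans => /=; rewrite leq_max.
by case: (ger0P i) => [i0|i0]; [rewrite gez0_abs ?leqnn|rewrite lez0_abs ?opprK ?leqnn ?orbT// ltW].
Qed.

Lemma measurable_biseq_event m (p : (int -> bool) -> Prop) :
  bdep m p -> measurable ([set w | p w] : set (biseq bool)).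
Proof.
move=> pm.
pose r (v : (m + m).+1.-tuple bool) : int -> bool := fun i => nth false v (absz (i + m%:Z)).
have -> : [set w | p w] = \bigcup_(v in [set v | p (r v)])
    [set w | forall k : int, - m%:Z <= k <= m%:Z -> w k = r v k].
  apply/seteqP; split => [w /= pw|w [v /= pv] h]; last first.
    by rewrite (pm w (r v))// => i im; apply: h; lia.
  pose v := [tuple of mkseq (fun j => w (j%:Z - m%:Z)) (m + m).+1].
  have rv k : - m%:Z <= k <= m%:Z -> w k = r v k.
    by move=> km; rewrite /r /= nth_mkseq; [congr w; lia|lia].
  exists v => //=; rewrite -(pm w (r v))// => i im; apply: rv; lia.
apply: fin_bigcup_measurable; first exact: finite_finset.
move=> v _; apply: sub_sigma_algebra.
by exists (- m%:Z), m%:Z, (r v); split => //; lia.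
Qed.

Lemma measurable_bloc d (T : measurableType d) (f : (int -> bool) -> T) :
  bloc f -> measurable_fun [set: biseq bool] f.
Proof.
move=> [m fm] _ B mB; rewrite setTI.
by apply: (@measurable_biseq_event m (fun w => B (f w))) => w w' ww'; rewrite (fm _ _ ww').
Qed.

Lemma bounded_integrable d (T : measurableType d) (P : probability T R)
    (f : T -> R) (B : R) : measurable_fun setT f -> (forall x, `|f x| <= B) ->
  P.-integrable setT (EFin \o f).
Proof.
move=> mf fB; apply: (@le_integrable _ _ _ _ _ _ _ (EFin \o cst B)) => //.
- exact/measurable_realfun.measurable_EFinP.
- move=> x _ /=; rewrite lee_fin; apply: (le_trans (fB x)); exact: ler_norm.
- exact: finite_measure_integrable_cst.
Qed.

Context (E : ((int -> bool) -> R) -> R).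
Context (E_add : forall f g, bloc f -> bloc g -> E (f + g) = E f + E g)
  (E_scale : forall c f, bloc f -> E (c *: f) = c * E f)
  (E_ge0 : forall f, bloc f -> (forall w, 0 <= f w) -> 0 <= E f)
  (E_cst : E (cst 1) = 1).

(** The default value at naturals coding no integer is harmless: only the positions [pickle i] are
    read back. *)
Let decode (j : nat) : int := odflt 0 (unpickle j).

Let F (f : past bool -> R) : R := E (fun w => f (fun j => w (decode j))).

Let F_bloc (f : past bool -> R) : loc f -> bloc (fun w => f (fun j => w (decode j))).
Proof.
move=> [k fk]; exists (\max_(j < k) `|decode j|%N) => w w' ww'.
apply: fk => j jk; apply: ww'.
exact: (@leq_bigmax_cond _ xpredT (fun j : 'I_k => `|decode j|%N) (Ordinal jk)).
Qed.

Let F_add f g : loc f -> loc g -> F (f + g) = F f + F g.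
Proof. by move=> /F_bloc lf /F_bloc lg; exact: E_add. Qed.

Let F_scale c f : loc f -> F (c *: f) = c * F f.
Proof. by move=> /F_bloc lf; exact: E_scale. Qed.

Let F_ge0 f : loc f -> (forall s, 0 <= f s) -> 0 <= F f.
Proof. by move=> /F_bloc lf f0; exact: E_ge0. Qed.

Let F_cst : F (cst 1) = 1.
Proof. exact: E_cst. Qed.

Let path (t : measurableTypeR R) : biseq bool := fun i : int => digit F t (pickle i).

Let loc_unfold (f : (int -> bool) -> R) : bloc f ->
  loc (fun s : past bool => f (fun i => s (pickle i))).
Proof.
move=> [m fm]; have [K Km] := pickle_bound m; exists K => s s' ss'.
by apply: fm => i im; apply: ss'; exact: Km.
Qed.

Let measurable_path : measurable_fun setT path.
Proof.
apply: (@measurability _ _ _ (biseq bool) setT path (@cylinders bool)) => //.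
move=> _ [_ [i [j [eta [ij ->]]]] <-].
rewrite setTI.
have [K Kb] := pickle_bound (`|i| + `|j|)%N.
apply: (@measurable_digit_event R F K
  (fun s => forall k : int, i <= k <= j -> s (pickle k) = eta k)) => s s' ss' h k kij.
by rewrite -ss' ?h//; apply: Kb; lia.
Qed.

(** In the role of an extension theorem: the functional is carried to sequences indexed by [nat] and
    realized as the law of the digits of a uniform point. *)
Lemma exists_biseq_measure : exists mu : probability (biseq bool) R,
  forall f, bloc f -> (\int[mu]_w (f w)%:E = (E f)%:E)%E.
Proof.
pose X : {mfun measurableTypeR R >-> biseq bool} := mfun_Sub (mem_set measurable_path).
exists (distribution (uniform_prob (@ltr01 R)) X) => f lf.
have lf' := loc_unfold lf.
have [B _ fB] := loc_bounded lf'.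
have fE : F (fun s => f (fun i => s (pickle i))) = E f.
  rewrite /F; congr E; apply/funext => w; congr f; apply/funext => i.
  by rewrite /decode pickleK.
rewrite integral_distribution.
- by rewrite -fE -(integral_local_digit F_add F_scale F_ge0 F_cst lf').
- by apply/measurable_realfun.measurable_EFinP; exact: measurable_bloc.
- apply: (@bounded_integrable _ _ _ (f \o path) B).
    exact: (measurable_local_digit F lf').
  by move=> t; exact: fB.
Qed.

End BiseqMeasure.

(** * The limit measure *)

Section LimitMeasure.
Context {R : realType}.
Local Notation obs := (past bool -> R).

(** The intervals of radius [eta n] around [bs n s] meet pairwise, so the supremum of their left
    ends lies in all of them. *)
Lemma exists_uniform_limit (bs : nat -> obs) (eta : nat -> R) :
  (forall n m s, `|bs (n + m)%N s - bs n s| <= eta n) ->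
  exists b : obs, forall n s, `|b s - bs n s| <= eta n.
Proof.
move=> bsd; pose A s : set R := range (fun n => bs n s - eta n).
have cmp n m s : bs n s - eta n <= bs m s + eta m.
  have h p q : (p <= q)%N -> `|bs q s - bs p s| <= eta p.
    by move=> pq; rewrite -(subnKC pq).
  have eta0 p : 0 <= eta p by exact: le_trans (bsd p 0%N s).
  have := eta0 n; have := eta0 m.
  have [nm|/ltnW mn] := leqP n m.
    by have := h _ _ nm; rewrite ler_norml => /andP[]; lra.
  by have := h _ _ mn; rewrite ler_norml => /andP[]; lra.
exists (fun s => sup (A s)) => n s; rewrite ler_norml; apply/andP; split.
  suff : bs n s - eta n <= sup (A s) by lra.
  by apply: ub_le_sup; [exists (bs 0%N s + eta 0%N) => _ [m _ <-]; exact: cmp|exists n].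
suff : sup (A s) <= bs n s + eta n by lra.
by apply: ge_sup; [exists (bs 0%N s - eta 0%N), 0%N|move=> _ [m _ <-]; exact: cmp].
Qed.

Lemma bloc_bounded (f : (int -> bool) -> R) : bloc f ->
  exists2 B, 0 <= B & forall w, `|f w| <= B.
Proof.
move=> [m fm]; have [K Km] := pickle_bound m.
have lf : loc (fun s : past bool => f (fun i => s (pickle i))).
  by exists K => s s' ss'; apply: fm => i im; apply: ss'; exact: Km.
have [B B0 fB] := loc_bounded lf; exists B => // w.
have -> : f w = f (fun i => w (odflt 0 (unpickle (pickle i)))).
  by congr f; apply/funext => i; rewrite pickleK.
exact: (fB (fun j => w (odflt 0 (unpickle j)))).
Qed.

(* [s] read as the coordinates [M - 1, M - 2, ...]; the coordinates from [M] on
   are irrelevant. *)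
Definition conf (M : nat) (s : past bool) : int -> bool :=
  fun i => s (absz (M%:Z - 1 - i)%R).

Lemma bloc_past n (f : obs) : loc f -> bloc (fun w => f (past_before n w)).
Proof.
move=> [k fk]; exists (absz n + k)%N => w w' ww'.
by apply: fk => j jk; rewrite /past_before ww'//; lia.
Qed.

Definition sign_of (c : bool) : R := if c then 1 else -1.

Definition last_is (c : bool) : obs := fun s => if s 0%N == c then 1 else 0.

Lemma loc_last_is c : loc (last_is c).
Proof. by exists 1%N => s s' ss'; rewrite /last_is ss'. Qed.

Context (bs : nat -> obs) (eta : nat -> R) (k : R) (k_gt0 : 0 < k)
  (bs_loc : forall n, loc (bs n)) (bs_le : forall n s, `|bs n s| <= 1 - 2 * k)
  (bs_odd : forall n, odd_obs (bs n))
  (bs_near : forall n m s, `|bs (n + m)%N s - bs n s| <= eta n).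

(** [e] is the generalized limit of the stationary means, and [E] its two-sided version, where the
    coordinates before time [M] are read from the [M]-th stationary past. The one-step equation is
    stated with [bs K] and an error, because [e] is controlled on local functions and the limit
    kernel need not be local. *)
Lemma exists_limit_measure : exists (mu : probability (biseq bool) R)
    (E : ((int -> bool) -> R) -> R) (e : obs -> R),
  [/\ forall f, bloc f -> (\int[mu]_w (f w)%:E = (E f)%:E)%E,
      forall n f, loc f -> E (fun w => f (past_before n w)) = e f,
      forall c K f, loc f -> (forall s, `|f s| <= 1) ->
        `|e (last_is c * (fun s => f (behead_past s))) -
          e ((fun s => (1 + sign_of c * bs K s) / 2) * f)| <= eta K,
      [/\ forall f, loc f -> odd_obs f -> e f = 0,
         forall f g, loc f -> loc g -> e (f + g) = e f + e g,
         forall c f, loc f -> e (c *: f) = c * e f & forall c, e (cst c) = c] &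
      forall f C J, loc f -> (forall m, C <= pi (bs (J + m)%N) f) -> C <= e f].
Proof.
have [Lm [LmD LmZ Lmc Lmle]] := @exists_generalized_limit R.
pose E (f : (int -> bool) -> R) := Lm (fun M => pi (bs M) (fun s => f (conf M s))).
pose e (f : obs) := Lm (fun M => pi (bs M) f).
have loc_conf f M : bloc f -> loc (fun s => f (conf M s) : R).
  move=> [m fm]; exists (M + m).+2 => s s' ss'.
  by apply: fm => i im; rewrite /conf ss'//; lia.
have bdE f : bloc f -> bounded_seq (fun M => pi (bs M) (fun s => f (conf M s))).
  move=> lf; have [B B0 fB] := bloc_bounded lf; exists B => M.
  by apply: (pi_norm_le k_gt0) => //; exact: loc_conf.
have bde f : loc f -> bounded_seq (fun M => pi (bs M) f).
  by move=> lf; have [B B0 fB] := loc_bounded lf; exists B => M; exact: (pi_norm_le k_gt0).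
have E_add f g : bloc f -> bloc g -> E (f + g) = E f + E g.
  move=> lf lg; rewrite /E -LmD; [|exact: bdE..]; congr Lm; apply/funext => M.
  by rewrite -(piD k_gt0)//; exact: loc_conf.
have E_scale c f : bloc f -> E (c *: f) = c * E f.
  move=> lf; rewrite /E -LmZ; last exact: bdE; congr Lm; apply/funext => M.
  by rewrite -(piZ k_gt0)//; exact: loc_conf.
have E_ge0 f : bloc f -> (forall w, 0 <= f w) -> 0 <= E f.
  move=> lf f0; rewrite -(Lmc 0) /E.
  apply: (Lmle _ _ 0%N); [by exists 0 => n; rewrite normr0|exact: bdE|move=> M _].
  by apply: (pi_ge0 k_gt0) => //; exact: loc_conf.
have E_cst : E (cst 1) = 1.
  rewrite -[RHS](Lmc 1); congr Lm; apply/funext => M.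
  exact: (pi_cst k_gt0).
have [mu muE] := exists_biseq_measure E_add E_scale E_ge0 E_cst.
have pi_shift M q f : loc f -> pi (bs M) (fun s => f (fun j => s (j + q)%N)) = pi (bs M) f.
  move=> lf; elim: q => [|q IH].
    by congr pi; apply/funext => s; congr f; apply/funext => j; rewrite addn0.
  have lq : loc (fun s : past bool => f (fun j => s (j + q)%N)).
    case: lf => m fm; exists (m + q)%N => s s' ss'; apply: fm => j jm.
    by apply: ss'; rewrite ltn_add2r.
  rewrite -IH -(pi_behead k_gt0 (bs_loc M) (bs_le M) lq).
  by congr pi; apply/funext => s; congr f; apply/funext => j; rewrite addnS.
have Lm_eq (x y : nat -> R) N : bounded_seq x -> bounded_seq y ->
    (forall n, (N <= n)%N -> x n = y n) -> Lm x = Lm y.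
  move=> bx by_ xy; apply/eqP; rewrite eq_le; apply/andP; split;
    by apply: (Lmle _ _ N) => // n /xy ->.
have e_le (f g : obs) K : loc f -> loc g ->
    (forall m, pi (bs (K + m)%N) f <= pi (bs (K + m)%N) g) -> e f <= e g.
  move=> lf lg fg; apply: (Lmle _ _ K); [exact: bde|exact: bde|].
  by move=> n Kn; rewrite -(subnKC Kn).
have e_cst c : e (cst c) = c.
  by rewrite -[RHS]Lmc; congr Lm; apply/funext => M; exact: (pi_cst k_gt0).
have eD f g : loc f -> loc g -> e (f + g) = e f + e g.
  move=> lf lg; rewrite /e -LmD; [|exact: bde..]; congr Lm; apply/funext => M.
  exact: (piD k_gt0).
exists mu, E, e; split => //.
(* Once [M] exceeds the absolute value of [n], the past before [n] is the past before [M] without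
   its last [M - n] spins, which leaves the stationary mean unchanged. *)
- move=> n f lf; apply: (Lm_eq _ _ (absz n).+1).
  + exact: (bdE _ (bloc_past n lf)).
  + exact: bde.
  move=> M nM; rewrite -(pi_shift M (absz (M%:Z - n)%R) f lf).
  congr pi; apply/funext => s; congr f; apply/funext => j.
  by rewrite /past_before /conf; congr s; lia.
- move=> c K f lf f1.
  pose h : obs := last_is c * (fun s => f (behead_past s)).
  pose q K : obs := fun s => (1 + sign_of c * bs K s) / 2.
  have lq M : loc (q M) := loc_map (fun x => (1 + sign_of c * x) / 2) (bs_loc M).
  have lh : loc h.
    apply: locM; first exact: loc_last_is.
    exact: loc_behead.
  have lqf M : loc (q M * f) by apply: locM => //; exact: lq.
  have trh M : tr (bs M) h = q M * f.
    apply/funext => s; rewrite trE /h /q /last_is !fctE /sign_of /=.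
    by case: (c) => /=; ring.
  have eta_ge0 : 0 <= eta K by exact: le_trans (bs_near K 0%N (fun=> false)).
  (* The one-step equation is exact for the kernel of index [K + M]; exchanging this kernel for that
     of index [K] costs [eta K]. *)
  have near M : `|pi (bs (K + M)%N) h - pi (bs (K + M)%N) (q K * f)| <= eta K.
    rewrite -(pi_tr k_gt0 (bs_loc _) (bs_le _) lh) trh -(piB k_gt0)//.
    apply: (pi_norm_le k_gt0 (bs_loc _) (bs_le _)); first by apply: locB; exact: lqf.
    move=> s; rewrite !fctE /q -mulrBl normrM -[eta K]mulr1; apply: ler_pM => //.
    have := bs_near K M s; rewrite /sign_of.
    by case: (c); rewrite !ler_norml => /andP[? ?]; apply/andP; split; lra.
  rewrite ler_norml; apply/andP; split.
    have -> : - eta K <= e h - e (q K * f) = (e (q K * f) <= e (h + cst (eta K))).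
      by rewrite eD// e_cst; apply/idP/idP; lra.
    apply: (e_le _ _ K) => //; first by apply: locD.
    move=> M; rewrite (piD k_gt0)// (pi_cst k_gt0)//.
    by have := near M; rewrite ler_norml => /andP[]; lra.
  have -> : e h - e (q K * f) <= eta K = (e h <= e (q K * f + cst (eta K))).
    by rewrite eD// e_cst; apply/idP/idP; lra.
  apply: (e_le _ _ K) => //; first by apply: locD.
  move=> M; rewrite (piD k_gt0)// (pi_cst k_gt0)//.
  by have := near M; rewrite ler_norml => /andP[]; lra.
- split => // [f lf fodd|c f lf].
    by rewrite -[RHS]Lmc; congr Lm; apply/funext => M; apply: (pi_odd k_gt0).
  rewrite /e -LmZ; last exact: bde.
  by congr Lm; apply/funext => M; rewrite -(piZ k_gt0).
- move=> f C J lf Cf; rewrite -(e_cst C); apply: (e_le _ _ J) => // m.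
  by rewrite (pi_cst k_gt0).
Qed.

End LimitMeasure.

(** * Shift invariance *)

Section PastMarginals.
Context {R : realType} (mu : probability (biseq bool) R) (e : (past bool -> R) -> R).
Local Notation obs := (past bool -> R).
Context (mu_past : forall n (f : obs), loc f ->
  (\int[mu]_w (f (past_before n w))%:E = (e f)%:E)%E).

Definition indicator (p : past bool -> bool) : obs := fun s => (p s)%:R.

Definition past_event n (p : past bool -> bool) : set (int -> bool) :=
  [set w | p (past_before n w)].

Lemma indicator_dep k p : dep k (indicator p) ->
  forall s s', (forall j, (j < k)%N -> s j = s' j) -> p s = p s'.
Proof.
move=> pk s s' /pk; rewrite /indicator.
by case: (p s); case: (p s') => // /eqP; rewrite ?oner_eq0// eq_sym oner_eq0.
Qed.

Lemma bdep_past_event n p k : dep k (indicator p) ->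
  bdep (absz n + k) (fun w => past_event n p w).
Proof.
move=> /indicator_dep pk w w' ww'; rewrite /past_event /=.
congr (is_true _); apply: pk => j jk; rewrite /past_before ww'//; lia.
Qed.

Lemma measurable_past_event n p : loc (indicator p) ->
  measurable (past_event n p : set (biseq bool)).
Proof. by case=> k /(@bdep_past_event n) /measurable_biseq_event. Qed.

Lemma mu_past_event n p : loc (indicator p) ->
  mu (past_event n p) = (e (indicator p))%:E.
Proof.
move=> lp; rewrite -(mu_past n lp) -[X in mu X]setIT -integral_indic//; last first.
  exact: measurable_past_event.
have inE' w : (w \in past_event n p) = p (past_before n w) by apply/idP/idP; rewrite inE.
by apply: eq_integral => w _; rewrite indicE inE'.
Qed.

Definition local_events : set (set (int -> bool)) :=
  [set B | exists m (p : (int -> bool) -> Prop), bdep m p /\ B = [set w | p w]].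

Lemma biseq_local_events :
  @measurable _ (biseq bool) = <<s local_events >>.
Proof.
apply/seteqP; split.
  apply: sub_sigma_algebra2 => _ [i [j [eta [ij ->]]]].
  exists (`|i| + `|j|)%N, (fun w => forall k, i <= k <= j -> w k = eta k); split => //.
  move=> w w' ww'; have {}ww' k : i <= k <= j -> w k = w' k by move=> ?; apply: ww'; lia.
  by apply/propext; split => h k kij; rewrite ?ww' ?h// -ww' ?h.
apply: smallest_sub; first exact: sigma_algebra_measurable.
by move=> _ [m [p [/measurable_biseq_event mp ->]]].
Qed.


Lemma local_events_setI : setI_closed local_events.
Proof.
move=> _ _ [m [p [pm ->]]] [m' [p' [pm' ->]]].
exists (maxn m m'), (fun w => p w /\ p' w); split => // w w' ww'.
rewrite (pm w w') ?(pm' w w')// => i im; apply: ww'; rewrite leq_max im ?orbT//.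
Qed.

Lemma measurable_shift : measurable_fun setT (@Defs.shift bool : biseq bool -> biseq bool).
Proof.
apply: (@measurability _ _ _ (biseq bool) setT _ (@cylinders bool)) => //.
move=> _ [_ [i [j [eta [ij ->]]]] <-].
rewrite setTI.
apply: (@measurable_biseq_event (`|i| + `|j| + 2)
  (fun w => forall k, i <= k <= j -> Defs.shift w k = eta k)) => w w' ww'.
have {}ww' k : i <= k <= j -> Defs.shift w k = Defs.shift w' k.
  by move=> ?; apply: ww'; lia.
by apply/propext; split => h k kij; rewrite ?ww' ?h// -ww' ?h.
Qed.

(** Local events generate the sigma-algebra and are stable under intersection; each is an event of
    some past, whose law does not depend on the time at which that past ends. *)
Lemma mu_shift_invariant : shift_invariant mu.
Proof.
move=> B mB.
pose X : {mfun biseq bool >-> biseq bool} := mfun_Sub (mem_set measurable_shift).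
have -> : mu (@Defs.shift bool @^-1` B) = distribution mu X B by [].
apply: (@measure_unique _ R (biseq bool) local_events (fun=> setT)) => //.
- exact: biseq_local_events.
- exact: local_events_setI.
- by move=> _; exists 0%N, (fun=> True); split => //; apply/seteqP; split.
- by rewrite bigcup_const//; exists 0%N.
- move=> _ [m [p [pm ->]]].
  (* [q] reads the window from [- m] to [m] backwards from time [m + 1]. *)
  pose q s := `[< p (fun i => s (absz (m%:Z - i)%R)) >].
  have lq : loc (indicator q).
    exists (m + m).+1 => s s' ss'; rewrite /indicator /q; congr (_%:R).
    congr asbool; apply: pm => i im; apply: ss'; lia.
  have mE n : [set w | p (fun i => w (i + n)%R)] = past_event (m.+1%:Z + n) q.
    apply/seteqP; split => w /=; rewrite /past_event /q /=.
    - move=> pw; apply/asboolP; rewrite (pm _ (fun i => w (i + n)))// => i im.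
      by rewrite /past_before; congr w; lia.
    - move=> /asboolP; rewrite (pm _ (fun i => w (i + n)))// => i im.
      by rewrite /past_before; congr w; lia.
  transitivity (mu (past_event (m.+1%:Z + 1) q)); first by rewrite -mE.
  rewrite mu_past_event// -(mu_past_event (m.+1%:Z + 0) lq) -mE; congr (mu _).
  apply/seteqP; split => w /=; rewrite (_ : (fun i => w (i + 0)) = w)//;
    by apply/funext => i; rewrite addr0.
- by move=> _; rewrite (le_lt_trans (probability_le1 _ _))// ltry.
Qed.

End PastMarginals.

(** * Compatibility *)

Section PastSigmaAlgebra.
Context {R : realType} (n : int).
Local Notation obs := (past bool -> R).
Local Notation pastT := (g_sigma_algebraType (@coord_events_before bool n)).

Lemma coord_event_measurable i (c : bool) : i < n ->
  measurable ([set w | w i = c] : set pastT).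
Proof.
by move=> iN; apply: sub_sigma_algebra; exists i, [set c]; split => //; apply/seteqP; split.
Qed.

Lemma past_event_measurable (p : past bool -> bool) : loc (@indicator R p) ->
  measurable (past_event n p : set pastT).
Proof.
move=> [k /indicator_dep pk].
pose r (v : k.-tuple bool) : past bool := nth false v.
have -> : past_event n p = \bigcup_(v in [set v | p (r v)])
    \bigcap_(j in [set j : 'I_k | true]) [set w | w (n - j.+1%:Z) = r v j].
  apply/seteqP; split => [w /= pw|w [v /= pv] h]; last first.
    by rewrite /past_event /= (pk _ (r v))// => j jk; exact: (h (Ordinal jk) isT).
  pose v := [tuple of mkseq (past_before n w) k].
  have rv j : (j < k)%N -> past_before n w j = r v j by move=> jk; rewrite /r /= nth_mkseq.
  by exists v => /= [|j _]; [rewrite -(pk (past_before n w))|rewrite -rv].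
apply: fin_bigcup_measurable; first exact: finite_finset.
move=> v _; apply: fin_bigcap_measurable; first exact: finite_finset.
by move=> j _; apply: coord_event_measurable; lia.
Qed.

Lemma measurable_past_loc (f : obs) : loc f ->
  measurable_fun setT (fun w : pastT => f (past_before n w)).
Proof.
move=> [k fk] _ B mB; rewrite setTI.
rewrite (_ : _ @^-1` B = past_event n (fun s => `[< B (f s) >])); last first.
  by apply/seteqP; split => w /asboolP.
by apply: past_event_measurable; exists k => s s' ss'; rewrite /indicator (fk s s').
Qed.

Definition past_events : set (set (int -> bool)) :=
  [set B | exists p, loc (@indicator R p) /\ B = past_event n p].

(** Provides generators stable under intersection for the induction in [integral_kernel_past]. *)
Lemma past_sigma_algebra :
  @measurable _ pastT = <<s past_events >>.
Proof.
apply/seteqP; split.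
  apply: sub_sigma_algebra2 => _ [i [S [iN ->]]].
  exists (fun s => `[< S (s (absz (n - 1 - i)%R)) >]); split.
    by exists (absz (n - 1 - i)%R).+1 => s s' ss'; rewrite /indicator ss'.
  apply/seteqP; split => w; rewrite /past_event/= /past_before.
    move=> h; apply/asboolP; rewrite (_ : n - _ = i)//; lia.
  move/asboolP; rewrite (_ : n - _ = i)//; lia.
apply: smallest_sub; first exact: sigma_algebra_measurable.
by move=> _ [p [lp ->]]; exact: past_event_measurable.
Qed.

Lemma past_events_setI : setI_closed past_events.
Proof.
move=> _ _ [p [lp ->]] [p' [lp' ->]].
exists (fun s => p s && p' s); split; last first.
  by apply/seteqP; split => w /andP.
rewrite (_ : indicator _ = indicator p * indicator p' :> obs); first exact: locM.
by apply/funext => s; rewrite /indicator !fctE /=; case: (p s); case: (p' s); rewrite ?mul1r ?mul0r.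
Qed.

Lemma past_measurable (B : set (int -> bool)) :
  <<s @coord_events_before bool n >> B -> measurable (B : set (biseq bool)).
Proof.
move: B; apply: smallest_sub; first exact: sigma_algebra_measurable.
move=> _ [i [S [_ ->]]]; apply: (@measurable_biseq_event `|i| (fun w => S (w i))).
by move=> w w' ww'; rewrite ww'.
Qed.

End PastSigmaAlgebra.

Section Compatible.
Context {R : realType} (mu : probability (biseq bool) R) (e : (past bool -> R) -> R).
Local Notation obs := (past bool -> R).
Context (mu_past : forall n (f : obs), loc f ->
  (\int[mu]_w (f (past_before n w))%:E = (e f)%:E)%E).
Context (b : obs) (bs : nat -> obs) (eta : nat -> R) (k : R)
  (bs_loc : forall n, loc (bs n)) (bs_near : forall n s, `|b s - bs n s| <= eta n)
  (eta_cvg : eta @ \oo --> 0) (b_le : forall s, `|b s| <= 1)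
  (e_step : forall c K f, loc f -> (forall s, `|f s| <= 1) ->
     `|e (last_is c * (fun s => f (behead_past s))) -
       e ((fun s => (1 + sign_of c * bs K s) / 2) * f)| <= eta K)
  (e_addc : forall f c, loc f -> e (f + cst c) = e f + c).

Definition kernel_of (f : obs) (a : bool) : obs := fun s => (1 + sign_of a * f s) / 2.

Section FixedCoordinate.
Context (n : int) (c : bool).
Local Notation pastT := (g_sigma_algebraType (@coord_events_before bool n)).

Let h (w : biseq bool) : R := kernel_of b c (past_before n w).

Let kernel_near K s : `|kernel_of b c s - kernel_of (bs K) c s| <= eta K.
Proof.
have := bs_near K s; rewrite /kernel_of /sign_of.
by case: (c); rewrite !ler_norml => /andP[? ?]; apply/andP; split; lra.
Qed.

Let kernel_loc K : loc (kernel_of (bs K) c).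
Proof. exact: (loc_map (fun x => (1 + sign_of c * x) / 2) (bs_loc K)). Qed.

(** A pointwise limit of the kernels of [bs m], which look at finitely many coordinates before
    [n]. *)
Lemma measurable_kernel_past : measurable_fun setT (h : pastT -> R).
Proof.
apply: (@measurable_realfun.measurable_fun_cvg _ _ _ _
  (fun m (w : pastT) => kernel_of (bs m) c (past_before n w))).
  by move=> m; apply: measurable_past_loc.
move=> w _; apply/cvgrPdist_le => /= eps eps0.
have /cvgrPdist_le/(_ _ eps0) := eta_cvg.
apply: filterS => m /=; rewrite sub0r normrN => em.
by apply: le_trans (kernel_near m _) _; apply: le_trans em; exact: ler_norm.
Qed.

Lemma kernel_of_bounded s : 0 <= kernel_of b c s <= 1.
Proof.
have := b_le s; rewrite /kernel_of /sign_of.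
by case: (c); rewrite !ler_norml => /andP[? ?]; apply/andP; split; lra.
Qed.

Lemma integrable_kernel_past : mu.-integrable setT (EFin \o h).
Proof.
apply: (@bounded_integrable _ _ _ mu h 1).
  move=> _ B mB; apply: past_measurable; exact: measurable_kernel_past.
by move=> w; have /andP[? ?] := kernel_of_bounded (past_before n w); rewrite ger0_norm.
Qed.

(** Both sides are compared with the local kernel of [bs K]: one comparison uses uniform closeness,
    the other the one-step equation [e_step]. Each costs [eta K], and [K] is arbitrary. *)
Lemma integral_kernel_past_event p : loc (@indicator R p) ->
  (\int[mu]_(w in past_event n p) (h w)%:E =
   mu ([set w | w n = c] `&` past_event n p))%E.
Proof.
move=> lp; have mp := measurable_past_event n lp.
have ip : mu.-integrable (past_event n p) (EFin \o h).
  by apply: integrableS integrable_kernel_past.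
have -> : [set w | w n = c] `&` past_event n p =
    past_event (n + 1) (fun s => (s 0%N == c) && p (behead_past s)).
  have E w : past_before (n + 1) w 0%N = w n by rewrite /past_before; congr w; lia.
  have E' w : behead_past (past_before (n + 1) w) = past_before n w.
    by apply/funext => j; rewrite /behead_past /past_before; congr w; lia.
  apply/seteqP; split => w; rewrite /past_event /= E E'.
    by case=> /eqP -> ->.
  by case/andP => /eqP -> ->.
have indE : indicator (fun s => (s 0%N == c) && p (behead_past s)) =
    last_is c * (fun s => indicator p (behead_past s)) :> obs.
  apply/funext => s; rewrite /indicator /last_is !fctE /=.
  by case: (_ == _); rewrite ?mul1r ?mul0r.
have lt : loc (indicator (fun s => (s 0%N == c) && p (behead_past s)) : obs).
  by rewrite indE; apply: locM; [exact: loc_last_is|exact: (loc_behead lp)].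
rewrite (mu_past_event mu_past)// -(fineK (integrable_fin_num mp ip)).
set r := fine _; congr (_%:E); apply/eqP; rewrite -subr_eq0 -normr_le0.
have ind1 s : `|indicator p s : R| <= 1.
  by rewrite /indicator; case: (p s); rewrite ?normr0 ?normr1.
suff near K : `|r - e (indicator (fun s => (s 0%N == c) && p (behead_past s)))| <= 2 * eta K.
  rewrite leNgt; apply/negP => x0.
  have /cvgrPdist_lt/(_ _ (divr_gt0 x0 (ltr0Sn _ 1))) [N _ /(_ N (leqnn N))] := eta_cvg.
  by rewrite sub0r normrN => xN; have := ler_norm (eta N); have := near N; lra.
have := e_step c K lp ind1; rewrite -indE.
set u := e _; set v := e _ => uv.
have lqp : loc (kernel_of (bs K) c * indicator p) by exact: locM.
have eta0 : 0 <= eta K by exact: le_trans (bs_near K (fun=> false)).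
have rE : (\int[mu]_w (h w * indicator p (past_before n w))%:E = r%:E)%E.
  rewrite /r fineK ?(integrable_fin_num mp ip)// [RHS]integral_mkcond.
  apply: eq_integral => w _; rewrite patchE /indicator.
  have -> : (w \in past_event n p) = p (past_before n w) by apply/idP/idP; rewrite inE.
  by case: (p _); rewrite ?mulr1 ?mulr0.
have ihp : mu.-integrable setT (EFin \o (fun w => h w * indicator p (past_before n w))).
  apply: (@bounded_integrable _ _ _ mu _ 1).
    apply: measurable_realfun.measurable_funM.
      move=> _ B mB; apply: past_measurable; exact: measurable_kernel_past.
    by apply: measurable_bloc; exact: (bloc_past n lp).
  move=> w; have /andP[? ?] := kernel_of_bounded (past_before n w).
  by rewrite normrM mulr_ile1// ger0_norm.
have iqp t : mu.-integrable setT (EFin \o (fun w =>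
    (kernel_of (bs K) c * indicator p + cst t) (past_before n w))).
  have lq : loc (kernel_of (bs K) c * indicator p + cst t) by exact: locD.
  have [B _ qB] := loc_bounded lq.
  by apply: (@bounded_integrable _ _ _ mu _ B) => //;
    apply: measurable_bloc; exact: (bloc_past n lq).
have hq w : `|h w * indicator p (past_before n w) -
    (kernel_of (bs K) c * indicator p) (past_before n w)| <= eta K.
  rewrite /h [X in _ - X]/GRing.mul /= -mulrBl normrM -[eta K]mulr1; exact: ler_pM.
have up : r <= v + eta K.
  rewrite -lee_fin -rE -e_addc// -(mu_past n); last exact: locD.
  apply: le_integral; [by []|exact: ihp|exact: iqp|move=> w _; rewrite lee_fin].
  by have := hq w; rewrite ler_norml !fctE => /andP[_ ]; rewrite lerBlDr addrC.
have lo : v + - eta K <= r.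
  rewrite -lee_fin -rE -e_addc// -(mu_past n); last exact: locD.
  apply: le_integral; [by []|exact: iqp|exact: ihp|move=> w _; rewrite lee_fin].
  by have := hq w; rewrite ler_norml !fctE => /andP[+ _]; rewrite lerBrDl.
by move: uv; rewrite !ler_norml => /andP[? ?]; apply/andP; split; lra.
Qed.

Lemma integral_kernel_past B : <<s @coord_events_before bool n >> B ->
  (\int[mu]_(w in B) (h w)%:E = mu ([set w | w n = c] `&` B))%E.
Proof.
have mE : measurable ([set w | w n = c] : set (biseq bool)).
  by apply: (@measurable_biseq_event `|n| (fun w => w n = c)) => w w' ->.
have iS D : measurable (D : set (biseq bool)) -> mu.-integrable D (EFin \o h).
  by move=> mD; apply: integrableS integrable_kernel_past.
have PT : (\int[mu]_w (h w)%:E = mu ([set w | w n = c] `&` setT))%E.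
  have lT : loc (@indicator R (fun=> true)) by exists 0%N.
  by have := integral_kernel_past_event lT; rewrite (_ : past_event n _ = setT)//;
    apply/seteqP; split.
move=> SB; have mG := past_sigma_algebra (R := R) n.
have {SB} : @measurable _ pastT B by [].
rewrite mG; move: B.
apply: (@dynkin_induction _ pastT _
  (fun B => \int[mu]_(w in B) (h w)%:E = mu ([set w | w n = c] `&` B))%E) => //.
- exact: past_events_setI.
- by move=> _ [p [lp ->]]; exact: integral_kernel_past_event.
- move=> S /past_measurable mS PS.
  have mS' : measurable (~` S : set (biseq bool)) by exact: measurableC.
  have fS := integrable_fin_num mS (iS _ mS).
  have cancel (x y z : \bar R) : z \is a fin_num -> (x + z = y + z)%E -> x = y.
    by move=> fz /(congr1 (fun u => u - z)%E); rewrite !addeK.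
  apply: (cancel _ _ _ fS); rewrite [in RHS]PS -measureU; [|exact: measurableI..|]; last first.
    by rewrite setIACA setICl setI0.
  rewrite -setIUr; move: PT; rewrite -(setvU S) => PT.
  apply: etrans PT; rewrite integral_setU//.
  + by rewrite setvU; case/integrableP: integrable_kernel_past.
  + by apply/disj_set2P; rewrite setICl.
- move=> F mF tF PF.
  have mF' i : measurable (F i : set (biseq bool)) := past_measurable (mF i).
  rewrite integral_bigcup//; last by apply: iS; exact: bigcup_measurable.
  rewrite setI_bigcupr measure_semi_bigcup.
  + by apply: eq_eseriesr => i _; exact: PF.
  + by move=> i; exact: measurableI.
  + by apply: trivIset_setIl.
  + by apply: bigcup_measurable => i _; exact: measurableI.
Qed.

End FixedCoordinate.

Lemma kernel_compatible : compatible mu (fun a x => kernel_of b a x).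
Proof.
move=> n a; exists (fun w => kernel_of b a (past_before n w)); split; last exact: aeW.
split; [exact: measurable_kernel_past|exact: integrable_kernel_past|].
exact: integral_kernel_past.
Qed.

End Compatible.

(** * Oscillation and variation of the limit kernel *)

Section KernelRegularity.
Context {R : realType}.
Local Notation obs := (past bool -> R).
Context (b : obs) (bs : nat -> obs) (eta : nat -> R) (k del L : R)
  (bs_loc : forall n, loc (bs n)) (bs_near : forall n s, `|b s - bs n s| <= eta n)
  (eta_cvg : eta @ \oo --> 0) (k_gt0 : 0 < k) (del_gt0 : 0 < del) (del_le : del <= 2^-1)
  (bs_le : forall n s, `|bs n s| <= 1 - 2 * k)
  (bs_lips : forall n, lips L (bs n))
  (bs_incr : forall n, incr (bs n - base_mean del)).
Local Notation g := (fun a x => kernel_of b a x).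

Lemma eta_ge0 n : 0 <= eta n.
Proof. exact: le_trans (bs_near n (fun=> false)). Qed.

Lemma eta_small e : 0 < e -> exists n, eta n < e.
Proof.
move=> e0; have /cvgrPdist_lt/(_ _ e0) [N _ /(_ N (leqnn N))] := eta_cvg.
by rewrite sub0r normrN => h; exists N; exact: le_lt_trans (ler_norm _) h.
Qed.

Lemma limit_le (x y c : R) : (forall n, x <= y + c * eta n) -> 0 <= c -> x <= y.
Proof.
move=> h c0; rewrite leNgt; apply/negP => yx.
have c1 : 0 < c + 1 by lra.
have [n en] : exists n, eta n < (x - y) / (c + 1) by apply: eta_small; apply: divr_gt0; lra.
have := h n; have := eta_ge0 n; move: en; rewrite ltr_pdivlMr// => *; nra.
Qed.

Lemma limit_bound s : `|b s| <= 1 - 2 * k.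
Proof.
apply: (@limit_le _ _ 1) => // n; have := bs_near n s; have := bs_le n s.
by rewrite mul1r => h1 h2; rewrite -(subrK (bs n s) (b s)); apply: le_trans (ler_normD _ _) _; lra.
Qed.

Lemma limit_incr s j :
  base_mean del (upd s j true) - base_mean del (upd s j false) <=
  b (upd s j true) - b (upd s j false).
Proof.
apply: (@limit_le _ _ 2) => // n.
have := bs_near n (upd s j true); have := bs_near n (upd s j false).
have := bs_incr n s j; rewrite !fctE !ler_norml => ? /andP[? ?] /andP[? ?]; lra.
Qed.

Lemma kernel_of_is_kernel : is_kernel (fun a x => kernel_of b a x).
Proof.
have k0 := k_gt0; split => [a x|x].
  have := limit_bound x; rewrite ler_norml /kernel_of /sign_of => /andP[? ?].
  by case: a; apply/andP; split; lra.
by rewrite big_bool /= /kernel_of /sign_of; field.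
Qed.

Lemma kernel_of_tv z z' : tv g z z' = `|b z - b z'| / 2.
Proof.
rewrite /tv big_bool /= /kernel_of /sign_of.
have -> : (1 + 1 * b z) / 2 - (1 + 1 * b z') / 2 = (b z - b z') / 2 by ring.
have -> : (1 + -1 * b z) / 2 - (1 + -1 * b z') / 2 = - ((b z - b z') / 2) by ring.
by rewrite normrN normrM (ger0_norm (x := 2^-1))//; field.
Qed.

Lemma kernel_of_bounded_below : (0 < ereal_inf [set e | exists a x, e = (g a x)%:E])%E.
Proof.
have k0 := k_gt0; apply: (@lt_le_trans _ _ k%:E); first by rewrite lte_fin.
apply: le_ereal_inf_tmp => _ [a [x ->]]; rewrite lee_fin.
have := limit_bound x; rewrite ler_norml /kernel_of /sign_of => /andP[? ?].
by case: a; lra.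
Qed.

Lemma Osc_ge0 j : (0 <= Osc g j)%E.
Proof.
apply: ereal_sup_ubound; exists (fun=> false), (fun=> false); split => //.
by rewrite kernel_of_tv subrr normr0 mul0r.
Qed.

Lemma Osc_ge_gap j s : (((b (upd s j true) - b (upd s j false)) / 2)%R%:E <= Osc g j.+1)%E.
Proof.
apply: (@le_trans _ _ (tv g (upd s j true) (upd s j false))%:E).
  by rewrite lee_fin kernel_of_tv ler_pM2r// ler_norm.
apply: ereal_sup_ubound; exists (upd s j true), (upd s j false); split => // i ij.
by rewrite eqSS in ij; rewrite /upd (negbTE ij).
Qed.

(** The first three terms already give [(1 - del / 2) + del / 2 + del / 2], the oscillations of
    [base_mean], which [limit_incr] passes on to [b]. *)
Lemma sum_Osc_gt1 : (1 < \sum_(1 <= j <oo) Osc g j)%E.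
Proof.
have d0 := del_gt0.
have gap j : (j < 3)%N -> ((if j == 0%N then 1 - del / 2 else del / 2)%:E <= Osc g j.+1)%E.
  move=> /(base_gap del_gt0) [s sE]; apply: le_trans (Osc_ge_gap j s).
  by rewrite lee_fin ler_pdivlMr// mulrC -sE limit_incr.
apply: (@lt_le_trans _ _ (1 + del / 2)%:E); first by rewrite lte_fin; lra.
apply: (@le_trans _ _ (\sum_(1 <= j < 4) Osc g j)%E); last first.
  by apply: nneseries_lim_ge => j _ _; exact: Osc_ge0.
rewrite big_ltn// big_ltn// big_nat1.
have -> : (1 + del / 2)%:E = ((1 - del / 2)%:E + ((del / 2)%:E + (del / 2)%:E))%E.
  by rewrite -!EFinD; congr EFin; lra.
by apply: leeD; [exact: (gap 0%N)|apply: leeD; [exact: (gap 1%N)|exact: (gap 2%N)]].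
Qed.

Lemma sum_Osc_le : (\sum_(1 <= j <oo) Osc g j <= L%:E)%E.
Proof.
apply: lime_le; first by apply: is_cvg_nneseries => j _ _; exact: Osc_ge0.
apply: nearW => J; apply/lee_addgt0Pr => e e0.
(* The approximation error [eta n] occurs once per term, hence [n] is chosen after the number of
   terms. *)
have [n en] : exists n, eta n < e / (J.+1)%:R by apply: eta_small; exact: divr_gt0.
have [c [c0 cL bsc]] := bs_lips n.
have oscj j : (Osc g j.+1 <= (c j + eta n)%:E)%E.
  apply: ge_ereal_sup => _ [z [z' [zz' ->]]]; rewrite lee_fin kernel_of_tv.
  rewrite ler_pdivrMr//.
  have h : `|bs n z - bs n z'| <= 2 * c j.
    have zE : upd z' j (z j) = z.
      by apply/funext => i; rewrite /upd; case: eqP => [->//|/eqP ij]; rewrite zz'.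
    have : `|bs n (upd z' j (z j)) - bs n (upd z' j (z' j))| <= 2 * c j.
      have := bsc z' j; have := c0 j.
      case: (z j); case: (z' j) => ?; rewrite ?subrr ?normr0 ?mulr_ge0//.
      by rewrite distrC.
    by rewrite zE upd_eta.
  have := bs_near n z; have := bs_near n z'; move: h.
  by rewrite !ler_norml => /andP[? ?] /andP[? ?] /andP[? ?]; apply/andP; split; lra.
apply: (@le_trans _ _ (\sum_(1 <= j < J) (c j.-1 + eta n)%:E)%E).
  by rewrite !big_nat; apply: lee_sum => -[|j].
rewrite sumEFin -EFinD lee_fin.
rewrite big_add1 big_mkord big_split /= sumr_const card_ord.
apply: lerD; first exact: cL.
rewrite -mulr_natl; move: en; rewrite ltr_pdivlMr// => en.
apply: le_trans (ltW en); rewrite mulrC ler_wpM2l ?eta_ge0// ler_nat.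
exact: leq_trans (leq_pred J) (leqnSn J).
Qed.

(** Beyond the finite memory of [bs n], the variation of the limit kernel is at most [eta n]. *)
Lemma Var_cvg0 : Var g j @[j --> \oo] --> 0%E.
Proof.
have near n : \forall j \near \oo, (Var g j <= (eta n)%:E)%E.
  have [K bK] := bs_loc n; exists K => // j /= Kj.
  apply: ge_ereal_sup => _ [z [z' [zz' ->]]]; rewrite lee_fin kernel_of_tv ler_pdivrMr//.
  have zE : bs n z = bs n z' by apply: bK => i iK; apply: zz'; exact: leq_trans Kj.
  have := bs_near n z; have := bs_near n z'; rewrite zE.
  by rewrite !ler_norml => /andP[? ?] /andP[? ?]; apply/andP; split; lra.
have Var0 j : (0 <= Var g j)%E.
  apply: ereal_sup_ubound; exists (fun=> false), (fun=> false); split => //.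
  by rewrite kernel_of_tv subrr normr0 mul0r.
apply/fine_cvgP; split.
  apply: filterS (near 0%N) => j h; rewrite ge0_fin_numE//; exact: le_lt_trans h (ltry _).
apply/cvgrPdist_le => e e0; have [n en] := eta_small e0.
apply: filterS (near n) => j h /=; rewrite sub0r normrN ger0_norm ?fine_ge0//.
rewrite -lee_fin fineK; last by rewrite ge0_fin_numE//; exact: le_lt_trans h (ltry _).
by apply: le_trans h _; rewrite lee_fin ltW.
Qed.

End KernelRegularity.

(** * Failure of the Gaussian concentration bound *)

Lemma expR_le_1D2x (R : realType) (x : R) : 0 <= x <= 2^-1 -> expR x <= 1 + 2 * x.
Proof.
move=> /andP[x0 x1].
have h : 1 - x <= expR (- x) by exact: expR_ge1Dx.
have e1 : expR x * expR (- x) = 1 by rewrite -expRD subrr expR0.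
have := expR_gt0 x; move: (expR x) (expR (- x)) h e1 => u v h e1 u0.
have h2 : u * (1 - x) <= 1 by rewrite -[leRHS]e1 ler_pM2l.
have h3 : 1 <= (1 + 2 * x) * (1 - x) by nra.
have x2 : 0 < 1 - x by lra.
by rewrite -(ler_pM2r x2); exact: le_trans h3.
Qed.

(** The square of the tangent inequality at [y / 2]. *)
Lemma expR_ge_quadratic (R : realType) (y : R) : `|y| <= 1 -> 1 + y + y * y / 4 <= expR y.
Proof.
rewrite ler_norml => /andP[y1 y2].
have h : 1 + y / 2 <= expR (y / 2) by exact: expR_ge1Dx.
have -> : expR y = expR (y / 2) * expR (y / 2) by rewrite -expRD -splitr.
have h0 : 0 <= 1 + y / 2 by lra.
by apply: le_trans (ler_pM h0 h0 h h); lra.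
Qed.

Section NoGaussianBound.
Context {R : realType} (mu : probability (biseq bool) R) (e : (past bool -> R) -> R).
Local Notation obs := (past bool -> R).
Context (mu_past : forall n (f : obs), loc f ->
  (\int[mu]_w (f (past_before n w))%:E = (e f)%:E)%E)
  (e_odd : forall f, loc f -> odd_obs f -> e f = 0)
  (eD : forall f g, loc f -> loc g -> e (f + g) = e f + e g)
  (eZ : forall c f, loc f -> e (c *: f) = c * e f) (e_cst : forall c, e (cst c) = c)
  (variance_unbounded : forall C, exists n, (0 < n)%N /\
     n%:R * C <= e (spin_sum n * spin_sum n)).

Definition total_spin n (v : 'I_n.+1 -> bool) : R := \sum_(j < n.+1) (if v j then 1 else -1).

Lemma delta_total_spin n (l : R) j : 0 <= l ->
  (0 <= delta (fun v => (l * total_spin (n := n) v)%R) j <= (2 * l)%:E)%E.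
Proof.
move=> l0; apply/andP; split.
  apply: ereal_sup_ubound; exists true, true, (fun=> true).
  by rewrite subrr normr0.
apply: ge_ereal_sup => _ [a [c [w ->]]]; rewrite lee_fin -mulrBr normrM ger0_norm//.
rewrite mulrC ler_wpM2r// /total_spin -sumrB (bigD1 j)//= big1 => [|i ij]; last first.
  by rewrite /subst_at (negbTE ij) subrr.
rewrite addr0 /subst_at eqxx.
by case: a; case: c; rewrite ler_norml; apply/andP; split; lra.
Qed.

Lemma on_coords_total_spin n (l : R) w :
  on_coords (fun v => l * total_spin (n := n) v) w =
  (l *: spin_sum n.+1) (past_before n.+1%:Z w).
Proof.
rewrite /on_coords /total_spin /spin_sum /GRing.scale /=; congr (_ * _).
(* A past lists the coordinates backwards from [n]. *)
rewrite (reindex_inj rev_ord_inj) /=; apply: eq_bigr => i _.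
rewrite /spin /past_before.
have -> : n.+1%:Z - i.+1%:Z = (n.+1 - i.+1)%N :> int; last by [].
by rewrite -subzn.
Qed.

Lemma odd_spin_sum n : odd_obs (spin_sum n : obs).
Proof.
by move=> s; rewrite /spin_sum -sumrN; apply: eq_bigr => i _; exact: odd_spin.
Qed.

(** The bound is tested on a small multiple [l] of the spin sum, of mean zero by oddness, where
    second-order expansions of both sides compare its variance with [C] times the number of
    spins. *)
Lemma no_GCB : ~ GCB mu.
Proof.
(* The expansions leave [l ^+ 2 / 4 * variance <= 8 * C * l ^+ 2 * N], which a variance above
   [32 * C * N] contradicts. *)
move=> [C C0 gcb]; have [[|n] [n0 nC]] := variance_unbounded (32 * C + 1); first by [].
have [N NE] : exists N : R, N = n.+1%:R by exists n.+1%:R.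
have N1 : 1 <= N by rewrite NE ler1n.
(* The two upper bounds keep the exponents within the ranges of [expR_ge_quadratic] and
   [expR_le_1D2x]. *)
have [l [l0 lN lC]] : exists l : R, [/\ 0 < l, l * N <= 1 & 4 * C * l ^+ 2 * N <= 2^-1].
  have d0 : 0 < N * (1 + 4 * C) by apply: mulr_gt0; lra.
  exists (N * (1 + 4 * C))^-1; have := mulVf (lt0r_neq0 d0).
  have : 0 < (N * (1 + 4 * C))^-1 by rewrite invr_gt0.
  move: (N * _)^-1 => l l0; rewrite mulrA; have : 0 < l * N by apply: mulr_gt0 => //; lra.
  have : l <= l * N by rewrite ler_peMr// ltW.
  rewrite (_ : 4 * C * l ^+ 2 * N = (l * N * (4 * C)) * l); last by ring.
  move: (l * N) => x lx x0 xC.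
  have xC' : x * (4 * C) = 1 - x by lra.
  have x1 : x <= 1 by rewrite -subr_ge0 -xC'; apply: mulr_ge0; lra.
  by split => //; rewrite xC'; have := ler_wpM2l (_ : 0 <= 1 - x) lx; nra.
pose f := fun v => l * total_spin (n := n) v.
have fd j : (0 <= delta f j <= (2 * l)%:E)%E by apply: delta_total_spin; exact: ltW.
have lf : local_fun f.
  by move=> j; have /andP[_ h] := fd j; exact: le_lt_trans h (ltry _).
have sq : delta_sqnorm f <= 4 * l ^+ 2 * N.
  apply: (@le_trans _ _ (\sum_(j < n.+1) (2 * l) ^+ 2)).
    apply: ler_sum => j _; have /andP[h0 h1] := fd j.
    have fi : delta f j \is a fin_num by rewrite ge0_fin_numE//; exact: lf.
    by apply: lerXn2r; rewrite ?nnegrE ?fine_ge0 ?mulr_ge0 ?(ltW l0)// -lee_fin fineK.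
  by rewrite sumr_const card_ord -[leLHS]mulr_natr -NE exprMn; lra.
have lS : loc (l *: spin_sum n.+1 : obs) by apply: locZ; exact: loc_spin_sum.
have EF : ('E_mu[on_coords f] = 0)%E.
  rewrite unlock; transitivity (e (l *: spin_sum n.+1))%:E.
    by rewrite -(mu_past n.+1%:Z lS); apply: eq_integral => w _; rewrite on_coords_total_spin.
  by rewrite eZ// e_odd ?mulr0//; exact: odd_spin_sum.
have := gcb n f lf; rewrite /= EF /=.
under eq_fun do rewrite subr0.
move=> le_exp.
have lo : ((1 + l ^+ 2 / 4 * e (spin_sum n.+1 * spin_sum n.+1))%:E <=
    'E_mu[fun w => expR (on_coords f w)])%E.
  pose q : obs := cst 1 + l *: spin_sum n.+1 + (l ^+ 2 / 4) *: (spin_sum n.+1 * spin_sum n.+1).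
  have lSS : loc ((l ^+ 2 / 4) *: (spin_sum n.+1 * spin_sum n.+1) : obs).
    by apply: locZ; apply: locM; exact: loc_spin_sum.
  have lq : loc q by apply: locD => //; apply: locD.
  have eq_ : e q = 1 + l ^+ 2 / 4 * e (spin_sum n.+1 * spin_sum n.+1).
    rewrite /q eD; [|by auto..]; rewrite eD; [|by auto..].
    rewrite !eZ ?e_cst; [|by auto..].
    by rewrite e_odd ?mulr0 ?addr0//; exact: odd_spin_sum.
  rewrite -eq_ -(mu_past n.+1%:Z lq) unlock.
  have [B _ qB] := loc_bounded lq.
  have le : loc (fun s => expR ((l *: spin_sum n.+1 : obs) s)) by exact: loc_map.
  have [B' _ eB'] := loc_bounded le.
  apply: le_integral => //.
  - by apply: (@bounded_integrable _ _ _ mu _ B) => //;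
    apply: measurable_bloc; exact: (bloc_past _ lq).
  - apply: (@bounded_integrable _ _ _ mu _ B') => //.
      rewrite (_ : (fun w => _) =
          fun w => expR ((l *: spin_sum n.+1 : obs) (past_before n.+1%:Z w))).
        by apply: measurable_bloc; exact: (bloc_past _ le).
      by apply/funext => w; rewrite on_coords_total_spin.
    by move=> w; rewrite on_coords_total_spin; exact: eB'.
  - move=> w _; rewrite lee_fin on_coords_total_spin.
    have -> : q (past_before n.+1%:Z w) = 1 + (l *: spin_sum n.+1 : obs) (past_before n.+1%:Z w) +
        (l *: spin_sum n.+1 : obs) (past_before n.+1%:Z w) *
        (l *: spin_sum n.+1 : obs) (past_before n.+1%:Z w) / 4.
      by rewrite /q !fctE /GRing.scale /=; ring.
    apply: expR_ge_quadratic; apply: le_trans _ lN.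
    rewrite /GRing.scale /= normrM (ger0_norm (ltW l0)).
    by rewrite NE; apply: ler_wpM2l; [exact: ltW|exact: spin_sum_norm].
have := le_trans lo le_exp; rewrite lee_fin => hh.
have h1 : expR (C * delta_sqnorm f) <= 1 + 2 * (4 * C * l ^+ 2 * N).
  apply: le_trans (expR_le_1D2x (x := 4 * C * l ^+ 2 * N) _).
    rewrite ler_expR (_ : 4 * C * l ^+ 2 * N = C * (4 * l ^+ 2 * N)); last by ring.
    by apply: ler_wpM2l => //; exact: ltW.
  by rewrite lC andbT !mulr_ge0 ?sqr_ge0//; lra.
have l2 : 0 < l ^+ 2 by rewrite exprn_gt0.
move: nC; rewrite -NE; have := le_trans hh h1.
move: (e _) (l ^+ 2) l2 N1 => u v v0; move: (N) => M; nra.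
Qed.

End NoGaussianBound.

Theorem corollary3p1 (R : realType) (eps : R) (eps_gt0 : 0 < eps) :
  exists (g : bool -> past bool -> R) (mu : probability (biseq bool) R),
    [/\ is_kernel g, shift_invariant mu, compatible mu g,
        (1 < \sum_(1 <= j <oo) Osc g j <= (1 + eps)%:E)%E &
        ~ GCB mu] /\
    (Var g j @[j --> \oo] --> 0%E /\
     (0 < ereal_inf [set e | exists a x, e = (g a x)%:E])%E).
Proof.
have [del [k [bs [eta [L [[d0 dl k0 Ll] bsP eP near var]]]]]] := exists_kernel_sequence eps_gt0.
have bs_loc n : loc (bs n) by have [] := bsP n.
have bs_odd n : odd_obs (bs n) by have [] := bsP n.
have bs_incr n : incr (bs n - base_mean del) by have [] := bsP n.
have bs_lips n : lips L (bs n) by have [] := bsP n.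
have bs_le n s : `|bs n s| <= 1 - 2 * k by have [_ _ _ _] := bsP n.
have [b bN] := exists_uniform_limit near.
have eta_cvg : eta @ \oo --> 0.
  apply: (@squeeze_cvgr _ _ _ _ (cst 0) (fun n => 2^-1 ^+ n)); [|exact: cvg_cst|].
    by apply: nearW => n; have /andP[/ltW -> ->] := eP n.
  by apply: cvg_expr; rewrite ger0_norm ?invr_ge0// invf_lt1 ?ltr1n.
have [mu [E [e [muE Ee e_step [e_odd eD eZ e_cst] e_lb]]]] :=
  exists_limit_measure k0 bs_loc bs_le bs_odd near.
have mu_past n f : loc f -> (\int[mu]_w (f (past_before n w))%:E = (e f)%:E)%E.
  by move=> lf; rewrite muE ?Ee//; exact: bloc_past.
have b_le := limit_bound bN eta_cvg bs_le.
have b_le1 s : `|b s| <= 1 by apply: le_trans (b_le s) _; lra.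
exists (fun a x => kernel_of b a x), mu; split; last first.
  split; first exact: (Var_cvg0 bs_loc bN eta_cvg).
  exact: (kernel_of_bounded_below bN eta_cvg k0 bs_le).
split.
- exact: (kernel_of_is_kernel bN eta_cvg k0 bs_le).
- exact: (mu_shift_invariant mu_past).
- apply: (kernel_compatible mu_past bs_loc bN eta_cvg b_le1 e_step) => f c lf.
  by rewrite eD ?e_cst//; exact: loc_cst.
- apply/andP; split; first exact: (sum_Osc_gt1 bN eta_cvg d0 bs_incr).
  apply: le_trans (sum_Osc_le bN eta_cvg bs_lips) _; by rewrite lee_fin.
- apply: (no_GCB mu_past e_odd eD eZ e_cst) => C.
  have [n [J [n0 CJ]]] := var C; exists n; split => //.
  apply: (e_lb _ _ J); last exact: CJ.
  by apply: locM; exact: loc_spin_sum.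
Qed.
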